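(* Let $F\colon S(n)\to\mathbb{R}$ be sublinear and uniformly elliptic, let $u$ be a viscosity supersolution of $F(\mathcal{H}w)=0$ in $\mathbb{R}^n$, and let $\mu\geq 0$ be a Radon measure on $\mathbb{R}^n$. Define the convolution \[w(x):=(u*\mu)(x)=\int_{\mathbb{R}^n}u(x-y)\,\mu(dy)\] and assume that one of the following conditions holds. 1. $w\not\equiv\infty$, and for all $R>0$ there exists a $\mu$-integrable function $C_R$ such that $u^-(x-y)\leq C_R(y)$ for all $x\in B(0,R)$. 2. $w\not\equiv\infty$ and $u\geq 0$. 3. $u(x)=c|x|^{\frac{p-n}{p-1}}$ for some $c\geq 0$ and $2\leq p<n$, and $\int_{|y|\geq 1}|y|^{\frac{p-n}{p-1}}\,\mu(dy)<\infty$. 4. $w\not\equiv\infty$ and $\mu$ has compact support. Then $w$ is a viscosity supersolution of the equation $F(\mathcal{H}w)=0$ in $\mathbb{R}^n$.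
   Context: Here $n\geq 2$ and $S(n)$ is the space of symmetric real $n\times n$ matrices, partially ordered by $X\leq Y$ iff $\xi^TX\xi\leq\xi^TY\xi$ for all $\xi\in\mathbb{R}^n$; $\mathcal{H}w$ is the Hessian matrix of $w$; $B(0,R)$ is the open ball. $F$ is sublinear if $F(X+Y)\leq F(X)+F(Y)$ and $F(tX)=tF(X)$ for all $X,Y\in S(n)$, $t\geq 0$. $F$ is uniformly elliptic if there are constants $0<\lambda\leq\Lambda$ such that $\lambda\operatorname{tr}A\leq F(X+A)-F(X)\leq\Lambda\operatorname{tr}A$ for all $X,A\in S(n)$ with $A\geq 0$. The negative part of $f$ is $f^-(x):=-\min\{f(x),0\}\geq 0$. A viscosity supersolution of $F(\mathcal{H}w)=0$ in an open set $\Omega$ is a function $u\colon\Omega\to(-\infty,\infty]$ that is lower semicontinuous, finite on a dense subset of $\Omega$, and such that whenever $x_0\in\Omega$ and a $C^2$ function $\phi$ satisfies $\phi(x_0)=u(x_0)$ and $\phi\leq u$ near $x_0$, then $F(\mathcal{H}\phi(x_0))\leq 0$. *)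

(* Defs.v *)
From mathcomp Require Import all_boot all_order all_algebra.
From mathcomp Require Import all_classical all_reals all_analysis.

Set Implicit Arguments.
Unset Strict Implicit.
Unset Printing Implicit Defensive.

Import Order.TTheory GRing.Theory Num.Theory.
Import numFieldNormedType.Exports.

Local Open Scope classical_set_scope.
Local Open Scope ring_scope.

(* The points of R^n are row vectors.  The library norm on ['rV[R]_n] is the
   sup norm; it induces the usual topology, but [enorm] is needed wherever the
   Euclidean length itself occurs. *)
Definition enorm (R : realType) (n : nat) (x : 'rV[R]_n) : R :=
  Num.sqrt (\sum_(i < n) x ord0 i ^+ 2).

Definition eball0 (R : realType) (n : nat) (r : R) : set 'rV[R]_n :=
  [set x | enorm x < r].

Section Operators.
Variables (R : realType) (n : nat).

Definition lesymmx (X Y : 'M[R]_n) : Prop :=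
  forall xi : 'rV[R]_n,
    (xi *m X *m xi^T) ord0 ord0 <= (xi *m Y *m xi^T) ord0 ord0.

(* An operator S(n) -> R is encoded as a function on all matrices, of which only
   the values on symmetric matrices are ever constrained or used. *)
Definition sublinear (F : 'M[R]_n -> R) : Prop :=
  (forall X Y, X \is symmetricmx -> Y \is symmetricmx -> F (X + Y) <= F X + F Y) /\
  (forall X t, X \is symmetricmx -> 0 <= t -> F (t *: X) = t * F X).

Definition uniformly_elliptic (F : 'M[R]_n -> R) : Prop :=
  exists lambda Lambda : R, [/\ 0 < lambda, lambda <= Lambda &
    forall X A, X \is symmetricmx -> A \is symmetricmx -> lesymmx 0 A ->
      lambda * \tr A <= F (X + A) - F X <= Lambda * \tr A].

Definition partial (i : 'I_n) (f : 'rV[R]_n -> R) : 'rV[R]_n -> R :=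
  'D_(delta_mx ord0 i) f.

Definition hessian (f : 'rV[R]_n -> R) (x : 'rV[R]_n) : 'M[R]_n :=
  \matrix_(i, j) partial i (partial j f) x.

Definition C2_on (U : set 'rV[R]_n) (f : 'rV[R]_n -> R) : Prop :=
  forall x, U x ->
    [/\ {for x, continuous f},
        forall i, derivable f x (delta_mx ord0 i),
        forall i, {for x, continuous (partial i f)},
        forall i j, derivable (partial j f) x (delta_mx ord0 i) &
        forall i j, {for x, continuous (partial i (partial j f))}].

(* Viscosity supersolutions of F(Hw) = 0 in the whole space.  The test function
   phi only has to be C^2, and to stay below u, in some open neighbourhood U of
   x0. *)
Definition viscosity_supersolution
    (F : 'M[R]_n -> R) (u : 'rV[R]_n -> \bar R) : Prop :=
  [/\ forall x, u x != -oo%E,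
      lower_semicontinuous u,
      dense [set x | u x \is a fin_num] &
      forall (x0 : 'rV[R]_n) (phi : 'rV[R]_n -> R) (U : set 'rV[R]_n),
        open_nbhs x0 U -> C2_on U phi ->
        (phi x0)%:E = u x0 -> (forall x, U x -> ((phi x)%:E <= u x)%E) ->
        F (hessian phi x0) <= 0].

End Operators.

Definition borelRn (R : realType) (n : nat) :=
  g_sigma_algebraType (@open 'rV[R]_n).

Section Measures.
Variables (R : realType) (n : nat).
Local Open Scope ereal_scope.

Definition Radon (mu : {measure set (borelRn R n) -> \bar R}) : Prop :=
  [/\ forall K : set 'rV[R]_n, compact K -> mu K < +oo,
      forall A : set (borelRn R n), measurable A ->
        mu A = ereal_inf [set mu U | U in [set U : set 'rV[R]_n |
                                            open U /\ A `<=` U]] &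
      forall U : set 'rV[R]_n, open U ->
        mu U = ereal_sup [set mu K | K in [set K : set 'rV[R]_n |
                                            compact K /\ K `<=` U]]].

Definition msupport (mu : {measure set (borelRn R n) -> \bar R})
    : set 'rV[R]_n :=
  [set x | forall U : set 'rV[R]_n, open_nbhs x U -> 0 < mu U].

Definition convolution (u : 'rV[R]_n -> \bar R)
    (mu : {measure set (borelRn R n) -> \bar R}) (x : 'rV[R]_n) : \bar R :=
  \int[mu]_(y in [set: borelRn R n]) u (x - (y : 'rV[R]_n))%R.

(* |x|^a for a < 0, with value +oo at the origin ([powR] has 0 `^ a = 0 there).
   In a multiple c * |x|^a the library convention 0 * +oo = 0 applies, so that
   c = 0 gives the zero function. *)
Definition enorm_negpow (a : R) (x : 'rV[R]_n) : \bar R :=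
  if x == 0%R then +oo else (enorm x `^ a)%:E.

End Measures.

(* Main.v *)
Require Import Defs.
From mathcomp Require Import all_boot all_order all_algebra.
From mathcomp Require Import all_classical all_reals all_analysis.
From mathcomp Require Import measurable_realfun.
From mathcomp Require Import ring lra.

(** F is a supremum of linear operators [X |-> tr (S X S^T)] with [S] invertible,
    and the supremum is attained at any prescribed [X0] (Hahn-Banach and a
    Cholesky factorization).  After the change of variables [S], every translate
    of [u] is superharmonic.  Comparing it with the heat flow of a step function
    gives a mean-value inequality [\sum_j p_j inf_(cell j) u <= u center] with
    Gaussian weights [p_j], up to a factor [1 - exp (- K ^ 2)] for the cube of
    side [2 K]; unlike the viscosity inequality, it is linear in [u] and can be
    integrated against [mu].  The infima over small balls, integrated against
    [mu], increase to [w], so the inequality passes to [w].  If a test function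
    touching [w] from below had [F (hessian) = tr (S X0 S^T) > 0], the second
    moments of the weights would give a gain of order [K ^ -2] at scale [1 / K],
    which beats the loss.  Conditions 2 and 4 provide the integrable bound on
    the negative parts directly; under 3 one has [u >= 0], and only the finiteness
    of [w] somewhere is left, by the restriction of [mu] to a ball. *)

Set Implicit Arguments.
Unset Strict Implicit.
Unset Printing Implicit Defensive.

Import Order.TTheory GRing.Theory Num.Theory.
Import numFieldNormedType.Exports.

Local Open Scope classical_set_scope.
Local Open Scope ring_scope.

(** A test function touching [w] from below says nothing about a single translate of [u], so the
    viscosity inequality cannot be integrated in [y]; this forces the detour through a pointwise
    inequality linear in [u]. The heat flow supplies it because the flow of the indicator of a box
    is explicit: a product of differences of the normal distribution function, with computable
    moments. Time is measured by the standard deviation [sg], which runs up to 1. As [u] is only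
    lower semicontinuous, each step value is an infimum over a ball that contains the cell with a
    margin [rho]; the margin makes the comparison hold at small times. On the boundary of a larger
    cube nothing is known of [u] beyond nonnegativity (after adding [C y]), but there the flow is at
    most [exp (- K^2)] times its value at the centre: hence the lost factor. Gaussian tails are
    smaller than any power of [K], so bounding them by [K^-3] is enough against the gain. [S] is
    chosen for the Hessian at the touching point, where the linear operator equals [F]; elsewhere
    only [tr (S X S^T) <= F X] enters. *)

(** * Monotonicity from derivatives on an interval *)

Section RealCalculus.
Variable R : realType.
Implicit Types (f df : R -> R) (a b x : R).

Lemma is_derive_within_continuous f df a b :
  (forall x, a <= x <= b -> is_derive x 1 f (df x)) ->
  {within `[a, b], continuous f}.
Proof.
move=> fd; apply: derivable_within_continuous => x.
by rewrite in_itv/= => /fd[].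
Qed.

Lemma mean_value f df a b : a <= b ->
  (forall x, a <= x <= b -> is_derive x 1 f (df x)) ->
  exists2 x, a <= x <= b & f b - f a = df x * (b - a).
Proof.
move=> ab fd.
have [||x xab ->] := @MVT_segment R f df a b ab.
- by move=> x; rewrite in_itv/= => /andP[/ltW ? /ltW ?]; apply: fd; apply/andP.
- exact: is_derive_within_continuous fd.
by exists x => //; move: xab; rewrite in_itv.
Qed.

Lemma is_derive_ge0_homo f df a b : a <= b ->
  (forall x, a <= x <= b -> is_derive x 1 f (df x)) ->
  (forall x, a <= x <= b -> 0 <= df x) -> f a <= f b.
Proof.
move=> ab fd df0; have [x xab fE] := mean_value ab fd.
by rewrite -subr_ge0 fE mulr_ge0 ?df0// subr_ge0.
Qed.

Lemma is_derive_le_sub f g df dg a b : a <= b ->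
  (forall x, a <= x <= b -> is_derive x 1 f (df x)) ->
  (forall x, a <= x <= b -> is_derive x 1 g (dg x)) ->
  (forall x, a <= x <= b -> df x <= dg x) -> f b - f a <= g b - g a.
Proof.
move=> ab fd gd le; rewrite lerBlDr addrAC -lerBlDr lerBlDr -lerBlDr.
have : (g \- f) a <= (g \- f) b.
  apply: (is_derive_ge0_homo (df := dg \- df)) => // x xab.
    exact: (@is_deriveB _ _ _ _ _ _ _ _ _ (gd x xab) (fd x xab)).
  by rewrite /= subr_ge0 le.
rewrite /=; lra.
Qed.

End RealCalculus.

(** * The normal distribution function *)

Section Gaussian.
Variable R : realType.
Implicit Types x y z : R.

Definition gpdf (x : R) : R := expR (- x ^+ 2 / 2).

Lemma gpdf_gt0 x : 0 < gpdf x. Proof. exact: expR_gt0. Qed.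

Lemma gpdfN x : gpdf (- x) = gpdf x. Proof. by rewrite /gpdf sqrrN. Qed.

Lemma is_derive_gpdf x : is_derive x 1 gpdf (- x * gpdf x).
Proof.
rewrite /gpdf.
have h : is_derive x 1 (fun y : R => - y ^+ 2 / 2) (- x).
  have h1 : is_derive x (1:R) ((2^-1:R) \*: (- (id ^+ 2 : R -> R))) ((2^-1:R) *: (- ((2%:R * id x ^+ 1) *: (1:R)))).
    exact: is_deriveZ.
  have -> : (fun y : R => - y ^+ 2 / 2) = ((2^-1:R) \*: (- (id ^+ 2 : R -> R))).
    by apply/funext => y /=; rewrite /GRing.scale/= mulrC.
  by apply: is_derive_eq; rewrite /GRing.scale/= expr1; lra.
have := @is_derive1_comp R expR (fun y => - y ^+ 2 / 2) x _ _ (is_derive_expR _) h.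
by move=> h2; apply: is_derive_eq; rewrite mulrC.
Qed.

(* [Phi] is the distribution function of the standard normal law and [c] its
   density at 0. *)
Record gauss_cdf (c : R) (Phi : R -> R) : Prop := GaussCdf {
  gauss_c_gt0 : 0 < c;
  gauss_deriv : forall x, is_derive x 1 Phi (c * gpdf x);
  gauss_ge0 : forall x, 0 <= Phi x;
  gauss_le1 : forall x, Phi x <= 1;
  gauss_sym : forall x, Phi (- x) = 1 - Phi x;
  gauss_tail : forall x, 1 <= x -> 1 - Phi x <= c * gpdf x }.

Lemma gauss_primitive :
  exists2 c : R, 0 < c & exists G : R -> R, forall x, is_derive x 1 G (c * gpdf x).
Proof.
exists (normal_peak 1); first by rewrite normal_peak_gt0.
exists (fun x => \int[lebesgue_measure]_(t in `]-oo, x]) (normal_pdf 0 1 t)).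
move=> x.
have pE : normal_peak 1 * gpdf x = normal_pdf 0 1 x.
  rewrite /normal_pdf (negbTE (oner_neq0 R)) /normal_fun /gpdf; congr (_ * expR _).
  by rewrite subr0 expr1n.
have xx1 : x < x + 1 by rewrite ltrDl.
have [|||d dE] := @continuous_FTC1 R (normal_pdf 0 1) (BInfty R true) x (x + 1) xx1.
- apply: (@integrableS _ _ _ _ setT) => //; exact: integrable_normal_pdf.
- first [exact: ltNyr | exact: num_real | exact: (num_real x)].
- exact: (continuous_normal_pdf (oner_neq0 R)).
by split => //; rewrite pE -dE derive1E.
Qed.

(** The total mass is never computed: the primitive is made odd, its supremum [L] is finite by the
    tail estimate, and division by [L] normalises it. Symmetry and the bounds 0 and 1 then come from
    oddness and [G <= L]. *)
Lemma gauss_cdf_exists : exists c Phi, gauss_cdf c Phi.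
Proof.
have [c c0 [G0 dG0]] := gauss_primitive.
pose G x := G0 x - G0 0.
have dG x : is_derive x 1 G (c * gpdf x).
  have h := @is_deriveB _ _ _ _ _ _ _ _ _ (dG0 x) (is_derive_cst (G0 0) x 1).
  by apply: is_derive_eq; rewrite subr0.
have G_0 : G 0 = 0 by rewrite /G subrr.
(* Both sides have the derivative [- c gpdf x] and vanish at 0. *)
have GN x : G (- x) = - G x.
  wlog x0 : x / 0 <= x.
    move=> h; have [/h//|/ltW x0] := leP 0 x.
    by rewrite -{2}(opprK x) (h (- x)) ?oppr_ge0 ?opprK.
  have dGN y : is_derive y 1 (G \o -%R) (- (c * gpdf y)).
    have h := @is_derive1_comp R G -%R y _ _ (dG _) (is_deriveN (is_derive_id y 1)).
    by apply: is_derive_eq; rewrite gpdfN mulrN1.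
  have dGo y : is_derive y 1 (- G) (- (c * gpdf y)) by exact: is_deriveN.
  have h1 := is_derive_le_sub x0 (fun y _ => dGN y) (fun y _ => dGo y) (fun y _ => lexx _).
  have h2 := is_derive_le_sub x0 (fun y _ => dGo y) (fun y _ => dGN y) (fun y _ => lexx _).
  move: h1 h2; rewrite /= !oppr0 -![(- G) _]/(- G _) G_0 !subr0 oppr0 !subr0.
  by move=> h1 h2; apply/eqP; rewrite eq_le h1 h2.
have Gle x y : x <= y -> G x <= G y.
  move=> xy; apply: (is_derive_ge0_homo xy (fun y _ => dG y)) => z _.
  by rewrite mulr_ge0 ?ltW ?gpdf_gt0.
(* For [z >= 1] the density [gpdf z] is at most [z gpdf z], the derivative of [- gpdf]. *)
have Gtail x y : 1 <= x -> x <= y -> G y - G x <= c * gpdf x.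
  move=> x1 xy.
  have dg z : is_derive z 1 (fun t => - (c * gpdf t)) (c * (z * gpdf z)).
    have h : is_derive z 1 (fun t => - (c * gpdf t)) _ :=
      is_deriveN (is_deriveZ c (is_derive_gpdf z)).
    by apply: is_derive_eq; rewrite /GRing.scale/=; ring.
  have h := @is_derive_le_sub _ _ _ _ _ _ _ xy (fun y _ => dG y) (fun y _ => dg y).
  apply: le_trans (h _) _.
    by move=> z /andP[xz _]; rewrite ler_pM2l// ler_peMl ?(ltW (gpdf_gt0 z))// (le_trans x1).
  have := mulr_gt0 c0 (gpdf_gt0 y); lra.
pose S := range G.
have Sub : ubound S (G 1 + c * gpdf 1).
  move=> _ [x _ <-]; have [x1|/ltW x1] := leP x 1.
    by rewrite (le_trans (Gle _ _ x1))// lerDl mulr_ge0 ?ltW ?gpdf_gt0.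
  by have := Gtail _ _ (lexx 1) x1; lra.
have hS : has_sup S by split; [exists (G 0), 0|exists (G 1 + c * gpdf 1)].
pose L := sup S.
have GL x : G x <= L by apply: (ub_le_sup hS.2); exists x.
have Ltail x : 1 <= x -> L - G x <= c * gpdf x.
  move=> x1; rewrite lerBlDr; apply: (ge_sup hS.1) => _ [y _ <-].
  have [xy|/ltW yx] := leP x y; first by have := Gtail _ _ x1 xy; lra.
  by have := Gle _ _ yx; have := mulr_gt0 c0 (gpdf_gt0 x); lra.
have L0 : 0 < L.
  have [x x01] := mean_value (ler01 : 0 <= 1 :> R) (fun y _ => dG y).
  rewrite G_0 !subr0 mulr1 => GE; apply: lt_le_trans (GL 1).
  by rewrite GE mulr_gt0 ?gpdf_gt0.
exists (c / L / 2), (fun x => (G x / L + 1) / 2); split.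
- by rewrite !divr_gt0.
- move=> x.
  have h : is_derive x 1 (fun y => L^-1 / 2 * G y + 2^-1) _ :=
    is_deriveD (is_deriveZ (L^-1 / 2) (dG x)) (is_derive_cst (2^-1 : R) x 1).
  have -> : (fun x => (G x / L + 1) / 2) = (fun y => L^-1 / 2 * G y + 2^-1).
    by apply/funext => y; lra.
  by apply: is_derive_eq; rewrite /GRing.scale/=; ring.
- move=> x; rewrite divr_ge0// -lerBlDr sub0r ler_pdivlMr// mulN1r lerNl -GN.
  exact: GL.
- move=> x; rewrite ler_pdivrMr// mul1r -lerBrDr ler_pdivrMr//.
  by have := GL x; lra.
- by move=> x; rewrite GN; field; rewrite gt_eqF.
- move=> x x1; have := Ltail _ x1 => h.
  have -> : 1 - (G x / L + 1) / 2 = (L - G x) / L / 2 by field; rewrite gt_eqF.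
  have -> : c / L / 2 * gpdf x = c * gpdf x / L / 2 by ring.
  by rewrite ler_pM2r// ler_pM2r// invr_gt0.
Qed.

End Gaussian.

(** * Second-order Taylor expansion of C^2 functions of several variables *)

Section SecondOrderTaylor.
Variables (R : realType) (n : nat).
Implicit Types (f g : 'rV[R]_n -> R) (x v z : 'rV[R]_n).

Local Notation e_ i := (delta_mx ord0 i : 'rV[R]_n).

Lemma line_quotientE f x v (t : R) :
  (fun h : R => h^-1 *: (((fun s : R => f (x + s *: v)) \o shift t) (h *: (1 : R))
      - f (x + t *: v))) =
  (fun h : R => h^-1 *: ((f \o shift (x + t *: v)) (h *: v) - f (x + t *: v))).
Proof.
apply/funext => h /=; congr (_ *: (f _ - _)).
by rewrite -[h *: 1]/(h * 1) mulr1 scalerDl addrCA.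
Qed.

Lemma is_derive_line f x v (t d : R) : is_derive (x + t *: v) v f d ->
  is_derive t (1 : R) (fun s : R => f (x + s *: v)) d.
Proof.
move=> [df dE]; split.
  by rewrite /derivable line_quotientE.
by rewrite -dE /derive line_quotientE.
Qed.

Lemma line_is_derive f x v (d : R) :
  is_derive (0 : R) (1 : R) (fun s : R => f (x + s *: v)) d ->
  is_derive x v f d.
Proof.
move=> [df dE]; split.
  by move: df; rewrite /derivable line_quotientE scale0r addr0.
by rewrite -dE /derive line_quotientE scale0r addr0.
Qed.

Lemma coord_norm_le z i : `|z ord0 i| <= `|z|.
Proof.
rewrite [leRHS]/Num.norm/= mx_normrE.
exact: (le_bigmax _ (fun ij : 'I_1 * 'I_n => `|z ij.1 ij.2|) (ord0, i)).
Qed.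

Lemma norm_le_coord z (r : R) : 0 <= r ->
  (forall i, `|z ord0 i| <= r) -> `|z| <= r.
Proof.
move=> r0 h; rewrite [leLHS]/Num.norm/= mx_normrE.
by apply: bigmax_le => // -[i j] _ /=; rewrite ord1.
Qed.

(* Moving one coordinate at a time, so that only partial derivatives occur. *)
Lemma partial_bound_increment f (df : 'I_n -> 'rV[R]_n -> R) x z (e : R) :
  0 <= e ->
  (forall i y, `|y| <= `|z| -> is_derive (x + y) (e_ i) f (df i (x + y))) ->
  (forall i y, `|y| <= `|z| -> `|df i (x + y)| <= e) ->
  `|f (x + z) - f x| <= e * n%:R * `|z|.
Proof.
move=> e0 fd dfe.
pose tr k : 'rV[R]_n := \row_j (if (j < k)%N then z ord0 j else 0).
have tr_n : tr n = z by apply/rowP => j; rewrite mxE ltn_ord.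
have tr_0 : tr 0%N = 0 by apply/rowP => j; rewrite !mxE.
have step k : (k <= n)%N -> `|f (x + tr k) - f x| <= e * k%:R * `|z|.
  elim: k => [_|k IH kn]; first by rewrite tr_0 addr0 subrr normr0 mulr0 mul0r.
  pose i := Ordinal kn.
  have trS : tr k.+1 = tr k + z ord0 i *: e_ i.
    apply/rowP => j; rewrite !mxE eqxx /=.
    have [->|ji] := eqVneq j i; first by rewrite /= ltnSn ltnn add0r mulr1.
    by rewrite mulr0 addr0 ltnS leq_eqVlt -[j == k :> nat]/(j == i) (negbTE ji).
  have dline t : `|t| <= `|z ord0 i| ->
      is_derive t (1 : R) (fun s : R => f ((x + tr k) + s *: e_ i))
        (df i (x + (tr k + t *: e_ i))) /\ `|tr k + t *: e_ i| <= `|z|.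
    move=> tz; have trz : `|tr k + t *: e_ i| <= `|z|.
      apply: norm_le_coord => // j; rewrite !mxE eqxx/=.
      have [->|ji] := eqVneq j i.
        by rewrite /= ltnn add0r mulr1 (le_trans tz)// coord_norm_le.
      by rewrite mulr0 addr0; case: ifP; rewrite ?normr0// coord_norm_le.
    by split => //; apply: is_derive_line; rewrite -addrA; exact: fd.
  suff : `|f (x + tr k.+1) - f (x + tr k)| <= e * `|z|.
    move=> h; rewrite -(subrKA (f (x + tr k))) (le_trans (ler_normD _ _))//.
    rewrite -natr1 mulrDr mulr1 mulrDl addrC lerD//.
    exact: IH (ltnW kn).
  have key : forall a b : R, a <= b -> `|a| <= `|z ord0 i| -> `|b| <= `|z ord0 i| ->
      `|f (x + tr k + b *: e_ i) - f (x + tr k + a *: e_ i)| <= e * (b - a).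
    move=> a b ab az bz.
    have inab c : a <= c <= b -> `|c| <= `|z ord0 i|.
      move=> /andP[ac cb]; rewrite ler_norml; move: az bz.
      by rewrite !ler_norml => /andP[? ?] /andP[? ?]; apply/andP; split; lra.
    have [c cab ->] := mean_value (f := fun s => f ((x + tr k) + s *: e_ i)) ab
      (fun t tab => (dline t (inab t tab)).1).
    rewrite normrM [`|b - a|]ger0_norm ?subr_ge0// ler_wpM2r ?subr_ge0//.
    exact: dfe (dline c (inab c cab)).2.
  rewrite trS addrA -{2}[x + tr k]addr0 -(scale0r (e_ i)).
  have zi := coord_norm_le z i.
  have [z0|/ltW z0] := leP 0 (z ord0 i).
    apply: le_trans (key _ _ z0 _ _) _; rewrite ?normr0// subr0.
    by rewrite ler_wpM2l// -(ger0_norm z0).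
  rewrite distrC; apply: le_trans (key _ _ z0 _ _) _; rewrite ?normr0// sub0r.
  by rewrite ler_wpM2l// -(ler0_norm z0).
by have := step n (leqnn n); rewrite tr_n.
Qed.

Definition dot (a b : 'rV[R]_n) : R := (a *m b^T) ord0 ord0.
Definition bil (Y : 'M[R]_n) (a b : 'rV[R]_n) : R := (a *m Y *m b^T) ord0 ord0.

Lemma dotDr a b c : dot a (b + c) = dot a b + dot a c.
Proof. by rewrite /dot linearD/= mulmxDr mxE. Qed.
Lemma dotZr a b (t : R) : dot a (t *: b) = t * dot a b.
Proof. by rewrite /dot linearZ/= -scalemxAr mxE. Qed.
Lemma dotZl a b (t : R) : dot (t *: a) b = t * dot a b.
Proof. by rewrite /dot -scalemxAl mxE. Qed.
Lemma dotDl a b c : dot (a + b) c = dot a c + dot b c.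
Proof. by rewrite /dot mulmxDl mxE. Qed.
Lemma dot0r a : dot a 0 = 0.
Proof. by rewrite /dot trmx0 mulmx0 mxE. Qed.
Lemma dotC a b : dot a b = dot b a.
Proof.
have -> : dot b a = (a *m b^T)^T ord0 ord0 by rewrite trmx_mul trmxK.
by rewrite mxE.
Qed.
Lemma dot_delta a i : dot a (e_ i) = a ord0 i.
Proof. by rewrite /dot trmx_delta -colE mxE. Qed.
Lemma bil_dot Y a b : bil Y a b = dot (a *m Y) b.
Proof. by []. Qed.
Lemma bilDl Y a b c : bil Y (a + b) c = bil Y a c + bil Y b c.
Proof. by rewrite !bil_dot mulmxDl dotDl. Qed.
Lemma bilDr Y a b c : bil Y a (b + c) = bil Y a b + bil Y a c.
Proof. by rewrite !bil_dot dotDr. Qed.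
Lemma bilZl Y a b (t : R) : bil Y (t *: a) b = t * bil Y a b.
Proof. by rewrite !bil_dot -scalemxAl dotZl. Qed.
Lemma bilZr Y a b (t : R) : bil Y a (t *: b) = t * bil Y a b.
Proof. by rewrite !bil_dot dotZr. Qed.
Lemma bilC Y a b : bil Y a b = bil Y^T b a.
Proof.
have -> : bil Y^T b a = (a *m Y *m b^T)^T ord0 ord0 by rewrite !trmx_mul trmxK mulmxA.
by rewrite mxE.
Qed.
Lemma bil0 a b : bil 0 a b = 0.
Proof. by rewrite bil_dot mulmx0 /dot mul0mx mxE. Qed.
Lemma bil0r Y a : bil Y a 0 = 0.
Proof. by rewrite bil_dot dot0r. Qed.
Lemma bil_delta Y i j : bil Y (e_ i) (e_ j) = Y i j.
Proof. by rewrite bil_dot dot_delta -rowE mxE. Qed.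

Lemma near_le_ball (P : 'rV[R]_n -> Prop) x :
  (\forall y \near x, P y) <->
  exists2 r : R, 0 < r & forall z, `|z| <= r -> P (x + z).
Proof.
split=> [/nbhs0P/nbhs_norm0P[r /= r0 h]|[r r0 h]].
  by exists (r / 2); [rewrite divr_gt0|move=> z zr; apply: h => /=; lra].
by apply/nbhs0P/nbhs_norm0P; exists r => //= z /= /ltW; exact: h.
Qed.

Lemma is_derive_poly2 (a b c : R) :
  is_derive (0 : R) (1 : R) (fun s : R => a + s * b + s ^+ 2 * c) b.
Proof.
have h : is_derive (0 : R) (1 : R) (fun s : R => a + b * s + c * s ^+ 2) _ :=
  is_deriveD (is_deriveD (is_derive_cst a (0 : R) (1 : R))
     (is_deriveZ b (is_derive_id (0 : R) (1 : R))))
     (is_deriveZ c (is_deriveX 2 (is_derive_id (0 : R) (1 : R)))).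
have -> : (fun s : R => a + s * b + s ^+ 2 * c) = (fun s : R => a + b * s + c * s ^+ 2).
  by apply/funext => s; ring.
by apply: is_derive_eq; rewrite /GRing.scale/= expr1; ring.
Qed.

Lemma is_derive_quadratic (c : R) (b : 'rV[R]_n) (Y : 'M[R]_n) x0 x v :
  is_derive x v (fun y => c + dot b (y - x0) + bil Y (y - x0) (y - x0))
    (dot b v + bil Y (x - x0) v + bil Y v (x - x0)).
Proof.
apply: line_is_derive.
set w := x - x0.
have -> : (fun s : R => c + dot b (x + s *: v - x0) + bil Y (x + s *: v - x0) (x + s *: v - x0))
   = (fun s => (c + dot b w + bil Y w w) + s * (dot b v + bil Y w v + bil Y v w) + s ^+ 2 * bil Y v v).
  apply/funext => s; have -> : x + s *: v - x0 = w + s *: v by rewrite addrAC.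
  by rewrite dotDr dotZr bilDl !bilDr !(bilZl, bilZr); ring.
exact: is_derive_poly2.
Qed.

Lemma is_derive_linear (b : 'rV[R]_n) x0 x v :
  is_derive x v (fun y => dot b (y - x0)) (dot b v).
Proof.
have := is_derive_quadratic 0 b 0 x0 x v.
rewrite (_ : (fun y => _) = (fun y => dot b (y - x0))); last first.
  by apply/funext => y; rewrite bil0 add0r addr0.
by move=> h; apply: is_derive_eq; rewrite !bil0 !addr0.
Qed.

Lemma C2_is_derive U f x i : C2_on U f -> U x -> is_derive x (e_ i) f (partial i f x).
Proof. by move=> h Ux; have [_ h2 _ _ _] := h x Ux; split. Qed.

Lemma C2_is_derive2 U f x i j : C2_on U f -> U x ->
  is_derive x (e_ i) (partial j f) (partial i (partial j f) x).
Proof. by move=> h Ux; have [_ _ _ h2 _] := h x Ux; split. Qed.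

Lemma near_dist_le (g : 'rV[R]_n -> R) x (e : R) :
  {for x, continuous g} -> 0 < e -> \forall y \near x, `|g y - g x| <= e.
Proof.
move=> gx e0; have gx' : g y @[y --> x] --> g x := gx.
by have /cvgrPdist_le/(_ _ e0) := gx'; apply: filterS => y; rewrite distrC.
Qed.

Lemma C2_hessian_near U f x0 (e : R) : open_nbhs x0 U -> C2_on U f -> 0 < e ->
  exists2 r : R, 0 < r & forall z, `|z| <= r -> U (x0 + z) /\
    forall i j, `|partial i (partial j f) (x0 + z) - hessian f x0 i j| <= e.
Proof.
move=> [oU Ux0] fC2 e0.
apply/(near_le_ball (fun y => U y /\
  forall i j, `|partial i (partial j f) y - hessian f x0 i j| <= e)).
have [_ _ _ _ hc] := fC2 _ Ux0.
near=> y; split; first by near: y; exact: open_nbhs_nbhs.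
near: y; apply: filter_forall => i; apply: filter_forall => j.
rewrite mxE; exact: (near_dist_le (hc i j) e0).
Unshelve. all: by end_near. Qed.

(** [partial j f] minus its linear part at [x0] has as partial derivatives the variations of the
    Hessian entries, small by continuity; [partial_bound_increment] integrates them. *)
Lemma C2_partial_taylor U f x0 (e : R) : open_nbhs x0 U -> C2_on U f -> 0 < e ->
  exists2 r : R, 0 < r & forall z, `|z| <= r -> U (x0 + z) /\
    forall j, `|partial j f (x0 + z) - partial j f x0 - bil (hessian f x0) z (e_ j)|
      <= e * n%:R * `|z|.
Proof.
move=> oU fC2 e0; have [r r0 hr] := C2_hessian_near oU fC2 e0.
exists r => // z zr; split; first exact: (hr z zr).1.
move=> j; set H := hessian f x0.
pose b : 'rV[R]_n := \row_i H i j.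
have bE y : dot b y = bil H y (e_ j).
  rewrite dotC bil_dot dot_delta mxE /dot mxE; apply: eq_bigr => k _.
  by rewrite !mxE.
pose g y := partial j f y - dot b (y - x0).
have := @partial_bound_increment g (fun i y => partial i (partial j f) y - H i j) x0 z e (ltW e0).
have -> : g (x0 + z) - g x0 = partial j f (x0 + z) - partial j f x0 - bil H z (e_ j).
  rewrite /g -bE [x0 + z]addrC addrK subrr [dot b 0]/dot trmx0 mulmx0 mxE; ring.
apply=> i y yz.
  have Uy := (hr y (le_trans yz zr)).1.
  have h : is_derive (x0 + y) (e_ i) g _ :=
    is_deriveB (C2_is_derive2 i j fC2 Uy) (is_derive_linear b x0 (x0 + y) (e_ i)).
  by apply: is_derive_eq; rewrite dot_delta [b _ _]mxE.
exact: (hr y (le_trans yz zr)).2.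
Qed.

Lemma norm_delta_le i : `|e_ i| <= 1.
Proof.
apply: norm_le_coord => // j; rewrite mxE eqxx /=.
by case: (_ == _); rewrite ?normr1 ?normr0.
Qed.

(** Schwarz's argument: the second difference [D k l] is symmetric in [k] and [l], and equals
    [s^2 H k l] up to an error small against [s^2]. *)
Lemma C2_hessian_sym U f x0 i j : open_nbhs x0 U -> C2_on U f ->
  hessian f x0 i j = hessian f x0 j i.
Proof.
move=> oU fC2; set H := hessian f x0.
apply/eqP; rewrite -subr_eq0 -normr_le0; apply/ler_addgt0Pl => e' e'0; rewrite addr0.
(* [D i j] and [D j i] are each off by at most [4 e n s^2]; the denominator absorbs the sum, and the
   1 keeps it positive. *)
pose e := e' / (8 * n%:R + 1).
have n0 : 0 < 8 * n%:R + 1 :> R by rewrite ltr_wpDl// mulr_ge0.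
have e0 : 0 < e by rewrite divr_gt0.
have [r r0 hr] := C2_partial_taylor oU fC2 e0.
pose s := r / 2.
have s0 : 0 < s by rewrite divr_gt0.
have ns k (t : R) : 0 <= t <= s -> `|t *: e_ k| <= s.
  move=> /andP[t0 ts]; rewrite normrZ ger0_norm// (le_trans _ ts)//.
  by rewrite ler_piMr// norm_delta_le.
pose D k l := (f (x0 + s *: e_ k + s *: e_ l) - f (x0 + s *: e_ l)) - (f (x0 + s *: e_ k) - f x0).
have DE k l : `|D k l - s * (s * H k l)| <= s * (4 * (e * n%:R * s)).
  pose phi t := f (x0 + s *: e_ k + t *: e_ l) - f (x0 + t *: e_ l).
  have -> : D k l = phi s - phi 0 by rewrite /phi /D scale0r !addr0.
  have n1 t : 0 <= t <= s -> `|s *: e_ k + t *: e_ l| <= 2 * s.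
    move=> ts; rewrite (le_trans (ler_normD _ _))//.
    have := ns k s; have := ns l t ts; rewrite lexx (ltW s0) /= => h1 /(_ isT) h2; lra.
  have n2 t : 0 <= t <= s -> `|t *: e_ l| <= 2 * s.
    by move=> ts; rewrite (le_trans (ns _ _ ts))//; lra.
  have sr : 2 * s <= r by rewrite /s; lra.
  pose dphi t := partial l f (x0 + s *: e_ k + t *: e_ l) - partial l f (x0 + t *: e_ l).
  have dphiP t : 0 <= t <= s -> is_derive t (1 : R) phi (dphi t).
    move=> ts; have d1 := C2_is_derive l fC2 (hr _ (le_trans (n1 t ts) sr)).1.
    have d2 := C2_is_derive l fC2 (hr _ (le_trans (n2 t ts) sr)).1.
    rewrite addrA in d1.
    exact: is_deriveB (is_derive_line d1) (is_derive_line d2).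
  have [t ts ->] := mean_value (ltW s0) dphiP.
  have h1 := (hr _ (le_trans (n1 t ts) sr)).2 l.
  have h2 := (hr _ (le_trans (n2 t ts) sr)).2 l.
  rewrite subr0 mulrC -mulrBr normrM gtr0_norm// ler_pM2l//.
  have {}h1 := le_trans h1 (ler_wpM2l (mulr_ge0 (ltW e0) (ler0n _ n)) (n1 t ts)).
  have {}h2 := le_trans h2 (ler_wpM2l (mulr_ge0 (ltW e0) (ler0n _ n)) (n2 t ts)).
  have -> : dphi t - s * H k l =
    (partial l f (x0 + (s *: e_ k + t *: e_ l)) - partial l f x0 -
      bil H (s *: e_ k + t *: e_ l) (e_ l)) -
    (partial l f (x0 + t *: e_ l) - partial l f x0 - bil H (t *: e_ l) (e_ l)).
    by rewrite /dphi -[x0 + s *: e_ k + _]addrA bilDl !bilZl !bil_delta; ring.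
  by rewrite (le_trans (ler_normB _ _))//; lra.
have Dsym : D i j = D j i by rewrite /D [x0 + _ + s *: e_ j]addrAC; ring.
have h1 := DE i j; have h2 := DE j i; rewrite -Dsym in h2.
have : s * (s * `|H i j - H j i|) <= s * (s * (8 * n%:R * e)).
  have -> : s * (s * `|H i j - H j i|) =
    `|(D i j - s * (s * H j i)) - (D i j - s * (s * H i j))|.
    rewrite -{1}(gtr0_norm s0) -{2}(gtr0_norm s0) -!normrM; congr `|_|; ring.
  by rewrite (le_trans (ler_normB _ _))//; lra.
rewrite ler_pM2l// ler_pM2l// => /le_trans; apply.
by rewrite /e mulrCA ler_piMr ?(ltW e'0)// ler_pdivrMr// mul1r; lra.
Qed.

Definition gradient f x : 'rV[R]_n := \row_i partial i f x.

(** The increment bound again, for [f] minus its quadratic polynomial, whose partial derivatives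
    [C2_partial_taylor] makes small. Symmetry of [H] identifies the gradient of half the quadratic
    form. *)
Lemma C2_taylor U f x0 (e : R) : open_nbhs x0 U -> C2_on U f -> 0 < e ->
  exists2 r : R, 0 < r & forall z, `|z| <= r -> U (x0 + z) /\
    `|f (x0 + z) - f x0 - dot (gradient f x0) z - 2^-1 * bil (hessian f x0) z z|
      <= e * `|z| ^+ 2.
Proof.
move=> oU fC2 e0; set H := hessian f x0; set b := gradient f x0.
pose e' := e / (n%:R ^+ 2 + 1).
have n0 : 0 < n%:R ^+ 2 + 1 :> R by rewrite ltr_wpDl// sqr_ge0.
have e'0 : 0 < e' by rewrite divr_gt0.
have [r r0 hr] := C2_partial_taylor oU fC2 e'0.
exists r => // z zr; split; first exact: (hr z zr).1.
have HT : H^T = H by apply/matrixP => i j; rewrite mxE; exact: C2_hessian_sym oU fC2.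
pose g y := f y - (0 + dot b (y - x0) + bil (2^-1 *: H) (y - x0) (y - x0)).
have bilZ (t : R) y w : bil (t *: H) y w = t * bil H y w.
  by rewrite !bil_dot -scalemxAr dotZl.
have := @partial_bound_increment g
  (fun i y => partial i f y - partial i f x0 - bil H (y - x0) (e_ i)) x0 z (e' * n%:R * `|z|).
have -> : g (x0 + z) - g x0 = f (x0 + z) - f x0 - dot b z - 2^-1 * bil H z z.
  rewrite /g [x0 + z - x0]addrAC subrr !add0r !bilZ bil0r !dot0r; ring.
move=> h; apply: le_trans (h _ _ _) _.
- exact: (mulr_ge0 (mulr_ge0 (ltW e'0) (ler0n _ n)) (normr_ge0 z)).
- move=> i y yz; have Uy := (hr y (le_trans yz zr)).1.
  have d : is_derive (x0 + y) (e_ i) g _ :=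
    is_deriveB (C2_is_derive i fC2 Uy) (is_derive_quadratic 0 b (2^-1 *: H) x0 (x0 + y) (e_ i)).
  apply: is_derive_eq; rewrite dot_delta !bilZ [b _ _]mxE [x0 + y]addrC addrK.
  by rewrite [bil H (e_ i) y]bilC HT; lra.
- move=> i y yz; rewrite {2}[x0 + y]addrC addrK.
  rewrite (le_trans ((hr y (le_trans yz zr)).2 i))// ler_wpM2l//.
  by rewrite mulr_ge0// ltW.
have -> : e' * n%:R * `|z| * n%:R * `|z| = e' * n%:R ^+ 2 * `|z| ^+ 2 by ring.
rewrite ler_wpM2r ?sqr_ge0// /e' -mulrA ler_piMr ?(ltW e0)//.
by rewrite mulrC ler_pdivrMr// mul1r lerDl.
Qed.

End SecondOrderTaylor.

(** * Quadratic polynomials as test functions *)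

Section Quadratics.
Variables (R : realType) (n : nat).
Implicit Types (f g : 'rV[R]_n -> R) (x v z a b : 'rV[R]_n) (Y X : 'M[R]_n).

Local Notation e_ i := (delta_mx ord0 i : 'rV[R]_n).

Lemma symmetricmxE X : (X \is symmetricmx) = (X^T == X).
Proof. by rewrite is_hermitianmxE expr0 scale1r map_mx_id// eq_sym. Qed.

Lemma dot_bound a b : `|dot a b| <= n%:R * (`|a| * `|b|).
Proof.
rewrite /dot mxE (le_trans (ler_norm_sum _ _ _))//.
rewrite [leRHS](_ : _ = \sum_(i < n) `|a| * `|b|); last first.
  by rewrite sumr_const card_ord mulr_natl.
apply: ler_sum => i _; rewrite mxE normrM ler_pM//; exact: coord_norm_le.
Qed.

Lemma mulmx_bound Y : exists2 C : R, 0 <= C & forall a, `|a *m Y| <= C * `|a|.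
Proof.
pose M := \sum_(i < n) \sum_(j < n) `|Y i j|.
have M0 : 0 <= M by rewrite sumr_ge0// => i _; rewrite sumr_ge0.
exists (n%:R * M) => [|a]; first by rewrite mulr_ge0.
apply: norm_le_coord => [|j]; first by rewrite !mulr_ge0.
rewrite -dot_delta /dot trmx_delta -mulmxA -colE.
have -> : a *m col j Y = a *m (col j Y)^T^T by rewrite trmxK.
rewrite -/(dot a (col j Y)^T) (le_trans (dot_bound _ _))// -[leRHS]mulrA.
rewrite ler_wpM2l// mulrC ler_wpM2r//.
apply: norm_le_coord => // i; rewrite !mxE /M.
rewrite (bigD1 i)//= (bigD1 j)//= -addrA lerDl addr_ge0 ?sumr_ge0//.
by move=> k _; rewrite sumr_ge0.
Qed.

Lemma bil_bound Y : exists2 C : R, 0 <= C & forall a b, `|bil Y a b| <= C * (`|a| * `|b|).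
Proof.
have [C C0 h] := mulmx_bound Y.
exists (n%:R * C) => [|a b]; first by rewrite mulr_ge0.
rewrite bil_dot (le_trans (dot_bound _ _))// -mulrA ler_wpM2l// mulrA.
by rewrite ler_wpM2r.
Qed.

(** Taylor errors come in the sup norm; this lets a multiple of the identity matrix in the Hessian
    absorb them. *)
Lemma sqr_norm_le_dot z : `|z| ^+ 2 <= dot z z.
Proof.
have dz : 0 <= dot z z.
  by rewrite /dot mxE sumr_ge0// => i _; rewrite mxE -expr2 sqr_ge0.
rewrite -(sqr_sqrtr dz) ler_sqr ?nnegrE ?sqrtr_ge0//.
apply: norm_le_coord => [|i]; first exact: sqrtr_ge0.
rewrite -sqrtr_sqr ler_sqrt// /dot mxE (bigD1 i)//= mxE -expr2 lerDl.
by rewrite sumr_ge0// => j _; rewrite mxE -expr2 sqr_ge0.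
Qed.

Lemma continuous_at_dist g x :
  (forall e : R, 0 < e -> \forall y \near x, `|g y - g x| <= e) -> {for x, continuous g}.
Proof.
move=> h; have : g y @[y --> x] --> g x; last by [].
apply: (iffRL (@cvgrPdist_le _ _ _ (nbhs x) (nbhs_filter x) g (g x))) => e e0.
have := h e e0.
by apply: filterS => y; rewrite distrC.
Qed.

Definition quadratic (c : R) b Y x0 x := c + dot b (x - x0) + bil Y (x - x0) (x - x0).

Lemma continuous_quadratic c b Y x0 : continuous (quadratic c b Y x0).
Proof.
move=> x; apply: continuous_at_dist => e e0.
have [C C0 hC] := bil_bound Y.
set w := x - x0.
pose L := n%:R * `|b| + C * `|w| + C * `|w| + C.
have L0 : 0 <= L by rewrite !addr_ge0 ?mulr_ge0.
apply/(near_le_ball (fun y => `|quadratic c b Y x0 y - quadratic c b Y x0 x| <= e)).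
exists (Num.min 1 (e / (L + 1))) => [|z]; first by rewrite lt_min ltr01 divr_gt0// ltr_wpDl.
rewrite le_min => /andP[z1 ze].
rewrite /quadratic [x + z - x0]addrAC -/w.
have -> : c + dot b (w + z) + bil Y (w + z) (w + z) - (c + dot b w + bil Y w w)
  = dot b z + bil Y w z + bil Y z w + bil Y z z.
  by rewrite dotDr bilDl !bilDr; ring.
have : L * `|z| <= e.
  rewrite (le_trans (ler_wpM2l L0 ze))// mulrA ler_pdivrMr ?ltr_wpDl//.
  by rewrite mulrC ler_pM2l// lerDl.
apply: le_trans; rewrite /L !mulrDl.
rewrite (le_trans (ler_normD _ _))// lerD//; last first.
  rewrite (le_trans (hC _ _))// ler_wpM2l// ler_piMl//.
rewrite (le_trans (ler_normD _ _))// lerD//; last first.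
  by rewrite (le_trans (hC _ _))// mulrA mulrAC.
rewrite (le_trans (ler_normD _ _))// lerD//.
  by rewrite (le_trans (dot_bound _ _))// mulrA.
by rewrite (le_trans (hC _ _))// mulrA.
Qed.

Lemma partial_quadratic c b Y x0 i :
  partial i (quadratic c b Y x0) = quadratic (b ord0 i) (e_ i *m (Y + Y^T)) 0 x0.
Proof.
apply/funext => x; rewrite /partial.
have h := is_derive_quadratic c b Y x0 x (e_ i).
rewrite (@derive_val _ _ _ _ _ _ _ h) /quadratic bil0 addr0 dot_delta mulmxDr dotDl.
by rewrite -!bil_dot -[bil Y^T _ _]bilC addrA addrAC.
Qed.

Lemma C2_quadratic c b Y x0 U : C2_on U (quadratic c b Y x0).
Proof.
move=> x _; split.
- exact: continuous_quadratic.
- by move=> i; have [] := is_derive_quadratic c b Y x0 x (e_ i).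
- by move=> i; rewrite partial_quadratic; exact: continuous_quadratic.
- by move=> i j; rewrite partial_quadratic; have [] := is_derive_quadratic (b ord0 j) (e_ j *m (Y + Y^T)) 0 x0 x (e_ i).
- by move=> i j; rewrite !partial_quadratic; exact: continuous_quadratic.
Qed.

Lemma hessian_quadratic c b Y x0 x : hessian (quadratic c b Y x0) x = Y + Y^T.
Proof.
apply/matrixP => i j; rewrite mxE !partial_quadratic /quadratic bil0 trmx0 !addr0 mulmx0.
by rewrite [dot 0 _]dotC dot0r addr0 -rowE !mxE addrC.
Qed.

(** The form in which the viscosity inequality for [u] enters the comparison. The test function is
    built on [X / 2] because the Hessian of the form of [Y] is [Y + Y^T]. *)
Lemma viscosity_quadratic_test (F : 'M[R]_n -> R) (u : 'rV[R]_n -> \bar R)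
    x0 (c : R) b X (r : R) :
  viscosity_supersolution F u -> X^T = X -> 0 < r -> u x0 = c%:E ->
  (forall z, `|z| <= r -> ((c + dot b z + 2^-1 * bil X z z)%:E <= u (x0 + z)%R)%E) ->
  F X <= 0.
Proof.
move=> [_ _ _ hu] XT r0 ux0 hle.
have -> : X = hessian (quadratic c b (2^-1 *: X) x0) x0.
  by rewrite hessian_quadratic linearZ/= XT -scalerDl -[LHS]scale1r; congr (_ *: _); field.
apply: (hu x0 _ (ball x0 r)).
- by split; [exact: ball_open|exact: ballxx].
- exact: C2_quadratic.
- by rewrite /quadratic subrr dot0r bil0r !addr0 ux0.
- move=> x; rewrite -ball_normE /= distrC => /ltW /hle.
  rewrite [x0 + _]addrC subrK; apply: le_trans; rewrite lee_fin /quadratic.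
  by rewrite !bil_dot -scalemxAr dotZl.
Qed.

End Quadratics.

(** * Continuity and derivatives of finite sums and products *)

Section Products.
Variable R : realType.

Lemma continuous_big_prod (T : topologicalType) (I : Type) (r : seq I) (g : I -> T -> R) (x : T) :
  (forall i, {for x, continuous (g i)}) ->
  {for x, continuous (fun y => \prod_(i <- r) g i y)}.
Proof.
move=> gc; elim: r => [|i r IH].
  rewrite (_ : (fun y => _) = cst 1); first exact: cst_continuous.
  by apply/funext => y; rewrite big_nil.
rewrite (_ : (fun y => _) = (fun y => g i y * \prod_(i <- r) g i y)).
  exact: continuousM (gc i) IH.
by apply/funext => y; rewrite big_cons.
Qed.

Lemma continuous_big_sum (T : topologicalType) (I : Type) (r : seq I) (g : I -> T -> R) (x : T) :
  (forall i, {for x, continuous (g i)}) ->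
  {for x, continuous (fun y => \sum_(i <- r) g i y)}.
Proof.
move=> gc; elim: r => [|i r IH].
  rewrite (_ : (fun y => _) = cst 0); first exact: cst_continuous.
  by apply/funext => y; rewrite big_nil.
rewrite (_ : (fun y => _) = (fun y => g i y + \sum_(i <- r) g i y)).
  exact: (@continuousD R R T (g i) (fun y => \sum_(i <- r) g i y) x (gc i) IH).
by apply/funext => y; rewrite big_cons.
Qed.

Lemma is_derive_big_prod (I : eqType) (r : seq I) (f : I -> R -> R) (df : I -> R) (s : R) :
  uniq r -> (forall i, is_derive s (1 : R) (f i) (df i)) ->
  is_derive s (1 : R) (fun s => \prod_(i <- r) f i s)
    (\sum_(i <- r) df i * \prod_(j <- r | j != i) f j s).
Proof.
move=> ur fd; elim: r ur => [_|i r IH /= /andP[ir ur]].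
  rewrite big_nil (_ : (fun s => _) = cst 1); first exact: is_derive_cst.
  by apply/funext => y; rewrite big_nil.
have h : is_derive s (1 : R) (fun s => f i s * \prod_(i <- r) f i s) _ :=
  is_deriveM (fd i) (IH ur).
rewrite (_ : (fun s => \prod_(i <- _) f i s) = (fun s => f i s * \prod_(i <- r) f i s)); last first.
  by apply/funext => y; rewrite big_cons.
apply: is_derive_eq; rewrite big_cons big_cons eqxx /= addrC; congr (_ + _).
  rewrite /GRing.scale/= mulrC; congr (_ * _).
  rewrite [RHS]big_seq_cond [LHS]big_seq; apply: eq_bigl => j.
  by case jr: (j \in r) => //=; apply/esym; apply: contraNneq ir => <-.
rewrite /GRing.scale/= mulr_sumr [LHS]big_seq [RHS]big_seq; apply: eq_bigr => j jr.
rewrite big_cons mulrCA ifT//; apply: contraNneq ir => -> //.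
Qed.

Lemma is_derive_big_sum (V : normedModType R) (I : Type) (r : seq I) (f : I -> V -> R) (df : I -> R) (s v : V) :
  (forall i, is_derive s v (f i) (df i)) ->
  is_derive s v (fun s => \sum_(i <- r) f i s) (\sum_(i <- r) df i).
Proof.
move=> fd; elim: r => [|i r IH].
  rewrite big_nil (_ : (fun s => _) = cst 0); first exact: is_derive_cst.
  by apply/funext => y; rewrite big_nil.
have h : is_derive s v (fun s => f i s + \sum_(i <- r) f i s) _ :=
  is_deriveD (fd i) IH.
rewrite (_ : (fun s => \sum_(i <- _) f i s) = (fun s => f i s + \sum_(i <- r) f i s)); last first.
  by apply/funext => y; rewrite big_cons.
by rewrite big_cons.
Qed.

End Products.

(** * Derivatives of combinations of tensor products *)

Section TensorProducts.
Variables (R : realType) (n : nat).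
Implicit Types (p q dp dq ddp : 'I_n -> R -> R) (x : 'rV[R]_n).

Local Notation e_ i := (delta_mx ord0 i : 'rV[R]_n).

Definition tensor p x : R := \prod_(i < n) p i (x ord0 i).
(** Differentiating a tensor product in coordinate [i] replaces its factor [i], so partial
    derivatives stay in the same class of functions and the argument can be iterated. *)
Definition upd p i q : 'I_n -> R -> R := fun j => if j == i then q j else p j.
Definition fam_derive p dp := forall i (t : R), is_derive t (1 : R) (p i) (dp i t).

Lemma upd_derive p dp ddp i : fam_derive p dp -> fam_derive dp ddp ->
  fam_derive (upd p i dp) (upd dp i ddp).
Proof. by move=> h1 h2 j t; rewrite /upd; case: ifP. Qed.

Lemma tensor_is_derive p dp x i : fam_derive p dp ->
  is_derive x (e_ i) (tensor p) (tensor (upd p i dp) x).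
Proof.
move=> pd; apply: line_is_derive.
set P := \prod_(j < n | j != i) p j (x ord0 j).
rewrite (_ : (fun s : R => _) = (fun s => P * p i (x ord0 i + s))); last first.
  apply/funext => s; rewrite /tensor (bigD1 i)//= mulrC; congr (_ * _).
    apply: eq_bigr => j ji; rewrite !mxE eqxx /= (negbTE ji).
    by rewrite mulr0 addr0.
  by rewrite !mxE !eqxx mulr1.
have -> : tensor (upd p i dp) x = P * dp i (x ord0 i).
  rewrite /tensor (bigD1 i)//= mulrC /upd eqxx; congr (_ * _).
  by apply: eq_bigr => j /negbTE ->.
have h0 : is_derive (0 : R) (1 : R) (fun s => x ord0 i + s) _ :=
  is_deriveD (is_derive_cst (x ord0 i) (0:R) (1:R)) (is_derive_id (0:R) (1:R)).
have h1 : is_derive (x ord0 i + 0) (1 : R) (p i) (dp i (x ord0 i)) by rewrite addr0; exact: pd.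
have h : is_derive (0 : R) (1 : R) (fun s => P * p i (x ord0 i + s)) _ :=
  is_deriveZ P (@is_derive1_comp _ _ (fun s : R => x ord0 i + s) _ _ _ h1 h0).
by apply: is_derive_eq; rewrite add0r mulr1.
Qed.

Lemma fam_continuous p dp x : fam_derive p dp -> {for x, continuous (tensor p)}.
Proof.
move=> pd; apply: continuous_big_prod => i.
apply: (@continuous_comp _ _ _ (fun x : 'rV[R]_n => x ord0 i) (p i)).
  exact: coord_continuous.
by apply: differentiable_continuous; apply/derivable1_diffP; have [] := pd i (x ord0 i).
Qed.

Variable J : finType.

Lemma partial_comb (w : J -> R) (p dp : J -> 'I_n -> R -> R) i :
  (forall k, fam_derive (p k) (dp k)) ->
  partial i (fun x => \sum_k w k * tensor (p k) x) =
  (fun x => \sum_k w k * tensor (upd (p k) i (dp k)) x).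
Proof.
move=> pd; apply/funext => x; rewrite /partial.
have h := @is_derive_big_sum R _ J (index_enum J) (fun k x => w k * tensor (p k) x) _ x (e_ i)
  (fun k => is_deriveZ (w k) (tensor_is_derive x i (pd k))).
exact: (@derive_val _ _ _ _ _ _ _ h).
Qed.

Lemma derivable_comb (w : J -> R) (p dp : J -> 'I_n -> R -> R) i x :
  (forall k, fam_derive (p k) (dp k)) ->
  derivable (fun x => \sum_k w k * tensor (p k) x) x (e_ i).
Proof.
move=> pd.
by have [] := @is_derive_big_sum R _ J (index_enum J) (fun k x => w k * tensor (p k) x) _ x (e_ i)
  (fun k => is_deriveZ (w k) (tensor_is_derive x i (pd k))).
Qed.

Lemma continuous_comb (w : J -> R) (p dp : J -> 'I_n -> R -> R) x :
  (forall k, fam_derive (p k) (dp k)) ->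
  {for x, continuous (fun x => \sum_k w k * tensor (p k) x)}.
Proof.
move=> pd; apply: continuous_big_sum => k.
have hc : {for x, continuous (cst (w k) : 'rV[R]_n -> R)} by exact: cst_continuous.
exact: (continuousM hc (fam_continuous (pd k))).
Qed.

(** Third derivatives of the factors serve to make the second ones continuous, since
    [continuous_comb] gets continuity from differentiability. *)
Lemma C2_comb (w : J -> R) (p dp ddp dddp : J -> 'I_n -> R -> R) U :
  (forall k, fam_derive (p k) (dp k)) -> (forall k, fam_derive (dp k) (ddp k)) ->
  (forall k, fam_derive (ddp k) (dddp k)) ->
  C2_on U (fun x => \sum_k w k * tensor (p k) x).
Proof.
move=> h1 h2 h3 x _.
have d1 i k : fam_derive (upd (p k) i (dp k)) (upd (dp k) i (ddp k)) by exact: upd_derive.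
have d2 i k : fam_derive (upd (dp k) i (ddp k)) (upd (ddp k) i (dddp k)) by exact: upd_derive.
split.
- exact: continuous_comb h1.
- by move=> i; exact: derivable_comb h1.
- by move=> i; rewrite (partial_comb w i h1); exact: continuous_comb (d1 i).
- by move=> i j; rewrite (partial_comb w j h1); exact: derivable_comb (d1 j).
- move=> i j; rewrite (partial_comb w j h1) (partial_comb w i (d1 j)).
  apply: (@continuous_comb w _ (fun k => upd (upd (dp k) j (ddp k)) i (upd (ddp k) j (dddp k)))).
  by move=> k; exact: upd_derive.
Qed.

Lemma hessian_comb (w : J -> R) (p dp ddp : J -> 'I_n -> R -> R) x :
  (forall k, fam_derive (p k) (dp k)) -> (forall k, fam_derive (dp k) (ddp k)) ->
  \tr (hessian (fun x => \sum_k w k * tensor (p k) x) x) =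
  \sum_k w k * \sum_i ddp k i (x ord0 i) * \prod_(j | j != i) p k j (x ord0 j).
Proof.
move=> h1 h2; rewrite /mxtrace.
have d1 i k : fam_derive (upd (p k) i (dp k)) (upd (dp k) i (ddp k)) by exact: upd_derive.
under eq_bigr => i _ do rewrite mxE (partial_comb w i h1) (partial_comb w i (d1 i)).
rewrite exchange_big; apply: eq_bigr => k _; rewrite -mulr_sumr; congr (_ * _).
apply: eq_bigr => i _; rewrite /tensor (bigD1 i)//= /upd !eqxx; congr (_ * _).
by apply: eq_bigr => j /negbTE ->.
Qed.

End TensorProducts.

(** * The Gaussian mass of an interval as a solution of the heat equation *)

Section HeatKernel.
Variables (R : realType) (c : R) (Phi : R -> R).
Hypothesis gPhi : gauss_cdf c Phi.
Implicit Types (sg a b t x y : R).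

Let c0 := gauss_c_gt0 gPhi.

(* [pcell sg a b t] is the mass that the normal law with mean [t] and standard
   deviation [sg] gives to the interval from [a] to [b]; [dpcell], [ddpcell] and
   [dddpcell] are its derivatives in [t]. *)
Definition pcell sg a b t := Phi ((b - t) / sg) - Phi ((a - t) / sg).
Definition dpcell sg a b t := - (c / sg) * (gpdf ((b - t) / sg) - gpdf ((a - t) / sg)).
Definition ddpcell sg a b t := - (c / sg ^+ 2) *
  ((b - t) / sg * gpdf ((b - t) / sg) - (a - t) / sg * gpdf ((a - t) / sg)).
Definition dddpcell sg a b t := c / sg ^+ 3 *
  ((1 - ((b - t) / sg) ^+ 2) * gpdf ((b - t) / sg) -
   (1 - ((a - t) / sg) ^+ 2) * gpdf ((a - t) / sg)).

Lemma is_derive_shift (G : R -> R) (dG : R) sg b t :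
  is_derive ((b - t) / sg) (1 : R) G dG ->
  is_derive t (1 : R) (fun t => G ((b - t) / sg)) (- (dG / sg)).
Proof.
move=> h; have h1 : is_derive t (1 : R) (fun t : R => sg^-1 * (b - t)) _ :=
  is_deriveZ sg^-1 (is_deriveB (is_derive_cst b t (1 : R)) (is_derive_id t (1 : R))).
have E : (fun t : R => sg^-1 * (b - t)) = (fun t => (b - t) / sg).
  by apply/funext => s; rewrite mulrC.
rewrite E in h1.
have h2 := @is_derive1_comp R G (fun t => (b - t) / sg) t _ _ h h1.
by apply: is_derive_eq; rewrite /GRing.scale/=; ring.
Qed.

Lemma is_derive_scale (G : R -> R) (dG : R) sg y : sg != 0 ->
  is_derive (y / sg) (1 : R) G dG ->
  is_derive sg (1 : R) (fun sg => G (y / sg)) (- (y / sg ^+ 2 * dG)).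
Proof.
move=> sg0 h; have h1 : is_derive sg (1 : R) (fun s : R => y * s^-1) _ :=
  is_deriveZ y (is_deriveV sg0 (is_derive_id sg (1 : R))).
have h2 := @is_derive1_comp R G (fun s => y * s^-1) sg _ _ h h1.
by apply: is_derive_eq; rewrite /GRing.scale/=; ring.
Qed.

Lemma is_derive_xgpdf y : is_derive y (1 : R) (fun y => y * gpdf y) ((1 - y ^+ 2) * gpdf y).
Proof.
have h : is_derive y (1 : R) (fun y => y * gpdf y) _ :=
  is_deriveM (is_derive_id y (1 : R)) (is_derive_gpdf y).
by apply: is_derive_eq; rewrite /GRing.scale/=; ring.
Qed.

Lemma pcell_derive sg a b t :
  is_derive t (1 : R) (pcell sg a b) (dpcell sg a b t).
Proof.
have h : is_derive t (1 : R) (pcell sg a b) _ :=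
  is_deriveB (is_derive_shift (gauss_deriv gPhi ((b - t) / sg)))
             (is_derive_shift (gauss_deriv gPhi ((a - t) / sg))).
by apply: is_derive_eq; rewrite /dpcell; ring.
Qed.

Lemma dpcell_derive sg a b t : sg != 0 ->
  is_derive t (1 : R) (dpcell sg a b) (ddpcell sg a b t).
Proof.
move=> sg0; have h : is_derive t (1 : R) (dpcell sg a b) _ :=
  is_deriveZ (- (c / sg)) (is_deriveB (is_derive_shift (is_derive_gpdf ((b - t) / sg)))
             (is_derive_shift (is_derive_gpdf ((a - t) / sg)))).
by apply: is_derive_eq; rewrite /ddpcell /GRing.scale/=; field.
Qed.

Lemma ddpcell_derive sg a b t : sg != 0 ->
  is_derive t (1 : R) (ddpcell sg a b) (dddpcell sg a b t).
Proof.
move=> sg0; have h : is_derive t (1 : R) (ddpcell sg a b) _ :=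
  is_deriveZ (- (c / sg ^+ 2)) (is_deriveB (is_derive_shift (is_derive_xgpdf ((b - t) / sg)))
             (is_derive_shift (is_derive_xgpdf ((a - t) / sg)))).
by apply: is_derive_eq; rewrite /dddpcell /GRing.scale/=; field.
Qed.

(** The heat equation in the variable [sg]; the usual time is [sg^2 / 2], whence the factor [sg]. *)
Lemma pcell_heat sg a b t : sg != 0 ->
  is_derive sg (1 : R) (fun sg => pcell sg a b t) (sg * ddpcell sg a b t).
Proof.
move=> sg0; have h : is_derive sg (1 : R) (fun sg => pcell sg a b t) _ :=
  is_deriveB (is_derive_scale sg0 (gauss_deriv gPhi ((b - t) / sg)))
             (is_derive_scale sg0 (gauss_deriv gPhi ((a - t) / sg))).
by apply: is_derive_eq; rewrite /ddpcell; field.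
Qed.

Lemma Phi_homo (s t : R) : s <= t -> Phi s <= Phi t.
Proof.
move=> st; apply: (is_derive_ge0_homo st (fun y _ => gauss_deriv gPhi y)) => y _.
by rewrite mulr_ge0 ?ltW ?gpdf_gt0.
Qed.

Lemma pcell_ge0 sg a b t : 0 < sg -> a <= b -> 0 <= pcell sg a b t.
Proof.
by move=> sg0 ab; rewrite subr_ge0 Phi_homo// ler_pM2r ?invr_gt0//; lra.
Qed.

Lemma pcell_le1 sg a b t : pcell sg a b t <= 1.
Proof.
have := gauss_le1 gPhi ((b - t) / sg); have := gauss_ge0 gPhi ((a - t) / sg).
rewrite /pcell; lra.
Qed.

Lemma gpdf_le y : 0 < y -> gpdf y <= 2 / y ^+ 2.
Proof.
move=> y0; have y2 : 0 < y ^+ 2 by rewrite exprn_gt0.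
rewrite /gpdf mulNr expRN -[leRHS]invf_div lef_pV2 ?posrE ?expR_gt0 ?divr_gt0//.
by apply: le_trans (expR_ge1Dx _); rewrite lerDr.
Qed.

Lemma gpdf_nincr s t : 0 <= s -> s <= t -> gpdf t <= gpdf s.
Proof.
move=> s0 st; rewrite ler_expR !mulNr lerN2 ler_pM2r// ler_sqr ?nnegrE//.
exact: le_trans st.
Qed.

(** The whole cell lies in one tail beyond distance [d], and [sg <= d] puts [d / sg] in the range of
    [gauss_tail]. *)
Lemma pcell_far sg a b t (d : R) : 0 < sg -> sg <= d -> (t <= a - d) \/ (b + d <= t) ->
  pcell sg a b t <= c * gpdf (d / sg).
Proof.
move=> sg0 sd H; have d0 : 0 < d by exact: lt_le_trans sd.
have ds1 : 1 <= d / sg by rewrite ler_pdivlMr// mul1r.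
have tl y : d <= y -> 1 - Phi (y / sg) <= c * gpdf (d / sg).
  move=> dy; have dy' : d / sg <= y / sg by rewrite ler_pM2r ?invr_gt0.
  apply: le_trans (gauss_tail gPhi (le_trans ds1 dy')) _.
  by rewrite ler_pM2l// gpdf_nincr// divr_ge0 ?ltW.
have := gauss_le1 gPhi ((b - t) / sg); have := gauss_ge0 gPhi ((a - t) / sg).
case: H => H; rewrite /pcell.
  by have := tl (a - t); lra.
have := tl (t - b); rewrite -opprB mulNr (gauss_sym gPhi); lra.
Qed.

(** Comparing densities and integrating bounds the mass of a cell relative to its central mass,
    uniformly in the width of the cell. *)
Lemma pcell_ratio sg a b t (k : R) : a <= b -> 0 < sg ->
  (forall x, a <= x <= b -> gpdf ((x - t) / sg) / sg <= k * gpdf x) ->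
  pcell sg a b t <= k * pcell 1 a b 0.
Proof.
move=> ab sg0 h; rewrite /pcell !divr1 !subr0.
have d1 x : is_derive x (1 : R) (fun x => Phi ((x - t) / sg)) (c * gpdf ((x - t) / sg) / sg).
  have h0 : is_derive x (1 : R) (fun x : R => sg^-1 * (x - t)) _ :=
    is_deriveZ sg^-1 (is_deriveB (is_derive_id x (1 : R)) (is_derive_cst t x (1 : R))).
  have E : (fun x : R => sg^-1 * (x - t)) = (fun x => (x - t) / sg).
    by apply/funext => s; rewrite mulrC.
  rewrite E in h0.
  have h2 := @is_derive1_comp R Phi (fun x => (x - t) / sg) x _ _ (gauss_deriv gPhi ((x - t) / sg)) h0.
  by apply: is_derive_eq; rewrite /GRing.scale/=; ring.
have d2 x : is_derive x (1 : R) (fun x => k * Phi x) (k * (c * gpdf x)) :=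
  is_deriveZ k (gauss_deriv gPhi x).
rewrite mulrBr; apply: (is_derive_le_sub ab (fun x _ => d1 x) (fun x _ => d2 x)) => x xab.
by rewrite mulrCA -mulrA ler_pM2l// h.
Qed.

Variable n : nat.
Implicit Types (s : 'rV[R]_n) (k : 'I_n).

(* Far from the cube [-K, K]^n the weight of a cell inside that cube is at most
   [exp(-K^2)] times its weight at the centre. *)
Lemma tensor_pcell_lateral (K sg : R) (a b : 'I_n -> R) s i0 :
  1 <= K -> 0 < sg -> sg <= 1 ->
  (forall i, [/\ - K <= a i, a i <= b i & b i <= K]) ->
  `|s ord0 i0| = n.+3%:R * K ->
  \prod_i pcell sg (a i) (b i) (s ord0 i) <=
  expR (- K ^+ 2) * \prod_i pcell 1 (a i) (b i) 0.
Proof.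
move=> K1 sg0 sg1 hab si0.
pose tau := sg^-1.
have tau1 : 1 <= tau by rewrite invf_ge1.
have tau0 : 0 < tau by rewrite invr_gt0.
have K0 : 0 < K by lra.
(* [A] bounds the ratio of densities in every coordinate, as [gpdf x >= exp (- K^2 / 2)] on
   [[-K, K]]. In coordinate [i0] the cell is at distance at least [(n+2) K], which contributes the
   small factor [B]. *)
pose A := tau * expR (K ^+ 2 / 2).
pose B := expR (- ((n.+2%:R * K * tau) ^+ 2 / 2)).
have gK x : - K <= x <= K -> 1 <= expR (K ^+ 2 / 2) * gpdf x.
  move=> xK; rewrite /gpdf -expRD -{1}expR0 ler_expR mulNr -mulrBl.
  rewrite divr_ge0// subr_ge0 -[leRHS](real_normK) ?num_real//.
  rewrite -[leLHS](real_normK) ?num_real// ler_sqr ?nnegrE//.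
  by rewrite (ger0_norm (ltW K0)) ler_norml.
have h1 i : pcell sg (a i) (b i) (s ord0 i) <= A * pcell 1 (a i) (b i) 0.
  have [h1 h2 h3] := hab i.
  apply: pcell_ratio => // x /andP[ax xb].
  rewrite /A -/tau mulrC -mulrA ler_pM2l//; apply: le_trans (gK x _).
    by rewrite /gpdf -expR0 ler_expR mulNr oppr_le0 divr_ge0// sqr_ge0.
  by apply/andP; split; lra.
have h2 : pcell sg (a i0) (b i0) (s ord0 i0) <= (B * A) * pcell 1 (a i0) (b i0) 0.
  have [h1' h2 h3] := hab i0.
  apply: pcell_ratio => // x /andP[ax xb].
  have -> : B * A * gpdf x = B * tau * (expR (K ^+ 2 / 2) * gpdf x) by rewrite /A; ring.
  apply: (@le_trans _ _ (B * tau)); last first.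
    by rewrite ler_peMr ?gK ?mulr_ge0 ?expR_ge0 ?(ltW tau0)//; apply/andP; split; lra.
  rewrite -/tau ler_pM2r// /B /gpdf ler_expR mulNr lerN2 ler_pM2r ?invr_gt0//.
  rewrite exprMn [leRHS]exprMn ler_pM2r ?exprn_gt0//.
  rewrite -[leRHS]real_normK ?num_real// ler_sqr ?nnegrE//; last first.
    by rewrite mulr_ge0// ltW.
  have : `|s ord0 i0| - `|x| <= `|x - s ord0 i0| by rewrite distrC lerB_dist.
  have : `|x| <= K by rewrite ler_norml; apply/andP; split; lra.
  rewrite si0 -(natr1 n.+2); lra.
pose P := \prod_i pcell 1 (a i) (b i) 0.
have P0 : 0 <= P by rewrite prodr_ge0// => i _; apply: pcell_ge0 => //; have [] := hab i.
have h3 : \prod_i pcell sg (a i) (b i) (s ord0 i) <= B * A ^+ n * P.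
  rewrite (bigD1 i0)//= /P (bigD1 i0 (P := xpredT))//=.
  have An : A ^+ n = A * \prod_(i < n | i != i0) A.
    by rewrite -(bigD1 i0 (P := xpredT) (F := fun=> A))//= prodr_const card_ord.
  rewrite An.
  set Q := \prod_(i < n | _) pcell 1 _ _ _.
  have -> : B * (A * \prod_(i < n | i != i0) A) * (pcell 1 (a i0) (b i0) 0 * Q)
    = (B * A * pcell 1 (a i0) (b i0) 0) * (\prod_(i < n | i != i0) A * Q) by ring.
  apply: ler_pM => //; first by apply: pcell_ge0 => //; have [] := hab i0.
    by rewrite prodr_ge0// => i _; apply: pcell_ge0 => //; have [] := hab i.
  rewrite /Q -big_split/=; apply: ler_prod => i _; rewrite h1 andbT.
  by apply: pcell_ge0 => //; have [] := hab i.
apply: le_trans h3 _; rewrite ler_wpM2r//.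
have tauE : tau <= expR (K ^+ 2 * tau ^+ 2 / 2).
  apply: le_trans (expR_ge1Dx _); have : 1 <= K ^+ 2 by rewrite exprn_ege1.
  move=> K2; have : tau ^+ 2 <= K ^+ 2 * tau ^+ 2 by rewrite ler_peMl ?sqr_ge0.
  have := sqr_ge0 (tau - 1); rewrite sqrrB1; lra.
have AE : A <= expR (K ^+ 2 * tau ^+ 2).
  have -> : K ^+ 2 * tau ^+ 2 = K ^+ 2 * tau ^+ 2 / 2 + K ^+ 2 * tau ^+ 2 / 2 by lra.
  rewrite expRD; apply: ler_pM; rewrite ?expR_ge0 ?(ltW tau0)//.
  by rewrite ler_expR ler_pM2r// ler_peMr ?sqr_ge0// exprn_ege1.
apply: (@le_trans _ _ (B * expR (K ^+ 2 * tau ^+ 2) ^+ n)).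
  rewrite ler_pM2l ?expR_gt0// lerXn2r ?nnegrE ?expR_ge0//.
  by rewrite mulr_ge0 ?expR_ge0// ltW.
(* With [q = K^2 tau^2 >= K^2] the exponent is [n q - (n+2)^2 q / 2 <= - 2 q]: this is what the
   half-side [(n+3) K] of the large cube is for. *)
rewrite -expRM_natl /B -expRD ler_expR.
have h : K ^+ 2 * 1 <= K ^+ 2 * tau ^+ 2 by rewrite ler_pM2l ?exprn_gt0// exprn_ege1.
have -> : (n.+2%:R * K * tau) ^+ 2 = (n%:R + 2) ^+ 2 * (K ^+ 2 * tau ^+ 2).
  by rewrite -addn2 natrD; ring.
have n0 : 0 <= n%:R :> R by rewrite ler0n.
set q := K ^+ 2 * tau ^+ 2 in h *.
have q0 : 0 <= q by rewrite mulr_ge0 ?sqr_ge0.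
rewrite mulr1 in h.
have h4 : 0 <= n%:R * q by rewrite mulr_ge0.
have h5 : 0 <= n%:R * (n%:R * q) := mulr_ge0 n0 h4.
lra.
Qed.

End HeatKernel.

(** * Minima of semicontinuous functions and one-sided maxima *)

Section Minimum.
Variables (R : realType) (T : topologicalType).

(** If the infimum [r] were not attained, [f > r] would hold on [A], and compactness would give a
    uniform gap above [r]. *)
Lemma compact_lsc_min (A : set T) (f : T -> \bar R) (x0 : T) (B : R) :
  compact A -> A x0 -> f x0 != +oo%E -> (forall x, A x -> (B%:E <= f x)%E) ->
  (forall x (r : R), A x -> (r%:E < f x)%E -> \forall y \near x, (r%:E < f y)%E) ->
  exists2 x, A x & forall y, A y -> (f x <= f y)%E.
Proof.
move=> cA Ax0 fx0 fB lsc; apply/not_exists2P => nomin.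
pose m := ereal_inf (f @` A).
have mle x : A x -> (m <= f x)%E by move=> Ax; apply: ereal_inf_lbound; exists x.
have Bm : (B%:E <= m)%E by apply: le_ereal_inf_tmp => _ [x Ax <-]; exact: fB.
have [r mr] : exists r : R, m = r%:E.
  exists (fine m); rewrite fineK// fin_real//.
  rewrite (lt_le_trans (ltNyr B) Bm) /= (le_lt_trans (mle _ Ax0))//.
  by rewrite ltey.
have mlt x : A x -> (r%:E < f x)%E.
  move=> Ax; rewrite lt_neqAle -mr mle// andbT; apply/eqP => mE.
  have [//|] := nomin x; case=> //.
  by move=> y Ay; rewrite -mE; exact: mle.
have /compact_near_coveringP cov := cA.
have := cov R r^'+ (fun a x => (a%:E < f x)%E) _ _.
case=> [x Ax|e /= e0 he].
  have [a ra afx] : exists2 a : R, r < a & (a%:E < f x)%E.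
    have := mlt _ Ax; case: (f x) => [t|_|//].
      rewrite lte_fin => rt; exists ((r + t) / 2); last rewrite lte_fin.
        by rewrite ltr_pdivlMr//; lra.
      by rewrite ltr_pdivrMr//; lra.
    by exists (r + 1); [lra|exact: ltry].
  exists ([set y | (a%:E < f y)%E], [set b : R | b < a]).
    by split => /=; [exact: lsc|exact: nbhs_right_lt].
  by move=> [y b] /= [ay ba]; rewrite (lt_trans _ ay)// lte_fin.
have re : r < r + e / 2 by lra.
have := he (r + e / 2); rewrite /ball_/= opprD addNKr normrN gtr0_norm; last lra.
move=> /(_ _ re) H.
have : ((r + e / 2)%:E <= m)%E.
  by apply: le_ereal_inf_tmp => _ [x Ax <-]; apply: ltW; apply: H => //; lra.
by rewrite mr lee_fin leNgt re.
Qed.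

(** One-sided because the minimum in [heat_comparison] may sit at the final time [sg = 1]. *)
Lemma deriv_ge0_of_left_max (f : R -> R) (x0 x d : R) : x0 < x ->
  is_derive x (1 : R) f d -> (forall y, x0 <= y <= x -> f y <= f x) -> 0 <= d.
Proof.
move=> x0x [fd <-] fmax; rewrite leNgt; apply/negP => d0.
have /cvgrPdist_lt/(_ (- 'D_1 f x)) := fd; rewrite oppr_gt0 => /(_ d0) h.
have [e /= e0 he] := h.
pose t := - Num.min (e / 2) (x - x0).
have t0 : t < 0 by rewrite oppr_lt0 lt_min divr_gt0//= subr_gt0.
have te : `|t| < e.
  by rewrite normrN ger0_norm ?gt_min; [apply/orP; left; lra|rewrite -oppr_le0 ltW].
have tx : - (x - x0) <= t by rewrite lerN2 ge_min lexx orbT.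
have := he t; rewrite /= sub0r normrN => /(_ te); rewrite lt_eqF// => /(_ isT).
rewrite -/('D_1 f x) [t%:A]mulr1.
have ft : f (t + x) <= f x by apply: fmax; apply/andP; split; lra.
have : 0 <= t^-1 * (f (t + x) - f x) by rewrite mulr_le0 ?invr_le0 ?(ltW t0) ?subr_le0.
rewrite /GRing.scale/= => q0.
by rewrite ltr0_norm; lra.
Qed.

End Minimum.

(** * Parabolic comparison of a superharmonic function with the heat flow *)

Section HeatComparison.
Variables (R : realType) (c : R) (Phi : R -> R) (gPhi : gauss_cdf c Phi).
Variables (n : nat) (J : finType) (w : J -> R) (a b : J -> 'I_n -> R).
Implicit Types (s z : 'rV[R]_n) (k : J) (sg : R).

(** The heat flow of the step function with value [w k] on the box with corners [a k] and [b k]. *)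
Definition heat sg s : R := \sum_k w k * tensor (fun i => pcell Phi sg (a k i) (b k i)) s.

Let p1 sg k := fun i => pcell Phi sg (a k i) (b k i).
Let p2 sg k := fun i => dpcell c sg (a k i) (b k i).
Let p3 sg k := fun i => ddpcell c sg (a k i) (b k i).
Let p4 sg k := fun i => dddpcell c sg (a k i) (b k i).

Lemma heat_C2 sg U : sg != 0 -> C2_on U (heat sg).
Proof.
move=> sg0; apply: (@C2_comb R n J w (p1 sg) (p2 sg) (p3 sg) (p4 sg)) => k i t.
- exact: pcell_derive.
- exact: dpcell_derive.
- exact: ddpcell_derive.
Qed.

Lemma heat_equation sg s : sg != 0 ->
  is_derive sg (1 : R) (fun sg => heat sg s) (sg * \tr (hessian (heat sg) s)).
Proof.
move=> sg0.
rewrite (@hessian_comb R n J w (p1 sg) (p2 sg) (p3 sg)); last 2 first.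
- by move=> k i t; exact: pcell_derive.
- by move=> k i t; exact: dpcell_derive.
have h k : is_derive sg (1 : R) (fun sg => w k * tensor (p1 sg k) s) _ :=
  is_deriveZ (w k) (is_derive_big_prod (index_enum_uniq _)
    (fun i => pcell_heat gPhi (a k i) (b k i) (s ord0 i) sg0)).
have H := is_derive_big_sum (index_enum J) h.
apply: is_derive_eq; rewrite mulr_sumr; apply: eq_bigr => k _.
rewrite /GRing.scale/= mulrCA; congr (_ * _); rewrite mulr_sumr; apply: eq_bigr => i _.
exact: (esym (mulrA _ _ _)).
Qed.

Lemma heat_continuous (q : R * 'rV[R]_n) : q.1 != 0 ->
  {for q, continuous (fun q : R * 'rV[R]_n => heat q.1 q.2)}.
Proof.
move=> q0.
have gc (y : R) i : {for q, continuous (fun q : R * 'rV[R]_n => Phi ((y - q.2 ord0 i) / q.1))}.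
  apply: (@continuous_comp _ _ _ (fun q : R * 'rV[R]_n => (y - q.2 ord0 i) / q.1) Phi).
    apply: (@cvgM R _ (nbhs q)).
      apply: cvgB; first exact: cvg_cst.
      apply: (@continuous_comp _ _ _ (@snd R 'rV[R]_n) (fun s : 'rV[R]_n => s ord0 i)).
        exact: cvg_snd.
      exact: coord_continuous.
    by apply: cvgV => //; exact: cvg_fst.
  apply: differentiable_continuous; apply/derivable1_diffP.
  by have [] := gauss_deriv gPhi ((y - q.2 ord0 i) / q.1).
apply: continuous_big_sum => k.
have hc : {for q, continuous (cst (w k) : R * 'rV[R]_n -> R)} by exact: cst_continuous.
apply: (continuousM hc).
apply: continuous_big_prod => i.
exact: continuousB (gc _ _) (gc _ _).
Qed.

Variables (K rho : R) (u : 'rV[R]_n -> \bar R).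
Hypotheses (K1 : 1 <= K) (rho0 : 0 < rho).
Hypothesis w0 : forall k, 0 <= w k.
Hypothesis hab : forall k i, [/\ - K <= a k i, a k i <= b k i & b k i <= K].
Hypothesis mass : forall sg s, 0 < sg ->
  \sum_k tensor (fun i => pcell Phi sg (a k i) (b k i)) s <= 1.
Hypothesis u_lsc : lower_semicontinuous u.
Hypothesis u_ge0 : forall s, `|s| <= n.+3%:R * K -> (0 <= u s)%E.
Hypothesis u_super : forall s (d r : R) g X, X^T = X -> 0 < r -> u s = d%:E ->
  (forall z, `|z| <= r -> ((d + dot g z + 2^-1 * bil X z z)%:E <= u (s + z)%R)%E) ->
  \tr X <= 0.
Hypothesis u_data : forall k s,
  (forall i, a k i - rho <= s ord0 i <= b k i + rho) -> ((w k)%:E <= u s)%E.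

Let ell := n.+3%:R * K.

Let tensor_ge0 sg k s : 0 < sg -> 0 <= tensor (fun i => pcell Phi sg (a k i) (b k i)) s.
Proof.
by move=> sg0; apply: prodr_ge0 => i _; apply: (pcell_ge0 gPhi) => //; have [] := hab k i.
Qed.

Let heat_ge0 sg s : 0 < sg -> 0 <= heat sg s.
Proof. by move=> sg0; apply: sumr_ge0 => k _; rewrite mulr_ge0 ?tensor_ge0. Qed.

Let heat_lateral sg s : 0 < sg <= 1 -> `|s| = ell ->
  heat sg s <= expR (- K ^+ 2) * heat 1 0.
Proof.
move=> /andP[sg0 sg1] sE; rewrite mulr_sumr; apply: ler_sum => k _.
rewrite mulrCA ler_wpM2l//.
have ell0 : `|s| != 0 by rewrite sE gt_eqF// mulr_gt0// (lt_le_trans ltr01 K1).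
have [[i0 i] iE] := mx_norm_neq0 ell0.
have si : `|s ord0 i| = ell by rewrite -sE [RHS]iE (ord1 i0).
apply: le_trans (tensor_pcell_lateral gPhi K1 sg0 sg1 (hab k) si) _.
rewrite ler_wpM2l ?expR_ge0// /tensor.
by under [leRHS]eq_bigr do rewrite mxE.
Qed.

(** Cells whose [rho]-enlargement contains [s] have [w k <= u s] by [u_data], and their masses add
    up to at most 1; every other cell is at distance [rho] in some coordinate and contributes a
    Gaussian tail. *)
Let heat_initial (eta : R) : 0 < eta -> exists2 sg : R, 0 < sg < 1 &
  forall s, `|s| <= ell -> ((heat sg s)%:E <= u s + eta%:E)%E.
Proof.
move=> eta0; have c0 := gauss_c_gt0 gPhi; have r0 := rho0.
pose W := \sum_k w k.
have W0 : 0 <= W by rewrite sumr_ge0.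
(* This will be [rho / sg]: it exceeds [rho] and 1, so [sg < 1] and [sg <= rho], and it exceeds
   [2 W c / eta], so the tails sum to at most [2 W c / y^2 <= eta]. *)
pose y := 1 + rho + 2 * W * c / eta.
have Wce : 0 <= 2 * W * c / eta by rewrite divr_ge0 ?mulr_ge0// ltW.
have y1 : 1 < y by rewrite /y; lra.
have y0 : 0 < y by lra.
exists (rho / y) => [|s sell].
  by rewrite divr_gt0//= ltr_pdivrMr// mul1r /y; lra.
set sg := rho / y.
have sg0 : 0 < sg by rewrite divr_gt0.
have sgr : sg <= rho by rewrite ler_pdivrMr// ler_peMr// ltW.
have rsg : rho / sg = y by rewrite /sg invf_div mulrC divfK ?gt_eqF.
pose near k := [forall i, a k i - rho <= s ord0 i <= b k i + rho].
have us0 := u_ge0 sell.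
have far k : ~~ near k -> tensor (fun i => pcell Phi sg (a k i) (b k i)) s <= c * gpdf y.
  move=> /forallPn[i hi]; rewrite /tensor (bigD1 i)//= -[leRHS]mulr1.
  apply: ler_pM.
  - by apply: (pcell_ge0 gPhi) => //; have [] := hab k i.
  - by apply: prodr_ge0 => j _; apply: (pcell_ge0 gPhi) => //; have [] := hab k j.
  - rewrite -rsg; apply: (pcell_far gPhi) => //.
    by move: hi; rewrite negb_and -!ltNge => /orP[/ltW ?|/ltW ?]; [left|right].
  - apply: prodr_ile1 => j _; rewrite (pcell_le1 gPhi) andbT.
    by apply: (pcell_ge0 gPhi) => //; have [] := hab k j.
have small : W * (c * gpdf y) <= eta.
  have := gpdf_le y0 => gy.
  apply: (@le_trans _ _ (W * (c * (2 / y ^+ 2)))).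
    by rewrite ler_wpM2l// ler_pM2l.
  have -> : W * (c * (2 / y ^+ 2)) = (2 * W * c / eta) / y ^+ 2 * eta.
    by field; rewrite !gt_eqF.
  rewrite ler_piMl ?(ltW eta0)// ler_pdivrMr ?exprn_gt0// mul1r.
  by rewrite (@le_trans _ _ y)// ?ler_eXnr// ?ltW// /y; lra.
case E : (u s) us0 => [us| |//] us0; last by rewrite leey.
rewrite -EFinD lee_fin /heat (bigID near)/= lerD//.
  apply: (@le_trans _ _ (us * \sum_(k | near k) tensor (fun i => pcell Phi sg (a k i) (b k i)) s)).
    rewrite mulr_sumr; apply: ler_sum => k /forallP hk.
    by rewrite ler_wpM2r ?tensor_ge0// -lee_fin -E; exact: u_data.
  apply: ler_piMr; first by rewrite -lee_fin.
  apply: le_trans _ (mass s sg0); rewrite [leRHS](bigID near)/= lerDl.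
  by rewrite sumr_ge0// => k _; exact: tensor_ge0.
apply: le_trans _ small; rewrite mulr_suml [leRHS](bigID near)/= ler_wpDl//.
  by rewrite sumr_ge0// => k _; rewrite mulr_ge0 ?mulr_ge0 ?(ltW c0) ?(ltW (gpdf_gt0 y)).
by apply: ler_sum => k fk; rewrite ler_wpM2l// far.
Qed.

(** Minimum principle: otherwise [u - heat + eta sg] has a minimum away from the lateral and initial
    boundaries. There [u] forces the Hessian of [heat] to have trace at most 0, while the derivative
    in [sg] requires at least [eta / sg]. *)
Lemma heat_comparison :
  (((1 - expR (- K ^+ 2)) * heat 1 0)%:E <= u 0)%E.
Proof.
have u00 : (0 <= u 0)%E by rewrite u_ge0// normr0 mulr_ge0// (le_trans ler01 K1).
rewrite leNgt; apply/negP => ulow.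
case E0 : (u 0) u00 ulow => [d0| |//] _; last by rewrite ltNge leey.
rewrite lte_fin => d0low.
pose E := expR (- K ^+ 2) * heat 1 0.
(* With a third of the gap, [f] equals [- E - 2 eta] at [(1, 0)], stays above [- E] laterally and
   above [- eta] at time [sg0]. *)
pose eta := (heat 1 0 - E - d0) / 3.
have eta0 : 0 < eta by rewrite divr_gt0// subr_gt0 /E; lra.
have [sg0 /andP[sg00 sg01] init] := heat_initial eta0.
pose m (q : R * 'rV[R]_n) := heat q.1 q.2 - eta * q.1.
pose f q := (u q.2 - (m q)%:E)%E.
pose A : set (R * 'rV[R]_n) := `[sg0, 1]%classic `*` [set s | `|s| <= ell].
have cA : compact A.
  apply: compact_setX; first exact: segment_compact.
  have -> : [set s : 'rV[R]_n | `|s| <= ell] =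
      [set s | forall i, `[- ell, ell]%classic (s ord0 i)].
    apply/seteqP; split => s /= h.
      by move=> i; rewrite in_itv/= -ler_norml (le_trans (coord_norm_le s i)).
    apply: norm_le_coord => [|i]; last by have := h i; rewrite in_itv/= -ler_norml.
    by rewrite mulr_ge0// (le_trans ler01 K1).
  by apply: (@rV_compact R n (fun=> `[- ell, ell]%classic)) => i; exact: segment_compact.
have ell_gt0 : 0 < ell by rewrite mulr_gt0// (lt_le_trans ltr01 K1).
have A10 : A (1, 0).
  split => /=; first by rewrite in_itv/= lexx ltW.
  by rewrite normr0 ltW.
have f10 : f (1, 0) = (d0 - (heat 1 0 - eta))%:E by rewrite /f /m /= E0 mulr1.
have Apos q : A q -> 0 < q.1.
  by move=> [/=]; rewrite in_itv/= => /andP[h _] _; exact: lt_le_trans h.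
have f_lsc q (r : R) : A q -> (r%:E < f q)%E -> \forall y \near q, (r%:E < f y)%E.
  move=> Aq rf.
  have mc : {for q, continuous m}.
    apply: (@continuousB R R _ (fun q => heat q.1 q.2) (fun q => eta * q.1)).
      by apply: heat_continuous; rewrite gt_eqF// Apos.
    have hc : {for q, continuous (cst eta : R * 'rV[R]_n -> R)} by exact: cst_continuous.
    apply: (continuousM hc); exact: cvg_fst.
  have [t rt tu] : exists2 t : R, r + m q < t & (t%:E < u q.2)%E.
    move: rf; rewrite /f; case: (u q.2) => [v| |].
    - rewrite -EFinB lte_fin => rv; exists ((r + m q + v) / 2); rewrite ?lte_fin.
        by rewrite ltr_pdivlMr//; lra.
      by rewrite ltr_pdivrMr//; lra.
    - by move=> _; exists (r + m q + 1); [lra|exact: ltry].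
    - by rewrite ltNge leNye.
  have mt : \forall y \near q, m y < t - r.
    have /cvgrPdist_lt/(_ (t - r - m q)) := mc; rewrite subr_gt0 ltrBrDl => /(_ rt).
    by apply: filterS => y; rewrite distrC => /(le_lt_trans (ler_norm _)); lra.
  have ut : \forall y \near q, (t%:E < u y.2)%E.
    have [V Vq Vt] := u_lsc tu.
    have : \forall y \near q, V y.2 by exact: (cvg_snd (F := nbhs q.1) Vq).
    by apply: filterS => y; exact: Vt.
  near=> y; rewrite /f.
  have : (t%:E < u y.2)%E by near: y.
  have : m y < t - r by near: y.
  case: (u y.2) => [v| |//]; last by move=> _ _; exact: ltry.
  by rewrite -EFinB !lte_fin; lra.
have [[sg s] Aq fmin] : exists2 q, A q & forall y, A y -> (f q <= f y)%E.
  apply: (compact_lsc_min (B := - \sum_k w k) cA A10) => //; first by rewrite f10.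
  move=> q Aq; have q1 := Apos q Aq.
  have hW : heat q.1 q.2 <= \sum_k w k.
    apply: ler_sum => k _; rewrite ler_piMr//; apply: prodr_ile1 => i _.
    by rewrite (pcell_le1 gPhi) andbT; apply: (pcell_ge0 gPhi) => //; have [] := hab k i.
  have := u_ge0 Aq.2; rewrite /f /m; case: (u q.2) => [v| |//]; last by move=> _; exact: leey.
  by rewrite -EFinB !lee_fin => v0; have := mulr_gt0 eta0 q1; lra.
have [/= sgI sell] := Aq.
have /andP[sg0sg sg1] : sg0 <= sg <= 1 by move: sgI; rewrite in_itv.
have sg_gt0 : 0 < sg by exact: Apos Aq.
have etaE : 3 * eta = heat 1 0 - E - d0 by rewrite /eta; field.
have esg := mulr_gt0 eta0 sg_gt0.
have := fmin _ A10; rewrite f10 /f /m /=.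
case us : (u s) (u_ge0 sell) => [d| |//]; last by rewrite leye_eq.
rewrite lee_fin -EFinB lee_fin => d_ge0 dle.
have s_int : `|s| < ell.
  rewrite lt_neqAle sell andbT; apply/eqP => sE.
  have := heat_lateral (sg := sg) _ sE; rewrite sg_gt0 sg1 => /(_ isT); rewrite -/E; lra.
have E_ge0 : 0 <= E by rewrite mulr_ge0 ?expR_ge0// heat_ge0.
have sg_int : sg0 < sg.
  rewrite lt_neqAle sg0sg andbT; apply/eqP => sgE.
  have := init _ sell; rewrite sgE us -EFinD lee_fin; lra.
(* [heat sg] plus a constant touches [u] from below at [s]; lowering its Hessian by [2 e] times the
   identity makes the Taylor polynomial an admissible quadratic. *)
have space : \tr (hessian (heat sg) s) <= 0.
  set H := hessian (heat sg) s.
  apply/ler_addgt0Pl => e' e'0; rewrite addr0.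
  pose e := e' / (2 * n%:R + 1).
  have n1 : 0 < 2 * n%:R + 1 :> R by rewrite ltr_wpDl// mulr_ge0.
  have e0 : 0 < e by rewrite divr_gt0.
  have oT : open_nbhs s [set: 'rV[R]_n] by split => //; exact: openT.
  have C2h : C2_on [set: 'rV[R]_n] (heat sg) by apply: heat_C2; rewrite gt_eqF.
  have HT : H^T = H.
    by apply/matrixP => i j; rewrite mxE; exact: C2_hessian_sym oT C2h.
  have [r r0 hr] := C2_taylor oT C2h e0.
  pose r' := Num.min r (ell - `|s|).
  have r'0 : 0 < r' by rewrite lt_min r0 subr_gt0.
  have bilE z : bil (H - (2 * e)%:M) z z = bil H z z - 2 * e * dot z z.
    rewrite !bil_dot mulmxBr mul_mx_scalar -[in LHS]scaleN1r dotDl !dotZl.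
    by rewrite mulN1r.
  have XT : (H - (2 * e)%:M)^T = H - (2 * e)%:M by rewrite linearB/= HT tr_scalar_mx.
  have trX : \tr (H - (2 * e)%:M) = \tr H - (2 * e) *+ n.
    by rewrite linearB/= mxtrace_scalar.
  have below z : `|z| <= r' -> ((d + dot (gradient (heat sg) s) z +
      2^-1 * bil (H - (2 * e)%:M) z z)%:E <= u (s + z)%R)%E.
    rewrite le_min => /andP[zr zell].
    have := (hr z zr).2; rewrite ler_norml => /andP[tay _].
    have ez : e * `|z| ^+ 2 <= e * dot z z by rewrite ler_pM2l// sqr_norm_le_dot.
    have sz : `|s + z| <= ell by rewrite (le_trans (ler_normD _ _))//; lra.
    have := fmin (sg, s + z) (conj sgI sz); rewrite /f /m /= us.
    case: (u (s + z)) => [v| |//]; last by move=> _; exact: leey.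
    by rewrite -!EFinB !lee_fin bilE; rewrite -/H in tay; lra.
  have := u_super XT r'0 us below; rewrite trX.
  have : (2 * e) *+ n <= e'.
    rewrite -mulr_natr /e.
    have -> : 2 * (e' / (2 * n%:R + 1)) * n%:R = e' * (2 * n%:R / (2 * n%:R + 1)) by ring.
    by rewrite ler_piMr ?(ltW e'0)// ler_pdivrMr// mul1r; lra.
  lra.
have dm : is_derive sg (1 : R) (fun t => heat t s - eta * t) _ :=
  is_deriveB (heat_equation s (negbT (gt_eqF sg_gt0))) (is_deriveZ eta (is_derive_id sg (1 : R))).
have tmax t : sg0 <= t <= sg -> heat t s - eta * t <= heat sg s - eta * sg.
  move=> /andP[t0 t1]; have : A (t, s).
    by split => //=; rewrite in_itv/= t0 (le_trans t1).
  by move=> /fmin; rewrite /f /m /= us -!EFinB lee_fin; lra.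
have := deriv_ge0_of_left_max sg_int dm tmax.
rewrite /GRing.scale/= mulr1.
have : sg * \tr (hessian (heat sg) s) <= 0 by rewrite mulr_ge0_le0// ltW.
lra.
Unshelve. all: by end_near. Qed.

End HeatComparison.

(** * Semicontinuity, measurability and infima over balls *)

Section Semicontinuity.
Variables (R : realType) (n : nat).
Implicit Types (u : 'rV[R]_n -> \bar R) (x y z : 'rV[R]_n).

Lemma lsc_borel (f : borelRn R n -> \bar R) :
  lower_semicontinuous (f : 'rV[R]_n -> \bar R) -> measurable_fun setT f.
Proof.
move=> scif; apply: (measurability _ (ErealGenOInfty.measurableE R)).
move=> /= _ [_ [a ->]] <-; apply: measurableI => //; apply: sub_sigma_algebra.
by rewrite preimage_itvoy; move/lower_semicontinuousP : scif; exact.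
Qed.

Lemma usc_borel (f : borelRn R n -> \bar R) :
  (forall a : R, open [set x : 'rV[R]_n | (f x < a%:E)%E]) -> measurable_fun setT f.
Proof.
move=> scif; apply: (measurability _ (ErealGenInftyO.measurableE R)).
move=> /= _ [_ [a ->]] <-; apply: measurableI => //; apply: sub_sigma_algebra.
by rewrite preimage_itvNyo; exact: scif.
Qed.

Lemma continuous_affine x (S : 'M[R]_n) : continuous (fun s : 'rV[R]_n => x + s *m S).
Proof.
move=> s V /(near_le_ball V) [r r0 hr].
have [M M0 hM] := mulmx_bound S.
apply/(near_le_ball (fun s => V (x + s *m S))); exists (r / (M + 1)).
  by rewrite divr_gt0// ltr_wpDl.
move=> z zr; rewrite mulmxDl addrA; apply: hr.
apply: le_trans (hM z) _; apply: le_trans (ler_wpM2l M0 zr) _.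
by rewrite mulrA ler_pdivrMr ?ltr_wpDl// mulrC ler_pM2l// lerDl.
Qed.

Lemma continuous_reflect x : continuous (fun y => x - y).
Proof.
have -> : (fun y => x - y) = (fun y => x + y *m (- 1%:M)).
  by apply/funext => y; rewrite mulmxN mulmx1.
exact: continuous_affine.
Qed.

Lemma lsc_comp u (h : 'rV[R]_n -> 'rV[R]_n) : lower_semicontinuous u -> continuous h ->
  lower_semicontinuous (u \o h).
Proof.
move=> lu ch x a ax; have [V Vx Va] := lu _ _ ax.
by exists (h @^-1` V) => [|y]; [exact: ch|exact: Va].
Qed.

Definition infball u x (d : R) : \bar R := ereal_inf (u @` ball x d).

Lemma infball_le u x d z : ball x d z -> (infball u x d <= u z)%E.
Proof. by move=> xz; apply: ereal_inf_lbound; exists z. Qed.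

Lemma infball_ge u x d (a : \bar R) : (forall z, ball x d z -> (a <= u z)%E) ->
  (a <= infball u x d)%E.
Proof. by move=> h; apply: le_ereal_inf_tmp => _ [z xz <-]; exact: h. Qed.

Lemma infball_sub u x y d e : ball y e `<=` ball x d -> (infball u x d <= infball u y e)%E.
Proof. by move=> h; apply: infball_ge => z /h; exact: infball_le. Qed.

Lemma ballB x y d z : ball (x - y) d z -> ball x d (z + y).
Proof. by rewrite -!ball_normE /= -addrA -opprD [y + z]addrC. Qed.

Lemma ballB_in x y d z : ball x d z -> ball (x - y) d (z - y).
Proof. by rewrite -!ball_normE /= opprB addrA subrK. Qed.

Lemma ballB_sub x1 x2 y d e : ball x1 d `<=` ball x2 e -> ball (x1 - y) d `<=` ball (x2 - y) e.
Proof. by move=> h z /ballB/h/(ballB_in y); rewrite addrK. Qed.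

(** The set where the infimum is below [a] is a union of open sets, one for each [z] with [u z < a];
    thus the infimum is upper semicontinuous in [y]. *)
Lemma infball_borel u x d :
  measurable_fun setT (fun y : borelRn R n => infball u (x - (y : 'rV[R]_n)) d).
Proof.
apply: usc_borel => a.
rewrite (_ : [set _ | _] = \bigcup_(z in [set z | (u z < a%:E)%E]) [set y | ball x d (z + y)]).
  apply: bigcup_open => z _.
  apply: (@open_comp _ _ (fun y => z + y) (ball x d)) => [y _|]; last exact: ball_open.
  have -> : (fun y : 'rV[R]_n => z + y) = (fun y => z + y *m 1%:M).
    by apply/funext => y'; rewrite mulmx1.
  exact: continuous_affine.
apply/seteqP; split => y /=.
  by move/ereal_inf_lt => [_ [z xz <-] za]; exists z => //; exact: ballB.
move=> [z /= za xz]; apply: le_lt_trans za; apply: infball_le.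
by have := ballB_in y xz; rewrite addrK.
Qed.

(** The infima increase as the balls shrink and stay below [u x]; lower semicontinuity lets them
    pass every real number below [u x]. *)
Lemma infball_cvg u x (d : R) : lower_semicontinuous u -> u x != -oo%E -> 0 < d ->
  infball u x (d / k.+1%:R) @[k --> \oo] --> u x.
Proof.
move=> lu ux d0.
have le k : (infball u x (d / k.+1%:R) <= u x)%E.
  by apply: infball_le; apply: ballxx; rewrite divr_gt0.
have nd : nondecreasing_seq (fun k => infball u x (d / k.+1%:R)).
  move=> j k jk; apply: infball_sub; apply: le_ball.
  by rewrite ler_pM2l// lef_pV2 ?posrE// ler_nat ltnS.
have cv := ereal_nondecreasing_cvgn nd.
suff -> : u x = ereal_sup (range (fun k => infball u x (d / k.+1%:R))) by [].
apply/eqP; rewrite eq_le; apply/andP; split; last first.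
  by apply: ge_ereal_sup => _ [k _ <-].
have key (a : R) : (a%:E < u x)%E ->
    (a%:E <= ereal_sup (range (fun k => infball u x (d / k.+1%:R))))%E.
  move=> ax; have [V + Va] := lu _ _ ax.
  move=> /(near_le_ball V)[r r0 hr].
  have [k kr] : exists k, d / k.+1%:R <= r.
    exists (Num.truncn (d / r)); rewrite ler_pdivrMr// mulrC -ler_pdivrMr//.
    by apply: ltW; exact: truncnS_gt.
  apply: (@le_trans _ _ (infball u x (d / k.+1%:R))).
    apply: infball_ge => z; rewrite -ball_normE /= => xz; apply/ltW/Va.
    by rewrite -(subrKC x z); apply: hr; rewrite distrC; apply: ltW (lt_le_trans xz kr).
  by apply: ereal_sup_ubound; exists k.
move: ux key; case: (u x) => [r _ key|_ key|]; last by rewrite eqxx.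
  apply/lee_subgt0Pr => e e0; apply: key; rewrite lte_fin; lra.
suff -> : ereal_sup (range (fun k => infball u x (d / k.+1%:R))) = +oo%E by [].
by apply/eqyP => A A0; apply: key; exact: ltry.
Qed.

End Semicontinuity.

(* The negative parts of the translates [u (x - y)], [x] in [B], have the common
   integrable bound [C]; [D] is the set of full measure where [C] is finite. *)
Record neg_dominated (R : realType) (n : nat) (u : 'rV[R]_n -> \bar R)
    (mu : {measure set (borelRn R n) -> \bar R}) (D : set (borelRn R n))
    (C : borelRn R n -> R) (B : set 'rV[R]_n) : Prop := NegDominated {
  nd_D : measurable D;
  nd_null : mu (~` D) = 0%E;
  nd_meas : measurable_fun setT (EFin \o C);
  nd_ge0 : forall y, 0 <= C y;
  nd_fin : (\int[mu]_(y in D) (C y)%:E < +oo)%E;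
  nd_open : open B;
  nd_le : forall (x : 'rV[R]_n) (y : borelRn R n), B x -> D y ->
    ((- C y)%:E <= u (x - (y : 'rV[R]_n))%R)%E }.

(** * Approximation of the convolution by integrals of infima *)

Section Convolution.
Variables (R : realType) (n : nat) (u : 'rV[R]_n -> \bar R).
Variables (mu : {measure set (borelRn R n) -> \bar R}) (D : set (borelRn R n)).
Variables (C : borelRn R n -> R) (B : set 'rV[R]_n).
Hypothesis nd : neg_dominated u mu D C B.
Hypothesis u_lsc : lower_semicontinuous u.
Hypothesis u_ninfty : forall x, u x != -oo%E.

Local Notation mass := (fine (\int[mu]_(y in D) (C y)%:E)).

(** Adding [C] makes the integrand nonnegative as long as the ball lies in [B], so monotone
    convergence and the exchange with finite sums apply. *)
Definition mollified (d : R) (x : 'rV[R]_n) : \bar R :=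
  \int[mu]_(y in D) (infball u (x - (y : 'rV[R]_n)) d + (C y)%:E)%E.

Let mD := nd_D nd.

Let mCD : measurable_fun D (fun y => (C y)%:E).
Proof. exact: (measurable_funS measurableT (@subsetT _ D) (nd_meas nd)). Qed.

Let mu_shift x : measurable_fun setT (fun y : borelRn R n => u (x - (y : 'rV[R]_n))).
Proof. by apply: lsc_borel; exact: lsc_comp u_lsc (@continuous_reflect R n x). Qed.

Let integral_C : (\int[mu]_(y in D) (C y)%:E)%E = mass%:E.
Proof.
rewrite fineK// ge0_fin_numE; first exact: nd_fin nd.
by apply: integral_ge0 => y _; rewrite lee_fin (nd_ge0 nd).
Qed.

(** The convolution is the difference of the integrals of two parts; on [D] the negative part is at
    most [C], so its integral is finite and can be moved across the equation. *)
Lemma convolution_shift x : B x ->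
  (\int[mu]_(y in D) (u (x - (y : 'rV[R]_n))%R + (C y)%:E) = convolution u mu x + mass%:E)%E.
Proof.
move=> Bx.
pose f (y : borelRn R n) := u (x - (y : 'rV[R]_n)).
have mf : measurable_fun setT f := mu_shift x.
have mfD : measurable_fun D f := measurable_funS measurableT (@subsetT _ D) mf.
have fD : (\int[mu]_y f y = \int[mu]_(y in D) f y)%E.
  have DE : D = setT `\` ~` D by rewrite setTD setCK.
  have mDc : measurable (~` D) by exact: measurableC.
  rewrite [LHS]integralE [RHS]integralE [in RHS]DE.
  rewrite -!(ge0_negligible_integral (mu := mu) mDc measurableT)//.
  - exact: measurable_funeneg.
  - exact: nd_null nd.
  - exact: measurable_funepos.
  - exact: nd_null nd.
have -> : convolution u mu x = (\int[mu]_(y in D) f y)%E by rewrite -fD.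
have fC y : D y -> (f^\- y <= (C y)%:E)%E.
  move=> Dy; rewrite funenegE ge_max lee_fin (nd_ge0 nd) andbT.
  by rewrite leeNl -EFinN; exact: nd_le nd _ _ Bx Dy.
have f0 y : D y -> (0 <= f y + (C y)%:E)%E.
  move=> Dy; have := nd_le nd Bx Dy; rewrite -/(f y).
  case: (f y) => [r|_|//]; last by rewrite leey.
  by rewrite -EFinD !lee_fin; lra.
have mfC : measurable_fun D (fun y => f y + (C y)%:E)%E by exact: emeasurable_funD.
have Nint0 : (0 <= \int[mu]_(y in D) f^\- y)%E by exact: integral_ge0.
have Nint : (\int[mu]_(y in D) f^\- y <= mass%:E)%E.
  rewrite -integral_C; apply: ge0_le_integral => //.
  exact: measurable_funeneg.
have key : (\int[mu]_(y in D) (f y + (C y)%:E) + \int[mu]_(y in D) f^\- y =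
     \int[mu]_(y in D) f^\+ y + mass%:E)%E.
  rewrite -integral_C -ge0_integralD//; last exact: measurable_funeneg.
  rewrite -ge0_integralD//; first last.
  - by move=> y _; rewrite lee_fin (nd_ge0 nd).
  - exact: measurable_funepos.
  apply: eq_integral => y; rewrite inE => Dy.
  have fN := fC y Dy; have fn0 : (0 <= f^\- y)%E by exact: funeneg_ge0.
  have fp0 : (0 <= f^\+ y)%E by exact: funepos_ge0.
  have : f y = (f^\+ y - f^\- y)%E by have /(congr1 (@^~ y)) := funeposneg f.
  case: (f^\- y)%E fn0 fN => [r _ _|//|//] fE.
  move: fp0; case: (f^\+ y)%E fE => [r' -> _|-> _|//].
    by rewrite -!(EFinB, EFinD); congr (_%:E); ring.
  by [].
rewrite [in RHS]integralE.
move: key Nint0 Nint; case: (\int[mu]_(y in D) f^\- y)%E => [r|//|//] key _ _.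
move: key; case: (\int[mu]_(y in D) (f y + (C y)%:E))%E;
  case: (\int[mu]_(y in D) f^\+ y)%E => //.
by move=> s t; rewrite -!(EFinB, EFinD) => -[E]; congr (_%:E); lra.
Qed.

Let infball_ge0 d x y : ball x d `<=` B -> D y ->
  (0 <= infball u (x - (y : 'rV[R]_n)) d + (C y)%:E)%E.
Proof.
move=> xB Dy.
have : ((- C y)%:E <= infball u (x - (y : 'rV[R]_n)) d)%E.
  apply: infball_ge => z xz; rewrite -(addrK (y : 'rV[R]_n) z).
  by apply: nd_le nd _ _ _ Dy; apply: xB; exact: ballB.
case: infball => [r| |]; last by rewrite leeNy_eq.
  by rewrite -EFinD !lee_fin; lra.
by move=> _; exact: leey.
Qed.

Let infball_meas d x :
  measurable_fun D (fun y => infball u (x - (y : 'rV[R]_n)) d + (C y)%:E)%E.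
Proof.
apply: emeasurable_funD => //.
exact: (measurable_funS measurableT (@subsetT _ D) (@infball_borel R n u x d)).
Qed.

Lemma mollified_le d e x y : ball y e `<=` ball x d -> ball x d `<=` B ->
  (mollified d x <= mollified e y)%E.
Proof.
move=> yx xB; apply: ge0_le_integral => //.
- by move=> z Dz; exact: infball_ge0.
- by move=> z Dz; rewrite leeD2r// infball_sub//; exact: ballB_sub.
Qed.

(** Monotone convergence along the radii [d / (k+1)]. *)
Lemma mollified_gt x (r : R) : B x -> (r%:E < convolution u mu x + mass%:E)%E ->
  exists d : R, [/\ 0 < d, ball x d `<=` B & (r%:E < mollified d x)%E].
Proof.
move=> Bx rw.
have [d d0 dB] : exists2 d : R, 0 < d & ball x d `<=` B.
  have /nbhs_ballP[d /= d0 dB] : nbhs x B by apply: open_nbhs_nbhs; split => //; exact: nd_open nd.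
  by exists d.
pose dk k := d / k.+1%:R.
have dk0 k : 0 < dk k by rewrite divr_gt0.
have dkd k : dk k <= d by rewrite ler_pdivrMr// ler_peMr ?(ltW d0)// ler1n.
have sub k : ball x (dk k) `<=` B by apply: subset_trans dB; exact: le_ball.
have := @cvg_monotone_convergence _ _ _ mu D mD
  (fun k y => infball u (x - (y : 'rV[R]_n)) (dk k) + (C y)%:E)%E.
move=> /(_ (fun k => infball_meas (dk k) x)) /(_ (fun k y => infball_ge0 (sub k))).
have mono : forall y, D y -> {homo (fun k => (infball u (x - (y : 'rV[R]_n)) (dk k) + (C y)%:E)%E)
    : j k / (j <= k)%N >-> (j <= k)%E}.
  move=> y Dy j k jk; rewrite leeD2r//; apply: infball_sub; apply: le_ball.
  by rewrite ler_pM2l// lef_pV2 ?posrE// ler_nat ltnS.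
move=> /(_ mono).
have -> : (\int[mu]_(y in D) limn ((fun k y => infball u (x - (y : 'rV[R]_n)) (dk k) + (C y)%:E) ^~ y) =
   convolution u mu x + mass%:E)%E.
  rewrite -convolution_shift//; apply: eq_integral => y; rewrite inE => Dy.
  apply: cvg_lim => //; apply: cvgeD.
  - by apply: fin_num_adde_defl.
  - by apply: infball_cvg.
  - exact: cvg_cst.
move=> cv.
have nr : nbhs (convolution u mu x + mass%:E)%E [set y | (r%:E < y)%E].
  by apply: open_nbhs_nbhs; split => //; exact: open_ereal_gt_ereal.
have [N _ /(_ N (leqnn N)) HN] := cv _ nr.
by exists (dk N); split.
Qed.

(** Balls of half the radius about nearby points stay inside the ball about [x]. This one fact gives
    both the lower semicontinuity of the convolution and the uniform radius of
    [mollified_uniform]. *)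
Lemma mollified_gt_near x (r : R) : B x -> (r%:E < convolution u mu x + mass%:E)%E ->
  exists2 d : R, 0 < d & forall e y, 0 < e <= d -> ball x d y ->
    ball y e `<=` B /\ (r%:E < mollified e y)%E.
Proof.
move=> Bx rw; have [d [d0 dB rd]] := mollified_gt Bx rw.
exists (d / 2) => [|e y /andP[e0 ed] xy]; first by rewrite divr_gt0.
have sub : ball y e `<=` ball x d.
  by move=> z yz; rewrite (splitr d); apply: ball_triangle xy _; exact: le_ball yz.
split; first exact: subset_trans dB.
by apply: lt_le_trans rd _; exact: mollified_le.
Qed.

Lemma mollified_le_convolution d x : 0 < d -> ball x d `<=` B ->
  (mollified d x <= convolution u mu x + mass%:E)%E.
Proof.
move=> d0 xB; have Bx : B x by apply: xB; exact: ballxx.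
rewrite -convolution_shift//; apply: ge0_le_integral => //.
- by move=> z Dz; exact: infball_ge0.
- apply: emeasurable_funD => //.
  exact: measurable_funS measurableT (@subsetT _ D) (mu_shift x).
- by move=> z Dz; rewrite leeD2r// infball_le//; exact: ballxx.
Qed.

Lemma convolution_ge x : B x -> (0 <= convolution u mu x + mass%:E)%E.
Proof.
move=> Bx; rewrite -convolution_shift//; apply: integral_ge0 => y Dy.
have := nd_le nd Bx Dy; case: (u _) => [r|_|//]; last by rewrite leey.
by rewrite -EFinD !lee_fin; lra.
Qed.

Lemma convolution_lsc_at x (r : R) : B x -> (r%:E < convolution u mu x)%E ->
  \forall y \near x, (r%:E < convolution u mu y)%E.
Proof.
move=> Bx rw.
have [d d0 hd] : exists2 d : R, 0 < d & forall e y, 0 < e <= d -> ball x d y ->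
    ball y e `<=` B /\ ((r + mass)%:E < mollified e y)%E.
  by apply: mollified_gt_near => //; rewrite EFinD lteD2rE.
apply/nbhs_ballP; exists d => // y xy.
have [|yB ry] := hd d y _ xy; first by rewrite d0 lexx.
have := lt_le_trans ry (mollified_le_convolution d0 yB).
by rewrite EFinD lteD2rE.
Qed.

(** A Dini argument: every point has a radius that works nearby, and compactness makes it
    uniform. *)
Lemma mollified_uniform (K : set 'rV[R]_n) (psi : 'rV[R]_n -> R) :
  compact K -> K `<=` B -> continuous psi ->
  (forall x, K x -> ((psi x)%:E < convolution u mu x + mass%:E)%E) ->
  exists2 d : R, 0 < d & forall x, K x -> ball x d `<=` B /\ ((psi x)%:E <= mollified d x)%E.
Proof.
move=> cK KB cpsi psiw.
have /compact_near_coveringP cov := cK.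
have := cov R 0^'+ (fun d x => ball x d `<=` B /\ ((psi x)%:E <= mollified d x)%E) _ _.
case=> [x Kx|e /= e0 he].
  have [r pr rw] : exists2 r : R, psi x < r & (r%:E < convolution u mu x + mass%:E)%E.
    have := psiw x Kx; case: (_ + _)%E => [t| _|//].
      rewrite lte_fin => pt; exists ((psi x + t) / 2); rewrite ?lte_fin.
        by rewrite ltr_pdivlMr//; lra.
      by rewrite ltr_pdivrMr//; lra.
    by exists (psi x + 1); [lra|exact: ltry].
  have [d d0 hd] := mollified_gt_near (KB _ Kx) rw.
  exists ([set y | ball x d y /\ psi y < r], [set e : R | 0 < e <= d]).
    split => /=; last first.
      near=> e; apply/andP; split; near: e; [exact: nbhs_right_gt|exact: nbhs_right_le].
    apply: filterI; first exact: nbhsx_ballx.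
    have /cvgrPdist_lt/(_ (r - psi x)) := cpsi x; rewrite subr_gt0 => /(_ pr).
    by apply: filterS => y; rewrite distrC => /(le_lt_trans (ler_norm _)); lra.
  move=> [y f] /= [[xy py] fd]; have [h1 h2] := hd f y fd xy; split => //.
  by apply: ltW; apply: lt_trans h2; rewrite lte_fin.
exists (e / 2); first by rewrite divr_gt0.
move=> x Kx; apply: he => //; last by rewrite divr_gt0.
by rewrite /ball_/= sub0r normrN gtr0_norm ?divr_gt0//; lra.
Unshelve. all: by end_near. Qed.

End Convolution.

(** * The weighted mean-value inequality for the convolution *)

Section KernelInequality.
Variables (R : realType) (c : R) (Phi : R -> R) (gPhi : gauss_cdf c Phi).
Variables (n : nat) (F : 'M[R]_n -> R) (u : 'rV[R]_n -> \bar R).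
Hypothesis hu : viscosity_supersolution F u.
Variable S : 'M[R]_n.
Hypothesis S_unit : S \in unitmx.
Hypothesis S_le : forall X, X^T = X -> \tr (S *m X *m S^T) <= F X.
Implicit Types (x y s z p : 'rV[R]_n).

Lemma lsc_addr (f : 'rV[R]_n -> \bar R) (r : R) : lower_semicontinuous f ->
  lower_semicontinuous (fun x => f x + r%:E)%E.
Proof.
move=> lf x a ax; have [|V Vx Va] := lf x (a - r); first by rewrite EFinB lteBlDr.
by exists V => // y /Va; rewrite EFinB lteBlDr.
Qed.

(* The change of variables [s |-> q + s *m S] turns supersolutions of [F] into
   superharmonic functions. *)
Lemma affine_superharmonic q (r0 : R) s (d r : R) g X : X^T = X -> 0 < r ->
  (u (q + s *m S)%R + r0%:E)%E = d%:E ->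
  (forall z, `|z| <= r ->
    ((d + dot g z + 2^-1 * bil X z z)%:E <= u (q + (s + z) *m S)%R + r0%:E)%E) ->
  \tr X <= 0.
Proof.
move=> XT rp usd below.
have us : u (q + s *m S) = (d - r0)%:E.
  by move: usd; case: (u _) => [v|//|//]; rewrite -EFinD => -[<-]; congr (_%:E); ring.
pose T := invmx S.
pose X' := T *m X *m T^T.
have X'T : X'^T = X' by rewrite /X' !trmx_mul trmxK XT mulmxA.
have [M M0 hM] := mulmx_bound T.
have <- : \tr (S *m X' *m S^T) = \tr X.
  rewrite /X' !mulmxA mulmxV// mul1mx -mulmxA -trmx_mul mulmxV//.
  by rewrite trmx1 mulmx1.
apply: le_trans (S_le X'T) _.
apply: (viscosity_quadratic_test (r := r / (M + 1)) (b := g *m T^T) hu X'T _ us).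
  by rewrite divr_gt0// ltr_wpDl.
move=> z zr.
have zT : `|z *m T| <= r.
  apply: le_trans (hM z) _; apply: le_trans (ler_wpM2l M0 zr) _.
  by rewrite mulrA ler_pdivrMr ?ltr_wpDl// mulrC ler_pM2l// lerDl.
have := below _ zT; rewrite mulmxDl -mulmxA mulVmx// mulmx1 addrA.
have -> : dot g (z *m T) = dot (g *m T^T) z by rewrite /dot trmx_mul mulmxA.
have -> : bil X (z *m T) (z *m T) = bil X' z z by rewrite /bil trmx_mul !mulmxA.
case: (u _) => [v|_|//]; last by rewrite leey.
by rewrite -EFinD !lee_fin; lra.
Qed.

Variables (mu : {measure set (borelRn R n) -> \bar R}) (D : set (borelRn R n)).
Variables (C : borelRn R n -> R) (B : set 'rV[R]_n).
Hypothesis nd : neg_dominated u mu D C B.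

Local Notation mass := (fine (\int[mu]_(y in D) (C y)%:E)).

Variables (J : finType) (a b : J -> 'I_n -> R) (K rho delta : R) (p : 'rV[R]_n).
Variables (x : J -> 'rV[R]_n) (psi : J -> R).
Hypotheses (K1 : 1 <= K) (rho0 : 0 < rho) (delta0 : 0 < delta).
Hypothesis hab : forall k i, [/\ - K <= a k i, a k i <= b k i & b k i <= K].
Hypothesis prob : forall sg s, 0 < sg ->
  \sum_k tensor (fun i => pcell Phi sg (a k i) (b k i)) s <= 1.
Hypothesis inB : forall s, `|s| <= n.+3%:R * K -> B (p + s *m S).
Hypothesis cells : forall k s,
  (forall i, a k i - rho <= s ord0 i <= b k i + rho) -> ball (x k) delta (p + s *m S).
Hypothesis xB : forall k, ball (x k) delta `<=` B.
Hypothesis psi_le : forall k, ((psi k)%:E <= mollified u mu D C delta (x k))%E.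

Let wt k := tensor (fun i => pcell Phi 1 (a k i) (b k i)) 0.

Let wt_ge0 k : 0 <= wt k.
Proof.
by apply: prodr_ge0 => i _; apply: (pcell_ge0 gPhi) => //; have [] := hab k i.
Qed.

Let eps := expR (- K ^+ 2).

Let eps_le1 : 0 <= 1 - eps.
Proof. by rewrite subr_ge0 -expR0 ler_expR oppr_le0 sqr_ge0. Qed.

(** [heat_comparison] for the translate of [u] by [y], in the coordinates given by [S], with the
    infima over the balls about [x k - y], raised by [C y], as step values. *)
Let pointwise (y : borelRn R n) : D y ->
  (\sum_k ((1 - eps) * wt k)%:E *
     (infball u (x k - (y : 'rV[R]_n))%R delta + (C y)%:E) <=
   u (p - (y : 'rV[R]_n))%R + (C y)%:E)%E.
Proof.
move=> Dy; have [uN ul ud _] := hu.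
pose y' := y : 'rV[R]_n.
(* Step values must be real: density of the points where [u] is finite bounds the infimum above,
   [- C y] bounds it below. *)
have inf_fin k : exists v : R, infball u (x k - y') delta = v%:E /\ - C y <= v.
  have [z [xz zfin]] : ball (x k - y') delta `&` [set z | u z \is a fin_num] !=set0.
    by apply: ud; [exists (x k - y'); exact: ballxx|exact: ball_open].
  have h1 : (infball u (x k - y') delta < +oo)%E.
    by apply: le_lt_trans (infball_le u xz) _; rewrite ltey_eq zfin.
  have h2 : ((- C y)%:E <= infball u (x k - y') delta)%E.
    apply: infball_ge => t xt; rewrite -(addrK y' t).
    by apply: (nd_le nd _ Dy); apply: xB; exact: (ballB xt).
  by case: infball h1 h2 => [v _|//|//]; rewrite lee_fin => h; exists v.
have [v hv] := choice inf_fin.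
have := @heat_comparison R c Phi gPhi n J (fun k => v k + C y) a b K rho
  (fun s => u (p - y' + s *m S)%R + (C y)%:E)%E K1 rho0 _ hab prob _ _ _ _.
rewrite mul0mx addr0.
have -> : (\sum_k ((1 - eps) * wt k)%:E * (infball u (x k - y')%R delta + (C y)%:E) =
   ((1 - expR (- K ^+ 2)) * heat Phi (fun k => v k + C y)%R a b 1 0)%:E)%E.
  rewrite /heat mulr_sumr -sumEFin; apply: eq_bigr => k _.
  by rewrite (hv k).1 -EFinD -EFinM; congr (_%:E); rewrite /wt /eps; ring.
apply.
- by move=> k; have := (hv k).2; lra.
- apply: lsc_addr; exact: lsc_comp ul (@continuous_affine R n (p - y') S).
- move=> s /inB Bs; rewrite addrAC; have := nd_le nd Bs Dy.
  case: (u _) => [t|_|//]; last by rewrite leey.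
  by rewrite -EFinD !lee_fin; lra.
- move=> s d r g X; exact: affine_superharmonic.
- move=> k s /cells/(ballB_in y')/(infball_le u).
  rewrite (hv k).1 addrAC; case: (u _) => [t|_|//]; last by rewrite leey.
  by rewrite -EFinD !lee_fin; lra.
Qed.

(** Integration of [pointwise] over [D]: all terms are nonnegative, so the sum leaves the integral,
    and each term becomes a [mollified] value, at least [psi k]. *)
Lemma kernel_inequality :
  (((1 - expR (- K ^+ 2)) *
     \sum_k psi k * tensor (fun i => pcell Phi 1 (a k i) (b k i)) 0)%:E <=
   convolution u mu p + mass%:E)%E.
Proof.
have [uN ul ud _] := hu.
have Bp : B p by have := @inB 0; rewrite mul0mx addr0 normr0; apply; rewrite mulr_ge0// (le_trans ler01 K1).
have inf0 k y : D y -> (0 <= infball u (x k - (y : 'rV[R]_n))%R delta + (C y)%:E)%E.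
  move=> Dy.
  have : ((- C y)%:E <= infball u (x k - (y : 'rV[R]_n)) delta)%E.
    apply: infball_ge => t xt; rewrite -(addrK (y : 'rV[R]_n) t).
    by apply: (nd_le nd _ Dy); apply: xB; exact: (ballB xt).
  case: infball => [v|_|//]; last by rewrite leey.
  by rewrite -EFinD !lee_fin; lra.
have mC : measurable_fun D (fun y => (C y)%:E).
  exact: (measurable_funS measurableT (@subsetT _ D) (nd_meas nd)).
have minf k : measurable_fun D
    (fun y => infball u (x k - (y : 'rV[R]_n)) delta + (C y)%:E)%E.
  apply: emeasurable_funD => //.
  exact: (measurable_funS measurableT (@subsetT _ D) (@infball_borel R n u (x k) delta)).
rewrite -(convolution_shift nd ul Bp).
pose G k (y : borelRn R n) := (((1 - eps) * wt k)%:E *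
     (infball u (x k - (y : 'rV[R]_n))%R delta + (C y)%:E))%E.
have mG k : measurable_fun D (G k) by exact: measurable_funeM.
have c0 k : 0 <= (1 - eps) * wt k by rewrite mulr_ge0.
have G0 k y : D y -> (0 <= G k y)%E.
  by move=> Dy; rewrite mule_ge0 ?lee_fin// inf0.
apply: (@le_trans _ _ (\int[mu]_(y in D) (\sum_k G k y))%E); last first.
  apply: ge0_le_integral => //.
  - exact: nd_D nd.
  - by move=> y Dy; apply: sume_ge0 => k _; exact: G0.
  - exact: emeasurable_sum.
  - apply: emeasurable_funD => //.
    apply: (measurable_funS measurableT (@subsetT _ D)).
    by apply: lsc_borel; exact: lsc_comp ul (@continuous_reflect R n p).
rewrite ge0_integral_sum//; last exact: nd_D nd.
rewrite mulr_sumr -sumEFin; apply: lee_sum => k _.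
rewrite ge0_integralZl_EFin//; [|exact: nd_D nd|by move=> y; exact: inf0].
rewrite mulrA mulrAC EFinM; apply: lee_wpmul2l; first (rewrite lee_fin; exact: (c0 k)).
exact: psi_le.
Qed.

End KernelInequality.

(** * Regular grids in a box *)

Section Grid.
Variables (R : realType) (c : R) (Phi : R -> R) (gPhi : gauss_cdf c Phi).
Variables (n : nat) (al be : 'I_n -> R) (m : nat).
Hypothesis al_be : forall i, al i <= be i.
Hypothesis m0 : (0 < m)%N.

Let m0R : 0 < m%:R :> R. Proof. by rewrite ltr0n. Qed.

Definition gstep i : R := (be i - al i) / m%:R.
Definition gleft i (k : nat) : R := al i + k%:R * gstep i.
Definition gmid i (k : nat) : R := al i + (k%:R + 2^-1) * gstep i.
Definition gmids (f : {ffun 'I_n -> 'I_m}) : 'rV[R]_n := \row_i gmid i (f i).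
Definition gcell sg t i (k : nat) := pcell Phi sg (gleft i k) (gleft i k.+1) t.

Lemma gstep_ge0 i : 0 <= gstep i.
Proof. by rewrite divr_ge0// subr_ge0. Qed.

Lemma gleft_bounds i (k : 'I_m) :
  [/\ al i <= gleft i k, gleft i k <= gleft i k.+1 & gleft i k.+1 <= be i].
Proof.
have s0 := gstep_ge0 i; split.
- by rewrite lerDl mulr_ge0.
- by rewrite lerD2l ler_wpM2r// ler_nat.
- have -> : be i = al i + m%:R * gstep i.
    by rewrite /gstep mulrC divfK ?gt_eqF//; ring.
  by rewrite lerD2l ler_wpM2r// ler_nat.
Qed.

Lemma gmid_mid i k : gmid i k = (gleft i k + gleft i k.+1) / 2.
Proof. by rewrite /gmid /gleft -natr1; field. Qed.

Lemma gcell_sum sg t i : \sum_(k < m) gcell sg t i k = pcell Phi sg (al i) (be i) t.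
Proof.
rewrite /gcell /pcell -(big_mkord xpredT (fun k => Phi ((gleft i k.+1 - t) / sg) - Phi ((gleft i k - t) / sg))).
rewrite telescope_sumr// /gleft mul0r addr0.
by rewrite (_ : al i + m%:R * gstep i = be i)// /gstep mulrC divfK ?gt_eqF//; ring.
Qed.

(** Distributivity reduces sums over all cells to one-dimensional sums; the choices of [h] give the
    total mass and the moments of the weights. *)
Lemma grid_moment sg (t : 'rV[R]_n) (h : 'I_n -> nat -> R) :
  \sum_(f : {ffun 'I_n -> 'I_m}) (\prod_i h i (f i)) * tensor (fun i => pcell Phi sg (gleft i (f i)) (gleft i (f i).+1)) t =
  \prod_i \sum_(k < m) h i k * gcell sg (t ord0 i) i k.
Proof.
rewrite (bigA_distr_bigA (fun i (k : 'I_m) => h i k * gcell sg (t ord0 i) i k)).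
by apply: eq_bigr => f _; rewrite -big_split.
Qed.

Lemma grid_mass sg t :
  \sum_(f : {ffun 'I_n -> 'I_m}) tensor (fun i => pcell Phi sg (gleft i (f i)) (gleft i (f i).+1)) t =
  \prod_i pcell Phi sg (al i) (be i) (t ord0 i).
Proof.
rewrite -(eq_bigr _ (fun i _ => gcell_sum sg (t ord0 i) i)).
have := grid_moment sg t (fun _ _ => 1) => h.
rewrite [RHS](eq_bigr (fun i => \sum_(k < m) 1 * gcell sg (t ord0 i) i k)); last first.
  by move=> i _; apply: eq_bigr => k _; rewrite mul1r.
by rewrite -h; apply: eq_bigr => f _; rewrite big1 ?mul1r.
Qed.

Lemma grid_mass_le1 sg t : 0 < sg ->
  \sum_(f : {ffun 'I_n -> 'I_m}) tensor (fun i => pcell Phi sg (gleft i (f i)) (gleft i (f i).+1)) t <= 1.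
Proof.
move=> sg0; rewrite grid_mass; apply: prodr_ile1 => i _.
by rewrite (pcell_le1 gPhi) andbT (pcell_ge0 gPhi).
Qed.

Lemma gmid_close i (k : 'I_m) (rho t : R) :
  gleft i k - rho <= t <= gleft i k.+1 + rho -> `|gmid i k - t| <= gstep i + rho.
Proof.
have s0 := gstep_ge0 i.
have -> : gleft i k.+1 = gleft i k + gstep i by rewrite /gleft -natr1; ring.
rewrite /gmid mulrDl addrA -/(gleft i k) ler_norml => /andP[? ?].
by apply/andP; split; lra.
Qed.

End Grid.

(** * The mean-value inequality on a fine grid *)

Section GridInequality.
Variables (R : realType) (c : R) (Phi : R -> R) (gPhi : gauss_cdf c Phi).
Variables (n : nat) (F : 'M[R]_n -> R) (u : 'rV[R]_n -> \bar R).
Hypothesis hu : viscosity_supersolution F u.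
Variable S : 'M[R]_n.
Hypothesis S_unit : S \in unitmx.
Hypothesis S_le : forall X, X^T = X -> \tr (S *m X *m S^T) <= F X.
Variables (mu : {measure set (borelRn R n) -> \bar R}) (D : set (borelRn R n)).
Variables (C : borelRn R n -> R) (B : set 'rV[R]_n).
Hypothesis nd : neg_dominated u mu D C B.

Local Notation mass := (fine (\int[mu]_(y in D) (C y)%:E)).

Variables (al be : 'I_n -> R) (K : R) (p : 'rV[R]_n) (psi : 'rV[R]_n -> R).
Hypothesis K1 : 1 <= K.
Hypothesis box : forall i, [/\ - K <= al i, al i <= be i & be i <= K].
Hypothesis inB : forall s : 'rV[R]_n, `|s| <= n.+3%:R * K -> B (p + s *m S).
Hypothesis psi_cont : continuous psi.
Hypothesis psi_lt : forall s : 'rV[R]_n, (forall i, al i <= s ord0 i <= be i) ->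
  ((psi (p + s *m S))%:E < convolution u mu (p + s *m S)%R + mass%:E)%E.

(** The radius from [mollified_uniform] is fixed first and the grid refined afterwards. The box may
    be smaller than the cube of side [2 K]: the density argument takes a small one off the centre,
    the touching argument the full cube. *)
Lemma grid_inequality : exists m0 : nat, forall m, (m0 <= m)%N -> (0 < m)%N ->
  (((1 - expR (- K ^+ 2)) * \sum_(f : {ffun 'I_n -> 'I_m})
      psi (p + gmids al be f *m S) *
      tensor (fun i => pcell Phi 1 (gleft al be m i (f i)) (gleft al be m i (f i).+1)) 0)%:E <=
   convolution u mu p + mass%:E)%E.
Proof.
have [uN ul _ _] := hu.
have K0 : 0 < K by exact: lt_le_trans ltr01 K1.
pose Q := (fun s : 'rV[R]_n => p + s *m S) @` [set s : 'rV[R]_n | forall i, `[al i, be i]%classic (s ord0 i)].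
have box_le (s : 'rV[R]_n) : (forall i, al i <= s ord0 i <= be i) -> `|s| <= n.+3%:R * K.
  move=> sb; apply: le_trans (_ : K <= _); last first.
    by rewrite ler_peMl ?(ltW K0)// ler1n.
  apply: norm_le_coord => [|i]; first exact: ltW.
  have [h1 _ h2] := box i; have /andP[h3 h4] := sb i.
  by rewrite ler_norml (le_trans h1 h3) (le_trans h4 h2).
have cQ : compact Q.
  apply: continuous_compact; last first.
    by apply: (@rV_compact R n (fun i => `[al i, be i]%classic)) => i; exact: segment_compact.
  by apply: continuous_subspaceT => s; exact: continuous_affine.
have QB : Q `<=` B.
  move=> _ [s sb <-]; apply: inB; apply: box_le => i.
  by have := sb i; rewrite /= in_itv.
have [|d d0 hd] := mollified_uniform nd ul uN cQ QB psi_cont.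
  move=> _ [s sb <-]; apply: psi_lt => i.
  by have := sb i; rewrite /= in_itv.
have [M M0 hM] := mulmx_bound S.
(* Points of an enlarged cell are within [2 rho] of its midpoint; [S] stretches this to at most
   [d / 2], inside the ball of radius [d]. *)
pose rho := d / (4 * (M + 1)).
have M1 : 0 < 4 * (M + 1) by rewrite mulr_gt0// ltr_wpDl.
have rho0 : 0 < rho by rewrite divr_gt0.
(* From here on the grid step, at most [2 K / m], is at most [rho]. *)
exists (Num.truncn (2 * K / rho)).+1 => m mm m0.
have m0R : 0 < m%:R :> R by rewrite ltr0n.
have al_be i : al i <= be i by have [] := box i.
have stepK i : gstep al be m i <= rho.
  rewrite /gstep ler_pdivrMr// mulrC -ler_pdivrMr//.
  apply: (@le_trans _ _ (2 * K / rho)).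
    by rewrite ler_pM2r ?invr_gt0//; have [] := box i; lra.
  apply: (@le_trans _ _ (Num.truncn (2 * K / rho)).+1%:R); last by rewrite ler_nat.
  by apply: ltW; exact: truncnS_gt.
have mid_in (f : {ffun 'I_n -> 'I_m}) : Q (p + gmids al be f *m S).
  exists (gmids al be f) => // i; rewrite /= mxE in_itv/= gmid_mid.
  by have [h1 h2 h3] := gleft_bounds al_be m0 i (f i); apply/andP; split; lra.
apply: (kernel_inequality gPhi hu S_unit S_le nd (x := fun f => p + gmids al be f *m S)
  (psi := fun f => psi (p + gmids al be f *m S)) (rho := rho) (delta := d)) => //.
- move=> f i; have [h1 h2 h3] := gleft_bounds al_be m0 i (f i).
  by have [h4 _ h5] := box i; split => //; [exact: le_trans h1|exact: le_trans h5].
- by move=> sg s sg0; exact: (grid_mass_le1 gPhi al_be m0).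
- move=> f s hs; rewrite -ball_normE /=.
  have -> : p + gmids al be f *m S - (p + s *m S) = (gmids al be f - s) *m S.
    by rewrite mulmxBl opprD addrACA subrr add0r.
  apply: le_lt_trans (hM _) _.
  apply: (@le_lt_trans _ _ (M * (2 * rho))).
    rewrite ler_wpM2l//; apply: norm_le_coord => [|i]; first by rewrite mulr_ge0 ?ltW.
    rewrite !mxE; apply: le_trans (gmid_close al_be (hs i)) _.
    by have := stepK i; lra.
  have -> : M * (2 * rho) = d / 2 * (M / (M + 1)).
    by rewrite /rho; field; rewrite gt_eqF// ltr_wpDl.
  apply: (@le_lt_trans _ _ (d / 2)); last lra.
  apply: ler_piMr; first by rewrite divr_ge0 ?(ltW d0).
  by rewrite ler_pdivrMr ?ltr_wpDl// mul1r lerDl.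
- by move=> f; exact: (hd _ (mid_in f)).1.
- by move=> f; exact: (hd _ (mid_in f)).2.
Qed.

End GridInequality.

(** What all four conditions say about the negative parts of the translates. [B] only has to contain
    the sup-norm ball, so each condition can supply its own open set. *)
Definition locally_dominated (R : realType) (n : nat) (u : 'rV[R]_n -> \bar R)
    (mu : {measure set (borelRn R n) -> \bar R}) : Prop :=
  forall r : R, 0 < r -> exists D C B,
    neg_dominated u mu D C B /\ forall x : 'rV[R]_n, `|x| < r -> B x.

(** * Semicontinuity of the convolution and density of its finiteness set *)

Section Density.
Variables (R : realType) (c : R) (Phi : R -> R) (gPhi : gauss_cdf c Phi).
Variables (n : nat) (F : 'M[R]_n -> R) (u : 'rV[R]_n -> \bar R).
Hypothesis hu : viscosity_supersolution F u.
Variable mu : {measure set (borelRn R n) -> \bar R}.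
Hypothesis loc : locally_dominated u mu.
Variable S : 'M[R]_n.
Hypothesis S_unit : S \in unitmx.
Hypothesis S_le : forall X, X^T = X -> \tr (S *m X *m S^T) <= F X.

Lemma pcell_gt0 a b : a < b -> 0 < pcell Phi 1 a b 0.
Proof.
move=> ab; rewrite /pcell !subr0 !divr1.
have [x _ ->] := mean_value (ltW ab) (fun y _ => gauss_deriv gPhi y).
by rewrite mulr_gt0 ?subr_gt0// mulr_gt0 ?gpdf_gt0 ?(gauss_c_gt0 gPhi).
Qed.

Lemma convolution_ninfty x : convolution u mu x != -oo%E.
Proof.
have [uN ul _ _] := hu.
have [|D [C [B [nd BB]]]] := loc (r := `|x| + 1); first by rewrite ltr_wpDl.
have := convolution_ge nd ul (BB x _); rewrite ltrDl => /(_ ltr01).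
by case: (convolution u mu x) => // r _.
Qed.

Lemma convolution_lsc : lower_semicontinuous (convolution u mu).
Proof.
have [uN ul _ _] := hu.
move=> x r rx.
have [|D [C [B [nd BB]]]] := loc (r := `|x| + 1); first by rewrite ltr_wpDl.
have Bx : B x by apply: BB; rewrite ltrDl.
by exists [set y | (r%:E < convolution u mu y)%E] => //; exact: (convolution_lsc_at nd).
Qed.

(** If [w] were infinite on an open set, any constant would lie below it on a small box there; the
    mean-value inequality at the point [x1] gives this box a fixed positive weight, so [w x1] could
    not be finite. *)
Lemma convolution_dense : (exists x, convolution u mu x <> +oo%E) ->
  dense [set x | convolution u mu x \is a fin_num].
Proof.
move=> [x1 wx1] O [x0 Ox0] oO; have [uN ul _ _] := hu.
apply: contrapT => Ofin.
have Oinf x : O x -> convolution u mu x = +oo%E.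
  move=> Ox; have := convolution_ninfty x.
  case E : (convolution u mu x) => [v|//|//] _.
  by exfalso; apply: Ofin; exists x; split => //=; rewrite E.
have [s0 s0S] : exists s0, x1 + s0 *m S = x0.
  by exists ((x0 - x1) *m invmx S); rewrite -mulmxA mulVmx// mulmx1 addrC subrK.
have : \forall s \near s0, O (x1 + s *m S).
  have cv : x1 + s *m S @[s --> s0] --> x0 by rewrite -s0S; exact: continuous_affine.
  apply: cv.
  by apply: open_nbhs_nbhs; split.
move=> /near_le_ball[r r0 hr].
(* Large enough for the box of half-side [r] about [s0] to lie in [[-K, K]^n]. *)
pose K := 1 + `|s0| + r.
have K1 : 1 <= K by rewrite /K; have := normr_ge0 s0; lra.
pose al i := s0 ord0 i - r; pose be i := s0 ord0 i + r.
have box i : [/\ - K <= al i, al i <= be i & be i <= K].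
  have := coord_norm_le s0 i; rewrite ler_norml /al /be /K => /andP[? ?].
  by split; lra.
have [M M0 hM] := mulmx_bound S.
pose rad := `|x1| + M * (n.+3%:R * K) + 1.
have K0 : 0 <= n.+3%:R * K by rewrite mulr_ge0// (le_trans ler01 K1).
have [|D [C [B [nd BB]]]] := loc (r := rad).
  by rewrite /rad ltr_wpDl// addr_ge0// mulr_ge0.
have inB (s : 'rV[R]_n) : `|s| <= n.+3%:R * K -> B (x1 + s *m S).
  move=> sK; apply: BB; apply: le_lt_trans (ler_normD _ _) _.
  have := le_trans (hM s) (ler_wpM2l M0 sK); rewrite /rad; lra.
have [T TE] : exists T : R, (convolution u mu x1 + (fine (\int[mu]_(y in D) (C y)%:E))%:E = T%:E)%E.
  move: wx1 (convolution_ninfty x1); case: (convolution u mu x1) => [v|//|//] _ _.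
  by eexists; rewrite -EFinD.
pose P := \prod_(i < n) pcell Phi 1 (al i) (be i) 0.
have P0 : 0 < P by apply: prodr_gt0 => i _; apply: pcell_gt0; rewrite /al /be; lra.
have e0 : 0 < 1 - expR (- K ^+ 2).
  by rewrite subr_gt0 -expR0 ltr_expR oppr_lt0 exprn_gt0// (lt_le_trans ltr01 K1).
(* With this constant the inequality reads [T + 1 <= T]. *)
pose N := (T + 1) / ((1 - expR (- K ^+ 2)) * P).
have [||m0 hm] := @grid_inequality R c Phi gPhi n F u hu S S_unit S_le mu D C B nd
   al be K x1 (cst N) K1 box inB _ _.
- exact: cst_continuous.
- move=> s sb; rewrite Oinf ?ltry//.
  rewrite -(subrKC s0 s); apply: hr; apply: norm_le_coord => [|i]; first exact: ltW.
  have /andP[h1 h2] := sb i; rewrite !mxE ler_norml; move: h1 h2; rewrite /al /be => h1 h2; apply/andP; split; lra.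
have := hm m0.+1 (leqnSn _) (ltn0Sn _); rewrite TE lee_fin -mulr_sumr.
have al_be i : al i <= be i by have [] := box i.
rewrite grid_mass//.
rewrite (eq_bigr (fun i => pcell Phi 1 (al i) (be i) 0)) -/P; last by move=> i _; rewrite mxE.
rewrite /= mulrCA /N divfK ?gt_eqF ?mulr_gt0//; lra.
Qed.

End Density.

(** * Moments of the discretised Gaussian *)

Section GaussianMoments.
Variables (R : realType) (c : R) (Phi : R -> R) (gPhi : gauss_cdf c Phi).
Variables (n : nat) (K : R) (m : nat).
Hypotheses (K0 : 0 < K) (m0 : (0 < m)%N).

Let al : 'I_n -> R := fun=> - K.
Let be : 'I_n -> R := fun=> K.
Let st := 2 * K / m%:R.
Let al_be i : al i <= be i.
Proof. by rewrite /al /be; have := K0; lra. Qed.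

Definition node (k : nat) : R := - K + k%:R * st.
Definition midpoint (k : nat) : R := - K + (k%:R + 2^-1) * st.
Definition nodemass (k : nat) : R := Phi (node k.+1) - Phi (node k).
Definition totalmass : R := Phi K - Phi (- K).
Definition variance : R := \sum_(k < m) midpoint k ^+ 2 * nodemass k.

Let gstepE i : gstep al be m i = st.
Proof. by rewrite /gstep /al /be /st opprK; congr (_ / _); ring. Qed.

Let gcellE i k : gcell Phi al be m 1 0 i k = nodemass k.
Proof. by rewrite /gcell /pcell !subr0 !divr1 /gleft !gstepE. Qed.

Let gmidE i k : gmid al be m i k = midpoint k.
Proof. by rewrite /gmid gstepE. Qed.

Lemma nodemass_sum : \sum_(k < m) nodemass k = totalmass.
Proof.
rewrite -(big_mkord xpredT (fun k => Phi (node k.+1) - Phi (node k))) telescope_sumr//.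
rewrite /node mul0r addr0 (_ : - K + m%:R * st = K)// /st mulrC divfK ?pnatr_eq0 -?lt0n//.
by ring.
Qed.

(** The reflection [k -> m - 1 - k] changes the sign of the midpoint and, by the symmetry of [Phi],
    keeps the mass. *)
Lemma odd_moment : \sum_(k < m) midpoint k * nodemass k = 0.
Proof.
have m0R : m%:R != 0 :> R by rewrite pnatr_eq0 -lt0n.
set s := \sum_(k < m) _.
suff sE : s = - s by lra.
rewrite {1}/s (reindex_inj rev_ord_inj) -sumrN; apply: eq_bigr => k _ /=.
have kE : (m - k.+1)%:R = m%:R - k.+1%:R :> R by rewrite natrB.
have mK : m%:R * st = 2 * K by rewrite /st mulrC divfK.
have node1 : node (m - k.+1) = - node k.+1.
  by rewrite /node kE; have := mK; lra.
have node2 : node (m - k.+1).+1 = - node k.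
  by rewrite /node -natr1 kE -natr1; have := mK; lra.
have midE : midpoint (m - k.+1) = - midpoint k.
  by rewrite /midpoint kE -natr1; have := mK; lra.
by rewrite midE /nodemass node1 node2 !(gauss_sym gPhi); ring.
Qed.

Let prod_if (G : 'I_n -> R) i : \prod_l (if l == i then G l else 1) = G i.
Proof. by rewrite -big_mkcond big_pred1_eq. Qed.

Let wt (f : {ffun 'I_n -> 'I_m}) :=
  tensor (fun i => pcell Phi 1 (gleft al be m i (f i)) (gleft al be m i (f i).+1)) 0.

Let momentE (h : 'I_n -> nat -> R) :
  \sum_(f : {ffun 'I_n -> 'I_m}) (\prod_i h i (f i)) * wt f =
  \prod_i \sum_(k < m) h i k * nodemass k.
Proof.
rewrite grid_moment; apply: eq_bigr => i _; apply: eq_bigr => k _.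
by rewrite mxE gcellE.
Qed.

Let moment0 : \sum_(f : {ffun 'I_n -> 'I_m}) wt f = totalmass ^+ n.
Proof.
have := momentE (fun _ _ => 1).
rewrite (eq_bigr (fun f => wt f)); last by move=> f _; rewrite big1 ?mul1r.
move=> ->; rewrite (eq_bigr (fun=> totalmass)) ?prodr_const ?card_ord// => i _.
by rewrite -nodemass_sum; apply: eq_bigr => k _; rewrite mul1r.
Qed.

Let moment1 i : \sum_(f : {ffun 'I_n -> 'I_m}) midpoint (f i) * wt f = 0.
Proof.
have := momentE (fun l k => if l == i then midpoint k else 1).
rewrite (eq_bigr (fun f : {ffun 'I_n -> 'I_m} => midpoint (f i) * wt f)); last first.
  by move=> f _; rewrite (prod_if (fun l => midpoint (f l))).
by move=> ->; rewrite (bigD1 i)//= eqxx odd_moment mul0r.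
Qed.

Let moment2 i j : \sum_(f : {ffun 'I_n -> 'I_m}) midpoint (f i) * midpoint (f j) * wt f =
  if i == j then variance * totalmass ^+ n.-1 else 0.
Proof.
have := momentE (fun l k => (if l == i then midpoint k else 1) * (if l == j then midpoint k else 1)).
rewrite (eq_bigr (fun f : {ffun 'I_n -> 'I_m} => midpoint (f i) * midpoint (f j) * wt f)); last first.
  move=> f _; rewrite big_split/= (prod_if (fun l => midpoint (f l))).
  by rewrite (prod_if (fun l => midpoint (f l))).
move=> ->; rewrite (bigD1 i)//= eqxx; case: eqVneq => [<-|ij].
  have -> : \sum_(k < m) midpoint k * midpoint k * nodemass k = variance.
    by apply: eq_bigr => k _; rewrite expr2.
  congr (_ * _).
  rewrite (eq_bigr (fun=> totalmass)); last first.
    by move=> l /negbTE ->; rewrite -nodemass_sum; apply: eq_bigr => k _; rewrite !mul1r.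
  by rewrite prodr_const cardC1 card_ord.
rewrite (eq_bigr (fun k : 'I_m => midpoint k * nodemass k)) ?odd_moment ?mul0r//.
by move=> k _; rewrite mulr1.
Qed.

(** First and mixed moments contain a factor [odd_moment], so the linear part and the off-diagonal
    entries drop out. *)
Lemma quadratic_moment (e : R) (g : 'rV[R]_n) (Y : 'M[R]_n) :
  \sum_(f : {ffun 'I_n -> 'I_m}) (e + dot g (gmids al be f) +
      2^-1 * bil Y (gmids al be f) (gmids al be f)) * wt f =
  e * totalmass ^+ n + 2^-1 * (variance * totalmass ^+ n.-1) * \tr Y.
Proof.
have dotE (f : {ffun 'I_n -> 'I_m}) : dot g (gmids al be f) = \sum_i g ord0 i * midpoint (f i).
  by rewrite /dot mxE; apply: eq_bigr => i _; rewrite !mxE gmidE.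
have bilE (f : {ffun 'I_n -> 'I_m}) : bil Y (gmids al be f) (gmids al be f) =
    \sum_i \sum_j Y i j * (midpoint (f i) * midpoint (f j)).
  rewrite bil_dot /dot mxE exchange_big; apply: eq_bigr => j _.
  rewrite !mxE mulr_suml; apply: eq_bigr => i _; rewrite !mxE !gmidE; ring.
under eq_bigr => f _ do rewrite dotE bilE !mulrDl.
rewrite !big_split/= -mulr_sumr moment0; congr (_ + _).
  rewrite [X in _ + X](_ : _ = 0) ?addr0//.
  under eq_bigr => f _ do rewrite mulr_suml.
  rewrite exchange_big big1// => i _.
  under eq_bigr => f _ do rewrite -mulrA.
  by rewrite -mulr_sumr moment1 mulr0.
under eq_bigr => f _ do rewrite -mulrA mulr_suml.
rewrite -mulr_sumr -mulrA; congr (_ * _).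
rewrite exchange_big /mxtrace mulr_sumr; apply: eq_bigr => i _.
under eq_bigr => f _ do rewrite mulr_suml.
rewrite exchange_big (bigD1 i)//= [X in _ + X]big1 => [|j ji].
  rewrite addr0; under eq_bigr => f _ do rewrite -mulrA.
  by rewrite -mulr_sumr moment2 eqxx mulrC.
under eq_bigr => f _ do rewrite -mulrA.
by rewrite -mulr_sumr moment2 eq_sym (negbTE ji) mulr0.
Qed.

Lemma totalmassE : totalmass = 1 - 2 * (1 - Phi K).
Proof. by rewrite /totalmass (gauss_sym gPhi); ring. Qed.

(* The antiderivative of [x^2 c exp(-x^2/2)] is [Phi x - x c exp(-x^2/2)]. *)
Lemma variance_lower :
  totalmass - 2 * K * (c * gpdf K) <= 2 * variance + 2 * st ^+ 2 * totalmass.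
Proof.
have st0 : 0 <= st by rewrite divr_ge0// mulr_ge0// ltW.
pose T x := Phi x - c * (x * gpdf x).
have dT x : is_derive x (1 : R) T (c * (x ^+ 2 * gpdf x)).
  have h : is_derive x (1 : R) T _ :=
    is_deriveB (gauss_deriv gPhi x) (is_deriveZ c (is_derive_xgpdf x)).
  by apply: is_derive_eq; rewrite /GRing.scale/=; ring.
(* On the cell [|x - midpoint| <= st], hence [x^2 <= 2 midpoint^2 + 2 st^2]; this is the comparison
   of the derivatives. *)
have cell k : T (node k.+1) - T (node k) <=
    2 * (midpoint k ^+ 2 * nodemass k) + 2 * st ^+ 2 * nodemass k.
  pose q := 2 * midpoint k ^+ 2 + 2 * st ^+ 2.
  have -> : 2 * (midpoint k ^+ 2 * nodemass k) + 2 * st ^+ 2 * nodemass k =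
      q * Phi (node k.+1) - q * Phi (node k) by rewrite /q /nodemass; ring.
  have nk : node k <= node k.+1 by rewrite lerD2l ler_wpM2r// ler_nat.
  have dq x : is_derive x (1 : R) (fun x => q * Phi x) (q * (c * gpdf x)) :=
    is_deriveZ q (gauss_deriv gPhi x).
  apply: (is_derive_le_sub nk (fun x _ => dT x) (fun x _ => dq x)) => x xk.
  rewrite mulrCA ler_pM2r ?mulr_gt0 ?gpdf_gt0 ?(gauss_c_gt0 gPhi)//.
  have : `|x - midpoint k| <= st.
    move: xk; rewrite ler_norml /node /midpoint -natr1 !mulrDl => /andP[? ?].
    by apply/andP; split; lra.
  rewrite -(ler_sqr (x := `|_|)) ?nnegrE// real_normK ?num_real// => h.
  have := sqr_ge0 (x - 2 * midpoint k); rewrite /q.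
  move: h; rewrite !expr2; nra.
have TK : T K - T (- K) = totalmass - 2 * K * (c * gpdf K).
  by rewrite /T gpdfN /totalmass; ring.
rewrite -TK; have -> : T K - T (- K) = \sum_(k < m) (T (node k.+1) - T (node k)).
  rewrite -(big_mkord xpredT (fun k => T (node k.+1) - T (node k))) telescope_sumr//.
  rewrite /node mul0r addr0 (_ : - K + m%:R * st = K)// /st mulrC divfK ?pnatr_eq0 -?lt0n//.
  by ring.
rewrite -nodemass_sum /variance !mulr_sumr -big_split/=.
by apply: ler_sum => k _; exact: cell.
Qed.

End GaussianMoments.

(** * Gaussian tails against powers of [K] *)

Section GaussianDefect.
Variables (R : realType) (c : R) (Phi : R -> R) (gPhi : gauss_cdf c Phi) (n : nat).

(** The bound [gpdf_le] has the same order [K^-2] as the gain; squaring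
    [1 + K^2 / 4 <= exp (K^2 / 4)] gives a better one. *)
Lemma gpdf_le4 (K : R) : 0 < K -> gpdf K <= 16 / K ^+ 4.
Proof.
move=> K0; have K4 : 0 < K ^+ 4 by rewrite exprn_gt0.
rewrite /gpdf mulNr expRN -[leRHS]invf_div lef_pV2 ?posrE ?expR_gt0 ?divr_gt0//.
have -> : K ^+ 2 / 2 = K ^+ 2 / 4 + K ^+ 2 / 4 by lra.
have h := expR_ge1Dx (K ^+ 2 / 4).
have q0 : 0 <= K ^+ 2 / 4 by rewrite divr_ge0// sqr_ge0.
rewrite expRD; apply: (@le_trans _ _ ((1 + K ^+ 2 / 4) * (1 + K ^+ 2 / 4))).
  have -> : K ^+ 4 / 16 = (K ^+ 2 / 4) * (K ^+ 2 / 4) by field.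
  by apply: ler_pM => //; lra.
by apply: ler_pM => //; lra.
Qed.

(** From [gpdf K <= 16 K^-4]: the terms account in turn for [exp (- K^2)], for
    [2 K c gpdf K <= 32 c K^-3], and for [n] times the missing mass [2 c gpdf K]. *)
Definition defect_const : R := 16 * (1 + 2 * c + 2 * n%:R * c).

Lemma defect_const_ge16 : 16 <= defect_const.
Proof.
have c0 := gauss_c_gt0 gPhi; have nc : 0 <= n%:R * c by rewrite mulr_ge0// ltW.
by rewrite /defect_const; lra.
Qed.

Lemma gauss_defect (K : R) : 1 <= K ->
  [/\ 0 <= 1 - totalmass Phi K, 1 - totalmass Phi K <= defect_const / K,
    2 * K * (c * gpdf K) <= defect_const / K &
    expR (- K ^+ 2) + n%:R * (1 - totalmass Phi K) <= defect_const * K^-1 ^+ 3].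
Proof.
move=> K1; have K0 : 0 < K by exact: lt_le_trans ltr01 K1.
have c0 := gauss_c_gt0 gPhi.
pose k := K^-1; have k0 : 0 <= k by rewrite invr_ge0 ltW.
have k1 : k <= 1 by rewrite invf_le1.
have Kk : K * k = 1 by rewrite mulfV ?gt_eqF.
have k43 : k ^+ 4 <= k ^+ 3 by rewrite exprS ler_piMl// exprn_ge0.
have k31 : k ^+ 3 <= k by rewrite exprS ler_piMr// exprn_ile1.
have g4 : gpdf K <= 16 * k ^+ 4 by rewrite /k exprVn; exact: gpdf_le4.
have cg : c * gpdf K <= c * (16 * k ^+ 4) by rewrite ler_pM2l.
have nc : 0 <= n%:R * c by rewrite mulr_ge0// ltW.
have e : totalmass Phi K = 1 - 2 * (1 - Phi K) by exact: totalmassE gPhi K.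
have tail := gauss_tail gPhi K1.
have ck43 : c * k ^+ 4 <= c * k ^+ 3 by rewrite ler_pM2l.
have ck31 : c * k ^+ 3 <= c * k by rewrite ler_pM2l.
have nck : 0 <= n%:R * c * k by rewrite mulr_ge0.
have le1 := gauss_le1 gPhi K.
rewrite /defect_const -/k e; clear gPhi.
split; [lra|lra| |].
  apply: (@le_trans _ _ (32 * (c * k ^+ 3))); last lra.
  have <- : 2 * K * (c * (16 * k ^+ 4)) = 32 * (c * k ^+ 3).
    have -> : 2 * K * (c * (16 * k ^+ 4)) = 32 * (c * k ^+ 3) * (K * k) by ring.
    by rewrite Kk mulr1.
  by rewrite ler_wpM2l// mulr_ge0// ltW.
have epsg : expR (- K ^+ 2) <= gpdf K.
  by rewrite /gpdf ler_expR mulNr lerN2; have := sqr_ge0 K; lra.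
have ck3 : 0 <= c * k ^+ 3 by rewrite mulr_ge0 ?exprn_ge0// ltW.
apply: (@le_trans _ _ (16 * k ^+ 3 + n%:R * (32 * (c * k ^+ 3)))); last lra.
by apply: lerD; [lra|rewrite ler_wpM2l//; lra].
Qed.

End GaussianDefect.

(** Once [q <= 1/2], the inequality gives [h K^-2 / 16 <= q a <= A a K^-3], that is [h K <= 16 A a],
    which fails for large [K]. *)
Lemma no_small_defect (R : realType) (a h A : R) : 0 <= a -> 0 < h -> 16 <= A ->
  (forall K, 1 <= K -> 8 * A <= K ->
    exists2 q, q <= A * K^-1 ^+ 3 & (1 - q) * (a + 8^-1 * (h * K^-1 ^+ 2)) <= a) -> False.
Proof.
move=> a0 h0 A16 H.
have A0 : 0 <= A by lra.
have Aa : 0 <= A * a / h by rewrite divr_ge0 ?mulr_ge0// ltW.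
pose K := 1 + 8 * A + 16 * (A * a / h).
have K1 : 1 <= K by rewrite /K; lra.
have K8 : 8 * A <= K by rewrite /K; lra.
have Kh : h * K = h + 8 * (A * h) + 16 * (A * a).
  by rewrite /K; field; rewrite gt_eqF.
have [q qA main] := H K K1 K8; clearbody K; clear H.
have K0 : 0 < K by lra.
pose k := K^-1; have k0 : 0 < k by rewrite invr_gt0.
have Kk : K * k = 1 by rewrite mulfV ?gt_eqF.
have k1 : k <= 1 by rewrite invf_le1.
have q2 : q <= 2^-1.
  apply: le_trans qA _; rewrite -/k; apply: (@le_trans _ _ (A * k)).
    by rewrite ler_wpM2l// exprS ler_piMr ?(ltW k0)// exprn_ile1// ltW.
  by rewrite /k ler_pdivrMr// mulrC; lra.
rewrite -/k in qA main.
have hk : 0 <= h * k ^+ 2 by rewrite mulr_ge0 ?sqr_ge0// ltW.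
have qh : 0 <= (2^-1 - q) * (h * k ^+ 2) by rewrite mulr_ge0// subr_ge0.
have qa : q * a <= A * k ^+ 3 * a by rewrite ler_wpM2r.
have : 16^-1 * (h * k ^+ 2) <= A * k ^+ 3 * a by lra.
have Ah : 0 <= A * h by rewrite mulr_ge0// ltW.
have k3 : 0 < k ^+ 3 by rewrite exprn_gt0.
have <- : 16^-1 * (h * K) * k ^+ 3 = 16^-1 * (h * k ^+ 2).
  have -> : 16^-1 * (h * K) * k ^+ 3 = 16^-1 * (h * k ^+ 2) * (K * k) by ring.
  by rewrite Kk mulr1.
have -> : A * k ^+ 3 * a = A * a * k ^+ 3 by ring.
by rewrite ler_pM2r// Kh; lra.
Qed.

(** * Quadratic polynomials touching the convolution from below *)

Section TouchingQuadratic.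
Variables (R : realType) (c : R) (Phi : R -> R) (gPhi : gauss_cdf c Phi).
Variables (n : nat) (F : 'M[R]_n -> R) (u : 'rV[R]_n -> \bar R).
Hypothesis hu : viscosity_supersolution F u.
Variable mu : {measure set (borelRn R n) -> \bar R}.
Hypothesis loc : locally_dominated u mu.
Variable S : 'M[R]_n.
Hypothesis S_unit : S \in unitmx.
Hypothesis S_le : forall X, X^T = X -> \tr (S *m X *m S^T) <= F X.

(** Replacing [S] by [h S] multiplies the trace by [h^2], so the comparison at scale [h] belongs to
    the operator [h^2 F]. *)
Lemma viscosity_scale (t : R) : 0 < t -> viscosity_supersolution (fun X => t * F X) u.
Proof.
move=> t0; have [h1 h2 h3 h4] := hu; split => // x0 phi U oU C2 E le.
by rewrite pmulr_rle0//; exact: h4 oU C2 E le.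
Qed.

Lemma bernoulli_ineq (t : R) k : 0 <= t <= 1 -> 1 - k%:R * t <= (1 - t) ^+ k.
Proof.
move=> /andP[t0 t1]; elim: k => [|k IH]; first by rewrite mul0r subr0 expr0.
rewrite exprS; apply: (@le_trans _ _ ((1 - t) * (1 - k%:R * t))).
  by rewrite -natr1; have := mulr_ge0 (ler0n R k) (mulr_ge0 t0 t0); lra.
by rewrite ler_wpM2l//; lra.
Qed.

Variables (x0 b : 'rV[R]_n) (X : 'M[R]_n) (w0 r0 : R).
Hypothesis r00 : 0 < r0.
Hypothesis wx0 : convolution u mu x0 = w0%:E.
Hypothesis touch : forall z, `|z| <= r0 ->
  ((w0 + dot b z + 2^-1 * bil X z z)%:E <= convolution u mu (x0 + z)%R)%E.

(* The kernel inequality at scale [h = h0 / K] compares a gain of order [K ^ -2]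
   with a loss of order at most [K ^ -3]. *)
Lemma quadratic_gain : exists a h0 : R, [/\ 0 <= a, 0 < h0 &
  forall K, 1 <= K -> 3 / 4 <= totalmass Phi K -> 2 * K * (c * gpdf K) <= 8^-1 ->
   0 <= \tr (S *m X *m S^T) ->
  (1 - expR (- K ^+ 2)) * (a * totalmass Phi K ^+ n +
     8^-1 * totalmass Phi K ^+ n.-1 * ((h0 / K) ^+ 2 * \tr (S *m X *m S^T))) <= a].
Proof.
have [uN ul _ _] := hu.
have [|D [C [B [nd BB]]]] := loc (r := `|x0| + r0 + 1).
  by rewrite ltr_wpDl// addr_ge0// ltW.
set mass := fine (\int[mu]_(y in D) (C y)%:E).
have aE : 0 <= w0 + mass.
  have Bx0 : B x0 by apply: BB; have := r00; lra.
  by have := convolution_ge nd ul Bx0; rewrite wx0 -EFinD lee_fin.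
have [M M0 hM] := mulmx_bound S.
(* With [h = h0 / K], the map [h S] sends the cube of half-side [(n+3) K] into the ball of radius
   [r0] where [w] is touched. *)
pose h0 := r0 / ((M + 1) * n.+3%:R).
have M1 : 0 < (M + 1) * n.+3%:R by rewrite mulr_gt0// ltr_wpDl.
have h00 : 0 < h0 by rewrite divr_gt0.
exists (w0 + mass), h0; split => // K K1 th Kg tau0.
have K0 : 0 < K by exact: lt_le_trans ltr01 K1.
set theta := totalmass Phi K in th *.
set eps := expR (- K ^+ 2).
set a := w0 + mass in aE *.
have theta1 : theta <= 1.
  by rewrite /theta (totalmassE gPhi); have := gauss_le1 gPhi K; lra.
have theta0 : 0 <= theta by lra.
have eps1 : 0 <= 1 - eps by rewrite subr_ge0 -expR0 ler_expR oppr_le0 sqr_ge0.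
have eps0 : 0 <= eps by exact: expR_ge0.
pose h := h0 / K.
have hgt0 : 0 < h by rewrite divr_gt0.
pose T := h *: S.
have T_unit : T \in unitmx by rewrite unitmxZ ?unitfE ?gt_eqF.
have T_le Z : Z^T = Z -> \tr (T *m Z *m T^T) <= h ^+ 2 * F Z.
  move=> ZT; rewrite /T linearZ/= -scalemxAr -!scalemxAl scalerA mxtraceZ -expr2.
  by rewrite ler_pM2l ?exprn_gt0//; exact: S_le.
have hT (s : 'rV[R]_n) : `|s| <= n.+3%:R * K -> `|s *m T| <= r0.
  move=> sK; rewrite /T -scalemxAr normrZ (gtr0_norm hgt0).
  apply: (@le_trans _ _ (h * (M * (n.+3%:R * K)))).
    by rewrite ler_pM2l// (le_trans (hM s))// ler_wpM2l.
  have -> : h * (M * (n.+3%:R * K)) = r0 * (M / (M + 1)).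
    by rewrite /h /h0; field; rewrite !gt_eqF//= ltr_wpDl.
  by apply: ler_piMr; [exact: ltW|rewrite ler_pdivrMr ?ltr_wpDl// mul1r lerDl].
have inB (s : 'rV[R]_n) : `|s| <= n.+3%:R * K -> B (x0 + s *m T).
  by move=> sK; apply: BB; rewrite (le_lt_trans (ler_normD _ _))//; have := hT s sK; lra.
(* [grid_inequality] asks for strict inequality, so the quadratic is lowered by an arbitrary
   [e > 0]. *)
apply/ler_addgt0Pl => e e0.
pose al : 'I_n -> R := fun=> - K; pose be : 'I_n -> R := fun=> K.
have box i : [/\ - K <= al i, al i <= be i & be i <= K] by rewrite /al /be; split; lra.
have halfX z : bil (2^-1 *: X) z z = 2^-1 * bil X z z.
  by rewrite !bil_dot -scalemxAr dotZl.
pose psi := quadratic (a - e) b (2^-1 *: X) x0.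
have psiE s : psi (x0 + s *m T) = a - e + dot (b *m T^T) s + 2^-1 * bil (T *m X *m T^T) s s.
  rewrite /psi /quadratic [x0 + _]addrC addrK.
  have -> : dot b (s *m T) = dot (b *m T^T) s by rewrite /dot trmx_mul mulmxA.
  by rewrite halfX /bil trmx_mul !mulmxA.
have [||m0 hm] := @grid_inequality R c Phi gPhi n (fun X => h ^+ 2 * F X) u
   (viscosity_scale (exprn_gt0 2 hgt0)) T T_unit T_le mu D C B nd
   al be K x0 psi K1 box inB _ _.
- exact: continuous_quadratic.
- move=> s sb; have sK : `|s| <= n.+3%:R * K.
    apply: le_trans (_ : K <= _); last by rewrite ler_peMl ?(ltW K0)// ler1n.
    apply: norm_le_coord => [|i]; first exact: ltW.
    by rewrite ler_norml; exact: sb.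
  have := touch (hT s sK); case: (convolution _ _ _) => [v|_|//]; last exact: ltry.
  rewrite lee_fin -EFinD lte_fin /psi /quadratic [x0 + _]addrC addrK.
  by rewrite halfX -/mass /a; lra.
(* The grid step is then at most 1/4, the discretisation costs at most [theta / 8] in
   [variance_lower], and the variance is at least 1/4; half of it is the 1/8 of the statement. *)
pose m := maxn m0 (Num.truncn (8 * K)).+1.
have mpos : (0 < m)%N by rewrite leq_max orbT.
have := hm m (leq_maxl _ _) mpos; rewrite wx0 -EFinD lee_fin -/mass -/a.
under eq_bigr => f _ do rewrite psiE.
rewrite (quadratic_moment gPhi K mpos) -/theta -/eps.
have -> : \tr (T *m X *m T^T) = h ^+ 2 * \tr (S *m X *m S^T).
  by rewrite /T linearZ/= -scalemxAr -!scalemxAl scalerA mxtraceZ -expr2.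
set tau := \tr (S *m X *m S^T) in tau0 *.
have V := variance_lower gPhi K0 mpos.
rewrite -/theta in V.
set st := 2 * K / m%:R in V.
have st4 : st <= 4^-1.
  have h8 : 8 * K <= m%:R.
    apply: (@le_trans _ _ (Num.truncn (8 * K)).+1%:R); last by rewrite ler_nat leq_max leqnn orbT.
    by apply: ltW; exact: truncnS_gt.
  by rewrite /st ler_pdivrMr ?ltr0n//; lra.
have st0 : 0 <= st by rewrite /st divr_ge0// mulr_ge0// ltW.
have st2 : st ^+ 2 <= 16^-1.
  have -> : 16^-1 = 4^-1 ^+ 2 :> R by field.
  by rewrite ler_sqr ?nnegrE.
have Vlow : 4^-1 <= variance Phi K m.
  have : 2 * st ^+ 2 * theta <= 8^-1 * theta by rewrite ler_wpM2r//; lra.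
  lra.
move=> main; have hh : 0 <= h ^+ 2 * tau by rewrite mulr_ge0// sqr_ge0.
have tn0 : 0 <= theta ^+ n.-1 by exact: exprn_ge0.
have tn : theta ^+ n <= 1 by exact: exprn_ile1.
have tn' : 0 <= theta ^+ n by exact: exprn_ge0.
rewrite -/h -lerBlDl; apply: le_trans main.
have -> : (1 - eps) * ((a - e) * theta ^+ n + 2^-1 * (variance Phi K m * theta ^+ n.-1) * (h ^+ 2 * tau))
   = (1 - eps) * (a * theta ^+ n + variance Phi K m / 2 * (theta ^+ n.-1 * (h ^+ 2 * tau)))
     - e * ((1 - eps) * theta ^+ n) by ring.
apply: lerB.
  rewrite ler_wpM2l// lerD2l -mulrA ler_wpM2r ?(mulr_ge0 tn0 hh)//; lra.
by rewrite ler_piMr ?(ltW e0)// mulr_ile1//; lra.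
Qed.

(** With [t = 1 - totalmass], Bernoulli bounds both powers of the mass below by [1 - n t], so the
    lost factor is at least [1 - q] with [q = exp (- K^2) + n t] of order [K^-3], as
    [no_small_defect] requires. *)
Lemma quadratic_touch : \tr (S *m X *m S^T) <= 0.
Proof.
rewrite leNgt; apply/negP => tau0; set tau := \tr _ in tau0.
have [a [h0 [a0 h00 gain]]] := quadratic_gain.
have ht : 0 < h0 ^+ 2 * tau by rewrite mulr_gt0// exprn_gt0.
apply: (no_small_defect a0 ht (defect_const_ge16 gPhi n)) => K K1 K8.
have [t0 t1 cg qA] := gauss_defect gPhi n K1.
have K0 : 0 < K by exact: lt_le_trans ltr01 K1.
have AK : defect_const c n / K <= 8^-1 by rewrite ler_pdivrMr// mulrC; lra.
have th : 3 / 4 <= totalmass Phi K by lra.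
have := gain K K1 th (le_trans cg AK) (ltW tau0).
set eps := expR (- K ^+ 2) in qA *; set t := 1 - totalmass Phi K in t0 t1 qA.
have -> : totalmass Phi K = 1 - t by rewrite /t; ring.
move=> main; exists (eps + n%:R * t) => //; apply: le_trans main.
have t01 : 0 <= t <= 1 by rewrite t0; lra.
have b1 := bernoulli_ineq n t01.
have b2 : 1 - n%:R * t <= (1 - t) ^+ n.-1.
  apply: le_trans (bernoulli_ineq n.-1 t01).
  by rewrite lerD2l lerN2 ler_wpM2r// ler_nat leq_pred.
have eps0 : 0 <= eps by exact: expR_ge0.
have eps1 : 0 <= 1 - eps by rewrite subr_ge0 -expR0 ler_expR oppr_le0 sqr_ge0.
have ent : 0 <= eps * (n%:R * t) by rewrite !mulr_ge0.
have gn : 0 <= 8^-1 * (h0 ^+ 2 * tau * K^-1 ^+ 2).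
  by apply: mulr_ge0 => //; apply: mulr_ge0; [exact: ltW|exact: sqr_ge0].
apply: (@le_trans _ _ ((1 - eps) * (1 - n%:R * t) * (a + 8^-1 * (h0 ^+ 2 * tau * K^-1 ^+ 2)))).
  by apply: ler_wpM2r; [exact: addr_ge0|lra].
rewrite -mulrA ler_wpM2l// mulrDr; apply: lerD; first by rewrite mulrC ler_wpM2l.
have -> : (h0 / K) ^+ 2 * tau = h0 ^+ 2 * tau * K^-1 ^+ 2 by rewrite expr_div_n exprVn; ring.
by rewrite (mulrC 8^-1 (_ ^+ _)) -(mulrA _ 8^-1); apply: ler_wpM2r.
Qed.

End TouchingQuadratic.

(** * Hahn-Banach by successive reductions of a sublinear function *)

Section HahnBanach.
Variables (R : realType) (V : lmodType R).
Implicit Types (p q : V -> R) (x y z : V).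

Definition sublin p := (forall x y, p (x + y) <= p x + p y) /\
  (forall (t : R) x, 0 <= t -> p (t *: x) = t * p x).

Lemma sublin0 p : sublin p -> p 0 = 0.
Proof. by move=> [_ h]; rewrite -(scale0r 0) h// mul0r. Qed.

Lemma sublin_opp p x : sublin p -> - p (- x) <= p x.
Proof.
by move=> hp; have := hp.1 x (- x); rewrite subrr (sublin0 hp); lra.
Qed.

(** The infimum of [p (y + t x) - t p x] over [t >= 0] is sublinear and below [p]; taking [t = 1] at
    [- x] gives [q (- x) <= - p x], which makes it odd at [x]. *)
Lemma sublin_extend p x : sublin p ->
  exists q, [/\ sublin q, forall y, q y <= p y, q x = p x & q (- x) = - q x].
Proof.
move=> hp; have [pD pZ] := hp.
pose A y := [set p (y + t *: x) - t * p x | t in [set t : R | 0 <= t]].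
have lbA y : lbound (A y) (- p (- y)).
  move=> _ [t /= t0 <-]; have := pD (y + t *: x) (- y).
  by rewrite addrAC subrr add0r pZ//; lra.
have hA y : has_inf (A y).
  split; last by exists (- p (- y)).
  by exists (p (y + 0 *: x) - 0 * p x), 0 => /=.
pose q y := inf (A y).
have qle y t : 0 <= t -> q y <= p (y + t *: x) - t * p x.
  by move=> t0; apply: (ge_inf (hA y).2); exists t.
have qge y r : (forall t, 0 <= t -> r <= p (y + t *: x) - t * p x) -> r <= q y.
  by move=> h; apply: (lb_le_inf (hA y).1) => _ [t /= t0 <-]; exact: h.
have qp y : q y <= p y by have := qle y 0 (lexx _); rewrite scale0r addr0 mul0r subr0.
have qD y z : q (y + z) <= q y + q z.
  rewrite -lerBlDr; apply: (qge _ _ _) => t t0; rewrite lerBlDr -lerBlDl.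
  apply: qge => s s0; rewrite lerBlDl.
  apply: le_trans (qle (y + z) (t + s) (addr_ge0 t0 s0)) _.
  have := pD (y + t *: x) (z + s *: x); rewrite addrACA -scalerDl; lra.
have q0 : q 0 = 0.
  apply/eqP; rewrite eq_le; apply/andP; split; first by rewrite -(sublin0 hp).
  by apply: qge => t t0; rewrite add0r pZ// subrr.
have qZ t y : 0 <= t -> q (t *: y) = t * q y.
  rewrite le_eqVlt => /predU1P[<-|t0]; first by rewrite scale0r mul0r q0.
  (* The reverse inequality is this one for the inverse scalar. *)
  have half s z : 0 < s -> s * q z <= q (s *: z).
    move=> s0; apply: qge => r r0; rewrite -ler_pdivlMl//.
    apply: le_trans (qle z (s^-1 * r) _) _; first by rewrite mulr_ge0// invr_ge0 ltW.
    have -> : p (s *: z + r *: x) = s * p (z + (s^-1 * r) *: x).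
      by rewrite -pZ ?ltW// scalerDr scalerA mulrA divff ?gt_eqF// mul1r.
    by rewrite mulrBr !mulrA mulVf ?gt_eqF// mul1r.
  apply/eqP; rewrite eq_le half// andbT.
  have ti : 0 < t^-1 by rewrite invr_gt0.
  have := half t^-1 (t *: y) ti; rewrite scalerA mulVf ?gt_eqF// scale1r.
  by rewrite ler_pdivrMl.
have h1 := qle (- x) 1 ler01; rewrite scale1r addNr (sublin0 hp) mul1r sub0r in h1.
have h2 := qD x (- x); rewrite subrr q0 in h2.
by exists q; split => //; have h3 := qp x; apply/eqP; rewrite eq_le; apply/andP; split; lra.
Qed.

(** Oddness at [z] survives a further decrease, since [- r (- z) <= r z <= q z = - q (- z) <= - r (-
    z)]; so the vectors can be treated one by one. *)
Lemma sublin_extend_seq p (s : seq V) : sublin p ->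
  exists q, [/\ sublin q, forall y, q y <= p y &
    forall z, z \in s -> q (- z) = - q z].
Proof.
move=> hp; elim: s => [|x s [q [hq qp qs]]]; first by exists p; split.
have [r [hr rq _ rx]] := sublin_extend x hq.
exists r; split => // [y|z]; first exact: le_trans (rq y) (qp y).
rewrite inE => /predU1P[->//|zs].
have := rq z; have := rq (- z); rewrite (qs z zs).
by have := sublin_opp z hr; lra.
Qed.

End HahnBanach.

(** * Cholesky factorization *)

Section Cholesky.
Variable R : realType.

Definition posdef (n : nat) (A : 'M[R]_n) := forall x : 'rV[R]_n, x != 0 -> 0 < bil A x x.

(** Induction on the size through the Schur complement [Sc] of the upper left entry. *)
Lemma cholesky (n : nat) (A : 'M[R]_n) : A^T = A -> posdef A ->
  exists2 S : 'M[R]_n, S \in unitmx & A = S^T *m S.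
Proof.
elim: n A => [|n IH] A AT Apos.
  by exists 1%:M; [rewrite unitmx1|apply/matrixP => -[]].
move: A AT Apos; rewrite -[n.+1]/(1 + n)%N => A AT Apos.
set a := ulsubmx A; set v := ursubmx A; set A' := drsubmx A.
have AE : A = block_mx a v v^T A' by rewrite /a /v /A' trmx_ursub AT submxK.
have A'T : A'^T = A' by rewrite /A' trmx_drsub AT.
pose al := a ord0 ord0.
have aE : a = al%:M by rewrite [LHS]mx11_scalar.
have bilE (t : R) (x : 'rV[R]_n) :
    bil A (row_mx t%:M x) (row_mx t%:M x) = t ^+ 2 * al + 2 * t * dot v x + bil A' x x.
  rewrite /bil AE mul_row_block tr_row_mx mul_row_col tr_scalar_mx mul_mx_scalar.
  rewrite !mul_scalar_mx mulmxDl -scalemxAl mxE mxE mxE mxE [X in _ + X]mxE [X in _ + (X + _)]mxE.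
  rewrite -/(dot x v) -/(dot v x) -/al dotC; ring.
have al0 : 0 < al.
  have := Apos (row_mx 1%:M 0) _; rewrite bilE dot0r bil0r expr1n mul1r mulr0 !addr0.
  apply; apply/eqP => /(congr1 lsubmx); rewrite row_mxKl => /matrixP/(_ ord0 ord0)/eqP.
  by rewrite !mxE eqxx oner_eq0.
have nal : al != 0 by rewrite gt_eqF.
pose Sc := A' - al^-1 *: (v^T *m v).
have ScT : Sc^T = Sc.
  by rewrite /Sc linearB/= linearZ/= trmx_mul trmxK A'T.
have [|S' S'unit S'E] := IH Sc ScT.
  (* This first coordinate minimises the form for given [x], and the minimum is [bil Sc x x]. *)
  move=> x x0; have := Apos (row_mx (- (dot v x / al))%:M x).
  have -> : row_mx (- (dot v x / al))%:M x != 0.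
    apply: contraNneq x0 => /(congr1 rsubmx); rewrite row_mxKr => ->.
    by apply/eqP/rowP => i; rewrite !mxE.
  move=> /(_ isT); rewrite bilE; congr (0 < _).
  have vv : bil (v^T *m v) x x = dot v x ^+ 2.
    by rewrite /bil mulmxA -mulmxA mxE big_ord1 -/(dot x v) -/(dot v x) dotC expr2.
  have -> : bil Sc x x = bil A' x x - al^-1 * bil (v^T *m v) x x.
    by rewrite /Sc !bil_dot mulmxBr -scalemxAr -[- (_ *: _)]scaleN1r dotDl !dotZl mulN1r.
  by rewrite vv; field.
pose r := Num.sqrt al.
have r0 : 0 < r by rewrite sqrtr_gt0.
have rr : r * r = al by rewrite -expr2 sqr_sqrtr// ltW.
exists (block_mx r%:M (r^-1 *: v) 0 S').
  by rewrite unitmxE det_ublock det_scalar1 unitrM unitfE gt_eqF.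
rewrite tr_block_mx mulmx_block !tr_scalar_mx !trmx0 !mul0mx !mulmx0 !addr0.
rewrite [LHS]AE -scalar_mxM rr -aE mul_scalar_mx scalerA divff ?gt_eqF// scale1r.
rewrite linearZ/= mul_mx_scalar scalerA divff ?gt_eqF// scale1r.
congr block_mx; rewrite -S'E /Sc -scalemxAl -scalemxAr scalerA -invfM rr.
by rewrite addrC subrK.
Qed.

End Cholesky.

(** * Linear operators supporting [F] *)

Section EllipticSupport.
Variables (R : realType) (n : nat) (F : 'M[R]_n -> R).
Hypotheses (hFsub : sublinear F) (hFell : uniformly_elliptic F).

Let sym (X : 'M[R]_n) := 2^-1 *: (X + X^T).

Let sym_sym X : sym X \is symmetricmx.
Proof. by rewrite symmetricmxE /sym linearZ/= linearD/= trmxK addrC. Qed.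

Let symK X : X^T = X -> sym X = X.
Proof. by move=> XT; rewrite /sym XT -mulr2n -[X *+ 2]scaler_nat scalerA mulVf ?scale1r ?pnatr_eq0. Qed.

(* A supporting functional of [F] at [X0] is [X |-> tr (A X)] with [A] symmetric;
   ellipticity makes [A] positive definite, and [A = S^T S]. *)
Lemma elliptic_support (X0 : 'M[R]_n) : X0^T = X0 ->
  exists S : 'M[R]_n, [/\ S \in unitmx,
    forall X, X^T = X -> \tr (S *m X *m S^T) <= F X &
    \tr (S *m X0 *m S^T) = F X0].
Proof.
move=> X0T; have [FD FZ] := hFsub.
(* [F] is constrained only on symmetric matrices; composed with [sym] it is sublinear on all
   matrices, where the [delta_mx] form a basis. *)
pose G X := F (sym X).
have symD X Y : sym (X + Y) = sym X + sym Y.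
  by rewrite /sym [(X + Y)^T]linearD/= addrACA scalerDr.
have symZ t X : sym (t *: X) = t *: sym X.
  by rewrite /sym linearZ/= -scalerDr !scalerA mulrC.
have hG : sublin G.
  split=> [X Y|t X t0]; first by rewrite /G symD FD.
  by rewrite /G symZ FZ.
have [q0 [hq0 q0G q0X q0N]] := sublin_extend X0 hG.
have [q [hq qq0 qs]] := sublin_extend_seq [seq delta_mx ij.1 ij.2 | ij : 'I_n * 'I_n] hq0.
have [qD qZ] := hq.
have qG X : q X <= G X := le_trans (qq0 X) (q0G X).
pose a : 'M[R]_n := \matrix_(i, j) q (delta_mx i j).
pose L (X : 'M[R]_n) := \sum_i \sum_j X i j * a i j.
have qdelta (t : R) i j : q (t *: delta_mx i j) = t * a i j.
  rewrite mxE; have [t0|/ltW t0] := leP 0 t; first exact: qZ.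
  have -> : t *: delta_mx i j = (- t) *: - (delta_mx i j : 'M[R]_n) by rewrite scalerN scaleNr opprK.
  rewrite qZ ?oppr_ge0// qs ?mulrNN//.
  by apply/mapP; exists (i, j) => //; rewrite mem_enum.
have qsum (I : Type) (r : seq I) (f : I -> 'M[R]_n) : q (\sum_(i <- r) f i) <= \sum_(i <- r) q (f i).
  elim: r => [|i r IH]; first by rewrite !big_nil (sublin0 hq).
  by rewrite !big_cons (le_trans (qD _ _))// lerD2l.
have qL X : q X <= L X.
  rewrite {1}[X]matrix_sum_delta (le_trans (qsum _ _ _))//; apply: ler_sum => i _.
  rewrite (le_trans (qsum _ _ _))//; apply: ler_sum => j _.
  by rewrite qdelta.
have LN X : L (- X) = - L X.
  rewrite /L -sumrN; apply: eq_bigr => i _; rewrite -sumrN; apply: eq_bigr => j _.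
  by rewrite mxE mulNr.
have qE X : q X = L X.
  apply/eqP; rewrite eq_le qL /=.
  by have := sublin_opp X hq; have := qL (- X); rewrite LN; lra.
have LF X : X^T = X -> L X <= F X.
  by move=> XT; have := qG X; rewrite qE /G symK.
(* [q0] is odd at [X0] with value [F X0], so [L (- X0) <= - F X0]. *)
have LX0 : L X0 = F X0.
  apply/eqP; rewrite eq_le LF//=.
  have := qq0 (- X0); rewrite q0N q0X (qE (- X0)) (LN X0) /G symK//; lra.
pose A := sym a.
have AT : A^T = A by apply/eqP; rewrite -symmetricmxE; exact: sym_sym.
have trL X : \tr (a^T *m X) = L X.
  rewrite /mxtrace /L exchange_big; apply: eq_bigr => i _; rewrite mxE.
  by apply: eq_bigr => j _; rewrite [a^T _ _]mxE mulrC.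
have trA X : X^T = X -> \tr (A *m X) = L X.
  move=> XT; have aX : \tr (a *m X) = L X.
    by rewrite -mxtrace_tr trmx_mul XT mxtrace_mulC trL.
  by rewrite /A /sym -scalemxAl mxtraceZ mulmxDl mxtraceD aX trL; lra.
have [lam [Lam [lam0 _ ell]]] := hFell.
have F0 : F 0 = 0 by rewrite -(scale0r (0 : 'M[R]_n)) FZ ?mul0r// symmetricmxE trmx0.
(* Ellipticity between [- x^T x] and 0 gives [F (- x^T x) <= - lam tr (x^T x)], and [L <= F] turns
   this into a positive lower bound for [bil A x x]. *)
have Apos : posdef A.
  move=> x x0; pose X := x^T *m x.
  have XT : X^T = X by rewrite /X trmx_mul trmxK.
  have NXT : (- X)^T = - X by rewrite linearN/= XT.
  have dotX (y : 'rV[R]_n) : (y *m X *m y^T) ord0 ord0 = dot y x ^+ 2.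
    by rewrite /X mulmxA -mulmxA mxE big_ord1 -/(dot y x) -/(dot x y) [dot x y]dotC expr2.
  have bilA : bil A x x = L X.
    rewrite -trA// /X mulmxA mxtrace_mulC mulmxA /mxtrace big_ord1.
    by [].
  have trX : 0 < \tr X.
    have -> : \tr X = \sum_i x ord0 i ^+ 2.
      by apply: eq_bigr => i _; rewrite mxE big_ord1 mxE expr2.
    rewrite lt_neqAle sumr_ge0 ?andbT => [|i _]; last exact: sqr_ge0.
    apply: contraNneq x0 => /esym/eqP; rewrite psumr_eq0 => [|i _]; last exact: sqr_ge0.
    move=> /allP h; apply/eqP/rowP => i; rewrite mxE; apply/eqP.
    by have := h i; rewrite mem_index_enum => /(_ isT); rewrite /= sqrf_eq0.
  have [|||+ _] := andP (ell (- X) X _ _ _).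
  - by rewrite symmetricmxE NXT.
  - by rewrite symmetricmxE XT.
  - by move=> y; rewrite mulmx0 mul0mx mxE dotX sqr_ge0.
  rewrite addNr F0 => h.
  have := LF _ NXT; rewrite LN bilA.
  have := mulr_gt0 lam0 trX; lra.
have [S Sunit SE] := cholesky AT Apos.
have trS X : \tr (S *m X *m S^T) = \tr (A *m X).
  by rewrite mxtrace_mulC mulmxA -SE.
exists S; split => //.
- by move=> X XT; rewrite trS trA// LF.
- by rewrite trS trA.
Qed.

End EllipticSupport.

(** * The viscosity property of locally dominated convolutions *)

Section ConvolutionSupersolution.
Variables (R : realType) (n : nat).
Implicit Types (F : 'M[R]_n -> R) (u : 'rV[R]_n -> \bar R) (x y z : 'rV[R]_n).
Implicit Types (mu : {measure set (borelRn R n) -> \bar R}).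

(** The Taylor error is absorbed by lowering the Hessian by [2 e] times the identity. This changes
    the trace by [2 e tr (S S^T)], and [S] is fixed before [e] tends to 0. *)
Lemma convolution_supersolution F u mu :
  sublinear F -> uniformly_elliptic F -> viscosity_supersolution F u ->
  locally_dominated u mu -> (exists x, convolution u mu x <> +oo%E) ->
  viscosity_supersolution F (convolution u mu).
Proof.
move=> hFsub hFell hu loc wfin.
have [c [Phi gPhi]] := gauss_cdf_exists R.
split.
- by move=> x; exact: (convolution_ninfty hu loc x).
- exact: (convolution_lsc hu loc).
(* Density only needs some invertible [S] below [F], here the one supporting [F] at 0. *)
- have [S [S_unit S_le _]] := elliptic_support hFsub hFell (trmx0 R n n).
  exact: (convolution_dense gPhi hu loc S_unit S_le).
move=> x0 phi U oU C2 phix0 phile; set H := hessian phi x0.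
have HT : H^T = H by apply/matrixP => i j; rewrite mxE; exact: C2_hessian_sym oU C2.
have [S [S_unit S_le S_eq]] := elliptic_support hFsub hFell HT.
rewrite -S_eq; set s := `|\tr (S *m S^T)|.
apply/ler_addgt0Pl => e' e'0; rewrite addr0.
pose e := e' / (2 * s + 1).
have s0 : 0 <= s by exact: normr_ge0.
have s1 : 0 < 2 * s + 1 by lra.
have e0 : 0 < e by rewrite divr_gt0.
have [r r0 hr] := C2_taylor oU C2 e0.
have := @quadratic_touch R c Phi gPhi n F u hu mu loc S S_unit S_le x0
  (gradient phi x0) (H - (2 * e)%:M) (phi x0) r r0 (esym phix0) _.
have -> : \tr (S *m (H - (2 * e)%:M) *m S^T) = \tr (S *m H *m S^T) - 2 * e * \tr (S *m S^T).
  rewrite mulmxBr mulmxBl linearB/= mul_mx_scalar -scalemxAl mxtraceZ.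
  by [].
move=> h; have {}h : \tr (S *m H *m S^T) - 2 * e * \tr (S *m S^T) <= 0.
  apply: h => z zr; have [Uz] := hr z zr; rewrite ler_norml => /andP[tay _].
  apply: le_trans (phile _ Uz); rewrite lee_fin.
  have -> : bil (H - (2 * e)%:M) z z = bil H z z - 2 * e * dot z z.
    rewrite !bil_dot mulmxBr mul_mx_scalar -[in LHS]scaleN1r dotDl !dotZl.
    by rewrite mulN1r.
  have : e * `|z| ^+ 2 <= e * dot z z by rewrite ler_pM2l// sqr_norm_le_dot.
  rewrite -/H in tay; lra.
have : 2 * e * \tr (S *m S^T) <= 2 * e * s.
  by rewrite ler_wpM2l ?ler_norm// mulr_ge0// ltW.
have : 2 * e * s <= e'.
  have -> : 2 * e * s = e' * (2 * s / (2 * s + 1)) by rewrite /e; ring.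
  by rewrite ler_piMr ?(ltW e'0)// ler_pdivrMr// mul1r; lra.
lra.
Qed.

Lemma enorm_le x : enorm x <= n%:R * `|x|.
Proof.
have -> : n%:R * `|x| = Num.sqrt ((n%:R * `|x|) ^+ 2).
  by rewrite sqrtr_sqr ger0_norm// mulr_ge0.
rewrite /enorm ler_sqrt ?sqr_ge0//.
apply: (@le_trans _ _ (\sum_(i < n) `|x| ^+ 2)).
  apply: ler_sum => i _; rewrite -[leLHS]real_normK ?num_real//.
  by rewrite ler_sqr ?nnegrE// coord_norm_le.
rewrite sumr_const card_ord exprMn -[`|x| ^+ 2 *+ n]mulr_natl ler_wpM2r ?sqr_ge0//.
rewrite expr2 -natrM ler_nat; have [-> //|n_gt0] := posnP n.
exact: leq_pmulr.
Qed.
Lemma norm_le_enorm x : `|x| <= enorm x.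
Proof.
rewrite /enorm; apply: norm_le_coord => [|i]; first exact: sqrtr_ge0.
rewrite -sqrtr_sqr ler_sqrt ?sumr_ge0// => [|j _]; last exact: sqr_ge0.
by rewrite (bigD1 i)//= lerDl sumr_ge0// => j _; exact: sqr_ge0.
Qed.

Lemma open_borel (A : set 'rV[R]_n) : open A -> measurable (A : set (borelRn R n)).
Proof. by move=> oA; exact: sub_sigma_algebra. Qed.

Lemma closed_borel (A : set 'rV[R]_n) : closed A -> measurable (A : set (borelRn R n)).
Proof.
move=> cA; rewrite -[A]setCK; apply: measurableC; apply: open_borel.
exact: closed_openC.
Qed.

Lemma ge0_locally_dominated u mu : (forall x, 0 <= u x)%E -> locally_dominated u mu.
Proof.
move=> u0 r r0; exists setT, (fun=> 0), setT; split=> //.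
split.
- exact: measurableT.
- by rewrite setCT measure0.
- exact: measurable_cst.
- by [].
- by rewrite integral0 ltry.
- exact: openT.
- by move=> x y _ _; rewrite oppr0.
Qed.

(** An integrable [C] is finite outside a null set [N], where [fine (C y)] is the real bound; it is
    nonnegative because [u^-] is. *)
Lemma integrable_locally_dominated u mu :
  (forall r : R, 0 < r -> exists C : borelRn R n -> \bar R,
     mu.-integrable [set: borelRn R n] C /\
     forall x y, eball0 r x -> (u^\- (x - y)%R <= C y)%E) ->
  locally_dominated u mu.
Proof.
move=> h r r0.
(* The sup-norm ball of radius [r] lies in the Euclidean ball of radius [n r + 1]. *)
have nr : 0 < n%:R * r + 1 by rewrite ltr_wpDl// mulr_ge0// ltW.
have [C [Cint Cle]] := h _ nr.
have C0 y : (0 <= C y)%E.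
  have : eball0 (n%:R * r + 1) (0 : 'rV[R]_n).
    by rewrite /eball0/= (le_lt_trans (enorm_le _))// normr0 mulr0.
  move=> /(Cle 0 y); apply: le_trans; exact: funeneg_ge0.
have [N [mN N0 hN]] := integrable_ae measurableT Cint.
have mCf : measurable_fun setT C by have /integrableP[] := Cint.
exists (~` N), (fine \o C), [set x | `|x| < r]; split => //.
have Cfin y : (~` N) y -> (fine (C y))%:E = C y.
  move=> Ny; rewrite fineK//; apply: contrapT => Cy; apply: Ny; apply: hN => /= hC.
  by apply: Cy; exact: hC.
split.
- exact: measurableC.
- by rewrite setCK.
- apply: measurableT_comp => //.
  by apply: measurableT_comp => //; exact: fine_measurable.
- by move=> y; exact: fine_ge0.
- apply: (@le_lt_trans _ _ (\int[mu]_y C y)%E); last exact: integrable_lty Cint.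
  rewrite (eq_integral C) => [|y]; last by rewrite inE => /Cfin.
  by apply: ge0_subset_integral => //; exact: measurableC.
- by have := @ball_open R 'rV[R]_n 0 r; rewrite -ball_normE/=; congr open; apply/seteqP; split => x /=; rewrite sub0r normrN.
- move=> x y xr Ny; have -> : (- (fine \o C) y)%:E = (- C y)%E by rewrite -(Cfin y Ny).
  rewrite leeNl.
  have ex : eball0 (n%:R * r + 1) x.
    rewrite /eball0/= (le_lt_trans (enorm_le _))// ltr_pwDr// ler_wpM2l//.
    exact: ltW.
  apply: le_trans (Cle x y ex); rewrite funenegE.
  by rewrite le_max lexx.
Qed.

End ConvolutionSupersolution.

(** * Measures with compact support *)

Section CompactSupport.
Variables (R : realType) (n : nat).
Variables (mu : {measure set (borelRn R n) -> \bar R}).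
Hypothesis hmu : Radon mu.
Implicit Types (u : 'rV[R]_n -> \bar R) (x y z : 'rV[R]_n) (U N : set 'rV[R]_n).

Lemma lsc_compact_lower_bound u (K : set 'rV[R]_n) :
  lower_semicontinuous u -> (forall x, u x != -oo%E) -> compact K ->
  exists2 b : R, 0 <= b & forall x, K x -> ((- b)%:E <= u x)%E.
Proof.
move=> lu uN /compact_near_coveringP cov.
have := cov nat \oo (fun i x => ((- i%:R)%:E < u x)%E) _ _.
case=> [x Kx|N _ hN].
  have [a ax] : exists a : R, (a%:E < u x)%E.
    have := uN x; case: (u x) => [v|_|//]; last by exists 0; exact: ltry.
    by exists (v - 1); rewrite lte_fin; lra.
  have [V Vx Va] := lu _ _ ax.
  exists (V, [set i | - a <= i%:R]).
    by split => //=; exact: nbhs_infty_ger.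
  by move=> [y i] /= [Vy ai]; apply: le_lt_trans (Va y Vy); rewrite lee_fin; lra.
by exists N%:R => // x Kx; apply: ltW; exact: (hN N (leqnn N)).
Qed.

Lemma closed_msupport : closed (msupport mu).
Proof.
rewrite -[msupport mu]setCK; apply: open_closedC.
rewrite openE => x /= /existsNP[U /not_implyP[[oU Ux] U0]].
have : nbhs x U by exact: open_nbhs_nbhs.
by apply: filterS => y Uy; apply/existsNP; exists U; apply/not_implyP; split.
Qed.

(** By inner regularity it suffices to treat a compact [K] off the support, and finitely many open
    null sets cover it. *)
Lemma msupportC_null : mu (~` msupport mu : set (borelRn R n)) = 0%E.
Proof.
have [_ _ inner] := hmu.
have oS : open (~` msupport mu) by exact/closed_openC/closed_msupport.
rewrite inner//; apply/eqP; rewrite eq_le; apply/andP; split; last first.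
  by apply: ereal_sup_ubound; exists set0; [split; [exact: compact0|exact: sub0set]|rewrite measure0].
apply: ge_ereal_sup => _ [K [cK KS] <-].
pose null U := open U /\ mu (U : set (borelRn R n)) = 0%E.
suff [N [[oN N0] KN]] : exists N, null N /\ K `<=` N.
  rewrite -N0; apply: le_measure => //; rewrite inE.
    by apply: closed_borel; apply: compact_closed cK; exact: norm_hausdorff.
  exact: open_borel.
apply: contrapT => nocover.
(* The finite cover in terms of filters: if no open null set contained [K], this filter would be
   proper and cluster at a point of [K], which has an open null neighbourhood. *)
pose F : set_system 'rV[R]_n := [set A | exists2 N, null N & K `\` N `<=` A].
have null0 : null set0 by split; [exact: open0|exact: measure0].
have nullU U N : null U -> null N -> null (U `|` N).
  move=> [oU U0] [oN N0]; split; first exact: openU.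
  by rewrite measureU0//; exact: open_borel.
have Fproper : ProperFilter F.
  split.
    move=> [N nN KN]; apply: nocover; exists N; split => // x Kx.
    by apply: contrapT => Nx; exact: (KN x).
  split.
  - by exists set0.
  - move=> A1 A2 [N1 h1 k1] [N2 h2 k2]; exists (N1 `|` N2); first exact: nullU.
    by move=> x [Kx /not_orP[x1 x2]]; split; [exact: k1|exact: k2].
  - by move=> A1 A2 A12 [N h k]; exists N => //; exact: subset_trans A12.
have FK : F K by exists set0 => //; exact: subDsetl.
have [x [Kx Fx]] := cK F Fproper FK.
have /existsNP[U /not_implyP[[oU Ux] U0]] := KS x Kx.
have nU : null U.
  split => //; apply/eqP; rewrite eq_le measure_ge0 andbT leNgt; exact/negP.
have FKU : F (K `\` U) by exists U.
by have [y [[]]] := Fx _ U FKU (open_nbhs_nbhs (conj oU Ux)).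
Qed.

(** For bounded [x] and [y] in the support, [x - y] stays in a compact set, where [u] is bounded
    below; a constant is integrable because the support has finite measure. *)
Lemma compact_locally_dominated u : lower_semicontinuous u -> (forall x, u x != -oo%E) ->
  compact (msupport mu) -> locally_dominated u mu.
Proof.
move=> lu uN cS r r0.
have [M [_ hM]] := compact_bounded cS.
pose m := Num.max M 0 + 1.
have m0 : 0 < m by rewrite /m ltr_wpDl// le_max lexx orbT.
have Sm y : msupport mu y -> `|y| <= m.
  by apply: hM; rewrite /m ltr_pwDr// le_max lexx.
have cB : compact [set x : 'rV[R]_n | `|x| <= r + m].
  have -> : [set x : 'rV[R]_n | `|x| <= r + m] =
      [set s | forall i, `[- (r + m), r + m]%classic (s ord0 i)].
    apply/seteqP; split => s /= h.
      by move=> i; rewrite in_itv/= -ler_norml (le_trans (coord_norm_le s i)).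
    apply: norm_le_coord => [|i]; last by have := h i; rewrite in_itv/= -ler_norml.
    by rewrite addr_ge0// ltW.
  by apply: (@rV_compact R n (fun=> `[- (r + m), r + m]%classic)) => i; exact: segment_compact.
have [b b0 hb] := lsc_compact_lower_bound lu uN cB.
have mS : measurable (msupport mu : set (borelRn R n)) := closed_borel closed_msupport.
exists (msupport mu), (fun=> b), [set x | `|x| < r]; split => [|//]; split.
- exact: mS.
- exact: msupportC_null.
- exact: measurable_cst.
- by [].
- have [fin _ _] := hmu.
  apply: (@le_lt_trans _ _ (b%:E * mu (msupport mu))%E).
    by rewrite -(integral_cst mu mS b%:E).
  apply: lte_mul_pinfty => //; exact: fin.
- by have := @ball_open R 'rV[R]_n 0 r; rewrite -ball_normE/=; congr open; apply/seteqP; split => x /=; rewrite sub0r normrN.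
- move=> x y xr Sy; apply: hb => /=.
  by rewrite (le_trans (ler_normB _ _))// lerD//; [exact: ltW|exact: Sm].
Qed.

End CompactSupport.

(** * Finiteness of Riesz potentials *)

Section RieszPotential.
Variables (R : realType) (n : nat) (hn : (0 < n)%N).
Variables (mu : {measure set (borelRn R n) -> \bar R}).
Hypothesis hmu : Radon mu.
Variables (F : 'M[R]_n -> R) (u : 'rV[R]_n -> \bar R) (c a : R).
Hypotheses (hFsub : sublinear F) (hFell : uniformly_elliptic F).
Hypothesis hu : viscosity_supersolution F u.
Hypotheses (c0 : 0 < c) (a0 : a < 0).
Hypothesis uE : u = (fun x => c%:E * enorm_negpow a x)%E.
Hypothesis tail : (\int[mu]_(y in [set y : borelRn R n |
   (1 <= enorm (y : 'rV[R]_n))%R]) enorm_negpow a y < +oo)%E.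

Let enorm_negpow_ge0 (x : 'rV[R]_n) : (0 <= enorm_negpow a x)%E.
Proof. by rewrite /enorm_negpow; case: ifP => // _; rewrite lee_fin powR_ge0. Qed.

Let u_ge0 x : (0 <= u x)%E.
Proof. by rewrite uE mule_ge0// lee_fin ltW. Qed.

Let powR_anti (s t : R) : 0 < s -> s <= t -> t `^ a <= s `^ a.
Proof.
move=> s0 st; have t0 : 0 < t by exact: (lt_le_trans s0 st).
have E x : x `^ a = (x `^ (- a))^-1 by rewrite powRN invrK.
rewrite !E lef_pV2 ?posrE ?powR_gt0//.
by apply: (@ge0_ler_powR R (- a) _ s t _ _ st); rewrite ?nnegrE ?oppr_ge0; exact: ltW.
Qed.

(** Measurability is inherited from the lower semicontinuous [u] on division by [c > 0]. *)
Let mneg : measurable_fun setT (fun y : borelRn R n => enorm_negpow a (y : 'rV[R]_n)).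
Proof.
have [_ lu _ _] := hu.
have mu' : measurable_fun setT (fun y : borelRn R n => ((c^-1)%:E * u (y : 'rV[R]_n))%E).
  by apply: measurable_funeM; exact: lsc_borel lu.
apply: eq_measurable_fun mu' => y _ /=.
by rewrite uE muleA -EFinM mulVf ?gt_eqF// mul1e.
Qed.

Let ext_meas : measurable ([set y : 'rV[R]_n | 1 <= enorm y] : set (borelRn R n)).
Proof.
pose g (y : 'rV[R]_n) : R := \sum_(i < n) y ord0 i ^+ 2.
have -> : [set y : 'rV[R]_n | 1 <= enorm y] = [set y | 1 <= g y].
  have gE y : (1 <= enorm y) = (1 <= g y).
    rewrite /enorm -[X in X <= _]sqrtr1 ler_sqrt// sumr_ge0// => i _.
    exact: sqr_ge0.
  by apply/seteqP; split => y /=; rewrite gE.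
apply: closed_borel; apply: (@closed_comp _ _ g [set t | 1 <= t]); last exact: closed_ge.
move=> y _; apply: continuous_big_sum => i.
have ci : {for y, continuous (fun y : 'rV[R]_n => y ord0 i)} by exact: coord_continuous.
exact: (continuousM ci ci).
Qed.

Let near_part : set (borelRn R n) := [set y : 'rV[R]_n | `|y| < 2].

Let near_ball : near_part = ball (0 : 'rV[R]_n) 2.
Proof. by apply/seteqP; split => x; rewrite -ball_normE /near_part /= sub0r normrN. Qed.

Let near_meas : measurable near_part.
Proof. by rewrite near_ball; apply: open_borel; exact: ball_open. Qed.

Let near_fin : (mu near_part < +oo)%E.
Proof.
have [fin _ _] := hmu.
have cB : compact [set s : 'rV[R]_n | forall i, `[- 2, 2]%classic (s ord0 i)].
  by apply: (@rV_compact R n (fun=> `[- 2, 2]%classic)) => i; exact: segment_compact.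
apply: le_lt_trans (fin _ cB); apply: le_measure; rewrite ?inE//.
  by apply: closed_borel; apply: compact_closed cB; exact: norm_hausdorff.
move=> x /= x2 i; rewrite in_itv/= -ler_norml.
by rewrite (le_trans (coord_norm_le x i))// ltW.
Qed.

(* The restriction of [mu] to a ball has a finite convolution at points far from
   that ball, hence on a dense set; the rest of [mu] is controlled by the decay
   of the potential. *)
Lemma potential_finite_somewhere : exists x, convolution u mu x <> +oo%E.
Proof.
have [_ lu _ _] := hu.
have n0 : 0 < n%:R :> R by rewrite ltr0n.
have e00 : enorm (0 : 'rV[R]_n) <= 0 by have := enorm_le (0 : 'rV[R]_n); rewrite normr0 mulr0.
have mu_shift x : measurable_fun setT (fun y : borelRn R n => u (x - (y : 'rV[R]_n))).
  by apply: lsc_borel; exact: lsc_comp lu (@continuous_reflect R n x).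
pose mu1 : {measure set (borelRn R n) -> \bar R} := mrestr mu near_meas.
have nearE x : (\int[mu1]_(y in near_part) u (x - (y : 'rV[R]_n))%R =
    \int[mu]_(y in near_part) u (x - (y : 'rV[R]_n))%R)%E.
  apply: eq_measure_integral => A mA /setIidl AE; by rewrite /mu1/= /mrestr AE.
have mu1E x : convolution u mu1 x = (\int[mu]_(y in near_part) u (x - (y : 'rV[R]_n))%R)%E.
  rewrite -nearE /convolution.
  rewrite (@ge0_negligible_integral _ _ _ mu1 setT (~` near_part)) ?setTD ?setCK//.
  - exact: measurableC.
  - by rewrite /mu1/= /mrestr setICl measure0.
(* The point is sought in the unit ball in order to have [|x - y| >= |y| / 2] whenever
   [|y| >= 2]. *)
have [x [xx xfin]] : (ball (0 : 'rV[R]_n) 1 `&` [set x | convolution u mu1 x \is a fin_num]) !=set0.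
  have [cc [Phi gPhi]] := gauss_cdf_exists R.
  have [S [S_unit S_le _]] := elliptic_support hFsub hFell (trmx0 R n n).
  apply: (convolution_dense gPhi hu (ge0_locally_dominated mu1 u_ge0) S_unit S_le).
  (* This point is at distance at least 1 from all [y] with [|y| < 2], so the integrand is at most
     [c]. *)
  - exists (const_mx 3); rewrite mu1E.
    suff : (\int[mu]_(y in near_part) u (const_mx 3 - (y : 'rV[R]_n))%R < +oo)%E.
      by case: (\int[mu]_(y in near_part) _)%E.
    apply: (@le_lt_trans _ _ (\int[mu]_(y in near_part) (cst c%:E y))%E); last first.
      rewrite integral_cst//; apply: lte_mul_pinfty => //.
      by rewrite lee_fin ltW.
    apply: ge0_le_integral => //.
    + exact: measurable_funS (mu_shift _).
    + move=> y /= y2; pose i0 := Ordinal hn.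
      have far : 1 <= enorm (const_mx 3 - (y : 'rV[R]_n)).
        apply: le_trans (norm_le_enorm _); apply: le_trans (coord_norm_le _ i0).
        have := le_lt_trans (coord_norm_le (y : 'rV[R]_n) i0) y2.
        rewrite !mxE ltr_norml => /andP[h1 h2].
        by apply: le_trans (ler_norm _); lra.
      rewrite uE /enorm_negpow; case: eqP => [E|_].
        by have := lt_le_trans ltr01 far; rewrite E ltNge e00.
      rewrite -EFinM lee_fin ler_piMr ?(ltW c0)//.
      by have := powR_anti ltr01 far; rewrite powR1.
  - by exists 0; exact: ballxx.
  - exact: ball_open.
exists x; rewrite /convolution.
have -> : (\int[mu]_y u (x - (y : 'rV[R]_n))%R =
   \int[mu]_(y in near_part) u (x - (y : 'rV[R]_n))%R +
   \int[mu]_(y in ~` near_part) u (x - (y : 'rV[R]_n))%R)%E.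
  rewrite -ge0_integral_setU ?setUv//; first exact: measurableC.
  by apply/disj_setPS; rewrite setICr.
rewrite -mu1E; set far_int := (\int[mu]_(y in ~` _) _)%E.
have combine : (far_int < +oo -> convolution u mu1 x + far_int <> +oo)%E.
  rewrite -(fineK xfin); case: far_int => [v|//|//] _.
  by rewrite -EFinD.
apply: combine.
(* Passing between the two norms gives [enorm (x - y) >= enorm y / (2 n)]; as [a < 0], raising to
   the power [a] costs the factor [(2 n)^(- a)]. *)
pose k := c * (2 * n%:R) `^ (- a).
have k0 : 0 <= k by rewrite mulr_ge0 ?powR_ge0 ?ltW.
apply: (@le_lt_trans _ _ (\int[mu]_(y in ~` near_part) (k%:E * enorm_negpow a (y : 'rV[R]_n)))%E).
  apply: ge0_le_integral => //.
  - exact: measurableC.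
  - exact: measurable_funS (mu_shift _).
  - by apply: measurable_funeM; exact: measurable_funS mneg.
  - move=> y /= /negP; rewrite -leNgt => y2.
    have x1 : `|x| < 1 by move: xx; rewrite -ball_normE /= sub0r normrN.
    have ey : 2 <= enorm (y : 'rV[R]_n) by apply: le_trans y2 (norm_le_enorm _).
    have y0 : (y : 'rV[R]_n) != 0 by apply: contraTneq y2 => ->; rewrite normr0; lra.
    have xy : `|y : 'rV[R]_n| / 2 <= `|x - (y : 'rV[R]_n)|.
      by have := lerB_dist (y : 'rV[R]_n) x; rewrite distrC; lra.
    have exy : enorm (y : 'rV[R]_n) / (2 * n%:R) <= enorm (x - (y : 'rV[R]_n)).
      apply: le_trans (norm_le_enorm _); apply: le_trans xy.
      rewrite invfM mulrA ler_pdivrMr// mulrAC ler_pM2r ?invr_gt0// mulrC.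
      exact: enorm_le.
    have q0 : 0 < enorm (y : 'rV[R]_n) / (2 * n%:R) by rewrite divr_gt0 ?mulr_gt0//; lra.
    rewrite uE /enorm_negpow (negbTE y0); case: eqP => [E|_].
      by have := lt_le_trans q0 exy; rewrite E ltNge e00.
    rewrite -!EFinM lee_fin /k -mulrA ler_pM2l//.
    apply: le_trans (powR_anti q0 exy) _.
    rewrite powRM ?invr_ge0 ?mulr_ge0 ?(ltW n0)//; last lra.
    have n2 : 0 <= 2 * n%:R :> R by rewrite mulr_ge0// ltW.
    by rewrite mulrC -(powR_inv1 n2) -powRrM mulN1r.
rewrite ge0_integralZl_EFin//; first last.
- exact: measurable_funS mneg.
- exact: measurableC.
apply: lte_mul_pinfty => //.
apply: le_lt_trans tail; apply: ge0_subset_integral => //.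
- exact: measurableC.
- exact: measurable_funS mneg.
- move=> y /= /negP; rewrite -leNgt => y2.
  by apply: le_trans (norm_le_enorm _); apply: le_trans y2; lra.
Qed.

End RieszPotential.

Theorem theorem4p3p1 (R : realType) (n : nat) (hn : (2 <= n)%N)
    (F : 'M[R]_n -> R) (hFsub : sublinear F) (hFell : uniformly_elliptic F)
    (u : 'rV[R]_n -> \bar R) (hu : viscosity_supersolution F u)
    (mu : {measure set (borelRn R n) -> \bar R}) (hmu : Radon mu)
    (hcond :
      [\/ (exists x, convolution u mu x <> +oo%E) /\
          (forall r : R, 0 < r ->
             exists C : borelRn R n -> \bar R,
               mu.-integrable [set: borelRn R n] C /\
               forall x y : 'rV[R]_n, eball0 r x -> (u^\- (x - y)%R <= C y)%E),
          (exists x, convolution u mu x <> +oo%E) /\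
          (forall x, 0 <= u x)%E,
          (exists c p : R,
             [/\ 0 <= c, 2 <= p, p < n%:R,
                 u = (fun x =>
                        c%:E * enorm_negpow ((p - n%:R) / (p - 1)) x)%E &
                 (\int[mu]_(y in [set y : borelRn R n |
                                    (1 <= enorm (y : 'rV[R]_n))%R])
                    (enorm_negpow ((p - n%:R) / (p - 1)) y) < +oo)%E]) |
          (exists x, convolution u mu x <> +oo%E) /\
          compact (msupport mu)]) :
  viscosity_supersolution F (convolution u mu).
Proof.
have sup := @convolution_supersolution R n F u mu hFsub hFell hu.
have [uN lu _ _] := hu.
case: hcond => [[wfin hC]|[wfin u0]|[c [p [c0 p2 pn uE tail]]]|[wfin cS]].
- exact/sup/wfin/integrable_locally_dominated.
- exact/sup/wfin/ge0_locally_dominated.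
- have e0 x : (0 <= enorm_negpow ((p - n%:R) / (p - 1)) x :> \bar R)%E.
    by rewrite /enorm_negpow; case: ifP => // _; rewrite lee_fin powR_ge0.
  have u0 x : (0 <= u x)%E by rewrite uE mule_ge0// lee_fin.
  apply: sup; first exact: ge0_locally_dominated.
  (* For [c = 0] the kernel is 0 also at the origin, by the convention for [0 * +oo], and [w]
     vanishes; for [c > 0] the exponent is negative because [p < n]. *)
  move: c0; rewrite le_eqVlt => /predU1P[cE|c0].
    exists 0; rewrite /convolution (eq_integral (cst 0%E)) ?integral0// => y _.
    by rewrite uE -cE mul0e.
  apply: potential_finite_somewhere hu c0 _ uE tail => //.
    exact: leq_trans hn.
  by rewrite pmulr_llt0 ?invr_gt0; lra.
- exact: sup (compact_locally_dominated hmu lu uN cS) wfin.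
Qed.
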